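(* Let $\xi$ be a real-valued random variable with zero mean and finite positive variance, and assume that the moment generating function $M_\xi(t)=\mathbb{E}(e^{t\xi})$ exists (is finite) in an open interval around zero. Let $\{\xi_k : k\ge 0\}$ be a sequence of independent identically distributed random variables with $\xi_k$ equal in distribution to $\xi$ for every $k\ge 0$, and let $G_n(z)=\sum_{j=0}^{n-1}\xi_j z^j$ for $z\in\mathbb{C}$. For $t\ge 1$, $\gamma>1/2$ and $n\ge 2$ let $\mathcal{M}_n$ be the event $$\mathcal{M}_n:=\left\{\ \min_{z\in\mathbb{C}\,:\,\big||z|-1\big|\le t n^{-2}(\log n)^{-1/2-\gamma}}|G_n(z)|\ \le\ t\,n^{-1/2}(\log n)^{-\gamma}\right\}.$$ Then, for any fixed $t\ge 1$ and $\gamma>1/2$, $$\mathbb{P}(\mathcal{M}_n)=O\big((\log n)^{-\gamma+1/2}\big)\qquad (n\to\infty),$$ where the implicit constant in the $O$-notation depends on $t$ and the moment generating function of $\xi$.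
   Context: $|\cdot|$ denotes the complex modulus. *)

(* Defs.v *)
From HB Require Import structures.
From mathcomp Require Import all_boot all_order all_algebra.
From mathcomp Require Import complex.
From mathcomp Require Import all_classical all_reals all_analysis.

Set Implicit Arguments.
Unset Strict Implicit.
Unset Printing Implicit Defensive.

Import Order.TTheory GRing.Theory Num.Theory.
Import numFieldNormedType.Exports.
Import ComplexField.

Local Open Scope classical_set_scope.
Local Open Scope ring_scope.
Local Open Scope complex_scope.

Definition mutually_independent (d : measure_display) (T : measurableType d)
    (R : realType) (P : probability T R) (X : nat -> {RV P >-> R}) : Prop :=
  forall (s : seq nat) (B : nat -> set R),
    uniq s -> (forall i, measurable (B i)) ->
    P (\bigcap_(i in [set` s]) (X i @^-1` B i)) =
      (\prod_(i <- s) P (X i @^-1` B i))%E.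

Arguments mutually_independent {d T R} P X.

(* The quantification over A is restricted to Borel sets because measures are
   total functions, with unspecified values on non-measurable sets. *)
Definition equal_in_distribution
    (d : measure_display) (T : measurableType d)
    (d' : measure_display) (T' : measurableType d') (R : realType)
    (P : probability T R) (P' : probability T' R)
    (X : {RV P >-> R}) (Y : {RV P' >-> R}) : Prop :=
  forall A : set R, measurable A -> distribution P X A = distribution P' Y A.

Arguments equal_in_distribution {d T d' T' R} P P' X Y.

Definition kac_poly (R : realType) (a : nat -> R) (n : nat) (z : R[i]) : R[i] :=
  \sum_(j < n) (a j)%:C * z ^+ j.

(* The library's norm `|z| takes its values in R[i]. *)
Definition cmod (R : realType) (z : R[i]) : R := Normc.normc z.

Definition unit_circle_nbhd (R : realType) (r : R) : set R[i] :=
  [set z | `|cmod z - 1| <= r].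

(* For r >= 0 the set unit_circle_nbhd r is nonempty and compact, and kac_poly is
   continuous in z, so this infimum is attained: it is the minimum. *)
Definition min_modulus (R : realType) (a : nat -> R) (n : nat) (r : R) : R :=
  inf [set cmod (kac_poly a n z) | z in unit_circle_nbhd r].

Definition small_min_event (d : measure_display) (T : measurableType d)
    (R : realType) (xs : nat -> T -> R) (t gamma : R) (n : nat) : set T :=
  [set w | min_modulus (fun k => xs k w) n
             (t * n%:R `^ (- 2) * (ln n%:R) `^ (- 2^-1 - gamma))
           <= t * n%:R `^ (- 2^-1) * (ln n%:R) `^ (- gamma)].

(* Main.v *)
(* Let L = log n. Cover the annulus by a net of directions e^(i theta) with
   spacing h = n^(-2) L^(-1/2-gamma). Outside an event of negligible probability
   (Markov and Chernoff bounds) the derivative of G_n is O(n^(3/2) L^(1/2)) on the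
   net, so by a Taylor estimate a small value in the annulus forces
   |G_n(e^(i theta))| <= eps with eps = O(n^(-1/2) L^(-gamma)) for some theta in the
   net. Each of these events should have probability O(eps^2), and there are
   O(1/h) of them, whence the bound O(eps^2 / h) = O(L^(1/2-gamma)).

   By a discrete Esseen inequality the probability is at most 4 K^(-2) times the
   sum, over a grid of vectors u, of exp(- (1/2) sum_j psi(x_j)), where
   psi = 1 - |phi|^2 for the characteristic function phi of xi and
   x_j = u_1 cos(j theta) + u_2 sin(j theta). Short vectors give a Gaussian sum,
   since psi(x) >= c x^2 near 0. A long u may fail to make sum_j psi(x_j) >> L for
   a particular theta, but this happens for few pairs (theta, u): averaging over
   shifts, x_j lies at eight prescribed offsets in a set where psi is tiny, and that
   set consists of short clusters far apart because sqrt psi is subadditive up to a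
   factor. If two angles have the same cluster data, the rotating vectors stay
   close, so the angles are either almost equal or far apart, at several nested
   scales; counting clusters bounds the number of bad pairs. Angles within
   n^(-9/10) of the real axis are few enough for a coarser net and cruder bounds.

   The constant depends only on t and the variance, and the variance is determined
   by the moment generating function as its second-order coefficient at 0. *)
Require Import Defs.
From HB Require Import structures.
From mathcomp Require Import all_boot all_order all_algebra.
From mathcomp Require Import complex.
From mathcomp Require Import all_classical all_reals all_analysis.
From mathcomp Require Import measurable_realfun.
From mathcomp Require Import ring lra zify.

Set Implicit Arguments.
Unset Strict Implicit.
Unset Printing Implicit Defensive.

Import Order.TTheory GRing.Theory Num.Theory.
Import numFieldNormedType.Exports.

Local Open Scope classical_set_scope.
Local Open Scope ring_scope.

(** * Trigonometric and exponential inequalities *)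

(** The obstacle is that xi may be discrete, so psi may vanish far from 0: for fair signs, theta =
    pi / 2 and u = (pi, pi), every term psi (x_j) is zero. Hence no decay holds angle by angle, and
    only the sum over the net is bounded. With n = y^80, the bad pairs number at most y^143 per
    dyadic range of angles, while K^2 is of order y^160 up to logarithms. Three gap scales 7000 <=
    d2 <= d3 serve that count. Passing from one to the next costs a factor of about b d_(i+1) / d_i,
    where b is the cluster width, of order y^(-39). One jump from 7000 to d3, which may be of order
    n, would cost too much; with d2 of order sqrt d3 both ratios are at most of order n^(1/2) =
    y^40, and each cost is at most y^3. For the constant to depend only on t and the variance,
    everything else about the law must go into the threshold for n: the radius c0 where psi x >= c
    x^2, the radius of the moment generating function, the first absolute moment. What stays in the
    constant is c = variance / 4 and the subgaussian rate, which is the variance. *)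

Lemma deriv_ge0 (R : realType) (f df : R -> R) :
  (forall x : R, is_derive x 1 f (df x)) -> f 0 = 0 ->
  (forall x, 0 <= x -> 0 <= df x) -> forall x, 0 <= x -> 0 <= f x.
Proof.
move=> fd f0 df0 x x0.
have [|c cx] := @MVT_segment R f df 0 x x0 (fun z _ => fd z).
  by apply: derivable_within_continuous => z _; exact: ex_derive.
rewrite f0 !subr0 => ->; apply: mulr_ge0 => //; apply: df0.
by move: cx; rewrite in_itv/= => /andP[].
Qed.

Lemma sin_le_id (R : realType) (x : R) : 0 <= x -> sin x <= x.
Proof.
move=> x0; rewrite -subr_ge0.
apply: (@deriv_ge0 R (fun x => x - sin x) (fun x => 1 - cos x)) => //.
by rewrite sin0 subr0.
Qed.

Lemma cos_ge_quad (R : realType) (x : R) : 1 - x ^+ 2 / 2 <= cos x.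
Proof.
wlog x0 : x / 0 <= x.
  by move=> H; have [/H//|/ltW x0] := leP 0 x; rewrite -cosN -sqrrN H ?oppr_ge0.
rewrite -subr_ge0.
apply: (@deriv_ge0 R (fun x => cos x - (1 - x ^+ 2 / 2)) (fun x => x - sin x)) => //.
- move=> z; apply: is_derive_eq.
  rewrite /= !scaler0 !add0r ?addr0 /GRing.scale/=; lra.
- rewrite cos0; lra.
- by move=> z z0; rewrite subr_ge0 sin_le_id.
Qed.

Lemma sin_ge_cubic (R : realType) (x : R) : 0 <= x -> x - x ^+ 3 / 6 <= sin x.
Proof.
move=> x0; rewrite -subr_ge0.
apply: (@deriv_ge0 R (fun x => sin x - (x - x ^+ 3 / 6))
  (fun x => cos x - (1 - x ^+ 2 / 2))) => //.
- move=> z; apply: is_derive_eq.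
  rewrite /= !scaler0 !add0r ?addr0 /GRing.scale/=; lra.
- rewrite sin0; lra.
- by move=> z z0; rewrite subr_ge0 cos_ge_quad.
Qed.

Lemma cos_le_quartic (R : realType) (x : R) :
  cos x <= 1 - x ^+ 2 / 2 + x ^+ 4 / 24.
Proof.
wlog x0 : x / 0 <= x.
  move=> H; have [/H//|/ltW x0] := leP 0 x; rewrite -cosN.
  by apply: le_trans (H _ _) _; rewrite ?oppr_ge0// sqrrN (exprM _ 2 2) sqrrN -exprM.
rewrite -subr_ge0.
apply: (@deriv_ge0 R (fun x => (1 - x ^+ 2 / 2 + x ^+ 4 / 24) - cos x)
  (fun x => sin x - (x - x ^+ 3 / 6))) => //.
- move=> z; apply: is_derive_eq.
  rewrite /= !scaler0 !add0r ?addr0 /GRing.scale/=; lra.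
- rewrite cos0; lra.
- by move=> z z0; rewrite subr_ge0 sin_ge_cubic.
Qed.

Lemma sin_sub_id_le (R : realType) (x : R) : `|sin x - x| <= x ^+ 2 / 2.
Proof.
wlog x0 : x / 0 <= x.
  move=> H; have [/H//|/ltW x0] := leP 0 x.
  have := H (- x); rewrite oppr_ge0 => /(_ x0).
  by rewrite sinN sqrrN -opprD normrN.
rewrite distrC ger0_norm ?subr_ge0 ?sin_le_id// -subr_ge0.
apply: (@deriv_ge0 R (fun x => x ^+ 2 / 2 - (x - sin x))
  (fun x => x - (1 - cos x))) => //.
- move=> z; apply: is_derive_eq.
  rewrite /= !scaler0 !add0r ?addr0 /GRing.scale/=; lra.
- rewrite sin0; lra.
move=> z z0.
apply: (@deriv_ge0 R (fun x => x - (1 - cos x)) (fun x => 1 - sin x)) => //.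
- move=> y; apply: is_derive_eq; lra.
- rewrite cos0; lra.
Qed.

Lemma lip_of_deriv (R : realType) (f df : R -> R) :
  (forall x : R, is_derive x 1 f (df x)) -> (forall x, `|df x| <= 1) ->
  forall x y, `|f x - f y| <= `|x - y|.
Proof.
move=> fd df1 x y.
wlog xy : x y / y <= x.
  by move=> H; have [/H//|/ltW/H] := leP y x; rewrite distrC (distrC y).
have [|c _ ->] := @MVT_segment R f df y x xy (fun z _ => fd z).
  by apply: derivable_within_continuous => z _; exact: ex_derive.
by rewrite normrM ler_piMl.
Qed.

Lemma cos_lip (R : realType) (x y : R) : `|cos x - cos y| <= `|x - y|.
Proof.
by apply: (@lip_of_deriv R cos (fun x => - sin x)) => z; rewrite normrN sin_max.
Qed.

Lemma sin_lip (R : realType) (x y : R) : `|sin x - sin y| <= `|x - y|.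
Proof. by apply: (@lip_of_deriv R sin cos) => z; rewrite cos_max. Qed.

(** The factor is 1 - x^2 / 6 at x = 2. Dyadic scaling puts the rotation steps in [1, 2], whence the
    lower bound [3^-1] on sines below. *)
Lemma sin_ge_third (R : realType) (x : R) : 0 <= x <= 2 -> x / 3 <= sin x.
Proof.
case/andP=> x0 x2; apply: le_trans (sin_ge_cubic x0).
nra.
Qed.

Lemma one_sub_cos_ge (R : realType) (x : R) : `|x| <= 1 -> x ^+ 2 / 4 <= 1 - cos x.
Proof.
move=> x1; have := cos_le_quartic x.
have : x ^+ 2 <= 1 by rewrite -real_normK ?num_real// expr_le1.
have := sqr_ge0 x; rewrite (exprM _ 2 2).
nra.
Qed.

Lemma expR_third_order (R : realType) (y : R) :
  `|expR y - 1 - y - y ^+ 2 / 2| <= `|y| ^+ 3 * expR `|y|.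
Proof.
have pos1 z : 0 <= z -> (0 : R) <= expR z - 1 - z - z ^+ 2 / 2.
  move=> z0; apply: (@deriv_ge0 R (fun z => expR z - 1 - z - z ^+ 2 / 2)
    (fun z => expR z - 1 - z)) => //.
  - move=> x; apply: is_derive_eq; rewrite /GRing.scale/=; lra.
  - rewrite expR0; lra.
  - move=> x _; have := expR_ge1Dx x; lra.
have pos2 z : 0 <= z -> (0 : R) <= z ^+ 3 * expR z - (expR z - 1 - z - z ^+ 2 / 2).
  have z1 x : 0 <= x -> (0 : R) <= 6 * x * expR x - (expR x - 1).
    move=> x0; apply: (@deriv_ge0 R (fun x => 6 * x * expR x - (expR x - 1))
      (fun x => 6 * x * expR x + 5 * expR x)) => //.
    - move=> x'; apply: is_derive_eq; rewrite /GRing.scale/=; lra.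
    - rewrite expR0; lra.
    - move=> x' x'0; have := expR_ge0 x'; nra.
  have z2 x : 0 <= x -> (0 : R) <= 3 * x ^+ 2 * expR x - (expR x - 1 - x).
    move=> x0; apply: (@deriv_ge0 R (fun x => 3 * x ^+ 2 * expR x - (expR x - 1 - x))
      (fun x => 6 * x * expR x - (expR x - 1) + 3 * x ^+ 2 * expR x)) => //.
    - move=> x'; apply: is_derive_eq; rewrite /GRing.scale/=; lra.
    - rewrite expR0; lra.
    - move=> x' x'0; rewrite addr_ge0 ?z1// mulr_ge0 ?expR_ge0// mulr_ge0 ?sqr_ge0//.
  move=> z0; apply: (@deriv_ge0 R (fun z => z ^+ 3 * expR z - (expR z - 1 - z - z ^+ 2 / 2))
      (fun x => 3 * x ^+ 2 * expR x - (expR x - 1 - x) + x ^+ 3 * expR x)) => //.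
  - move=> x'; apply: is_derive_eq; rewrite /GRing.scale/=; lra.
  - rewrite expR0; lra.
  - by move=> x' x'0; rewrite addr_ge0 ?z2// mulr_ge0 ?expR_ge0// exprn_ge0.
have [y0|/ltW y0] := leP 0 y.
  by rewrite !ger0_norm ?pos1// -subr_ge0 pos2.
rewrite (ler0_norm y0); have : 0 <= - y by rewrite oppr_ge0.
move: (- y) (opprK y) => z <- z0 {y y0}; rewrite sqrrN.
have n1 : (0 : R) <= - (expR (- z) - 1 + z - z ^+ 2 / 2).
  apply: (@deriv_ge0 R (fun z => - (expR (- z) - 1 + z - z ^+ 2 / 2))
      (fun z => expR (- z) - 1 + z)) => //.
  - move=> x'; apply: is_derive_eq; rewrite /GRing.scale/=; lra.
  - rewrite oppr0 expR0; lra.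
  - move=> x _; have := expR_ge1Dx (- x); lra.
have n2 : (0 : R) <= z ^+ 3 + (expR (- z) - 1 + z - z ^+ 2 / 2).
  apply: (@deriv_ge0 R (fun z => z ^+ 3 + (expR (- z) - 1 + z - z ^+ 2 / 2))
      (fun z => 3 * z ^+ 2 - (expR (- z) - 1 + z))) => //.
  - move=> x'; apply: is_derive_eq; rewrite /GRing.scale/=; lra.
  - rewrite oppr0 expR0; lra.
  move=> x x0.
  apply: (@deriv_ge0 R (fun z => 3 * z ^+ 2 - (expR (- z) - 1 + z))
      (fun z => 6 * z + (expR (- z) - 1))) => //.
  - move=> x'; apply: is_derive_eq; rewrite /GRing.scale/=; lra.
  - rewrite oppr0 expR0; lra.
  - move=> x' x'0; have := expR_ge1Dx (- x'); lra.
rewrite ler0_norm; last by rewrite -oppr_ge0.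
have : (1 : R) <= expR z by rewrite -expR0 ler_expR.
have := exprn_ge0 3 z0; nra.
Qed.

(** * Rotating vectors and lattice counting *)

(** Inner product of [u] with (cos x, sin x); [roty] is its derivative in [x]. Together they are the
    coordinates of [u] in a frame turned by [x], so advancing the index j is a rotation of this
    state. *)
Definition rotx (R : realType) (u : R * R) (x : R) : R := u.1 * cos x + u.2 * sin x.

Definition roty (R : realType) (u : R * R) (x : R) : R := u.2 * cos x - u.1 * sin x.

Section Rotation.
Context {R : realType}.
Implicit Types (u v : R * R) (x y a b r : R).

Lemma rotxD u x y : rotx u (x + y) = rotx u x * cos y + roty u x * sin y.
Proof. by rewrite /rotx /roty cosD sinD; ring. Qed.

Lemma rotyD u x y : roty u (x + y) = roty u x * cos y - rotx u x * sin y.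
Proof. by rewrite /rotx /roty cosD sinD; ring. Qed.

Lemma rot_norm u x : rotx u x ^+ 2 + roty u x ^+ 2 = u.1 ^+ 2 + u.2 ^+ 2.
Proof.
have -> : rotx u x ^+ 2 + roty u x ^+ 2 =
    (u.1 ^+ 2 + u.2 ^+ 2) * (cos x ^+ 2 + sin x ^+ 2) by rewrite /rotx /roty; ring.
by rewrite cos2Dsin2 mulr1.
Qed.

Lemma normr_le_sqr a b r : 0 <= r -> a ^+ 2 + b ^+ 2 <= r ^+ 2 -> `|a| <= r.
Proof.
move=> r0 ab; rewrite -(@ler_pXn2r _ 2%N)// ?nnegrE// real_normK ?num_real//.
by apply: le_trans ab; rewrite lerDl sqr_ge0.
Qed.

Lemma rotx_le u x r : 0 <= r -> u.1 ^+ 2 + u.2 ^+ 2 <= r ^+ 2 -> `|rotx u x| <= r.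
Proof. by move=> r0 ur; apply: (@normr_le_sqr _ (roty u x)); rewrite ?rot_norm. Qed.

Lemma roty_le u x r : 0 <= r -> u.1 ^+ 2 + u.2 ^+ 2 <= r ^+ 2 -> `|roty u x| <= r.
Proof.
by move=> r0 ur; apply: (@normr_le_sqr _ (rotx u x)); rewrite // addrC rot_norm.
Qed.

Lemma norm_sqr_le a r : `|a| <= r -> a ^+ 2 <= r ^+ 2.
Proof.
move=> ar; rewrite -(real_normK (num_real a)) lerXn2r ?nnegrE//.
exact: le_trans (normr_ge0 _) ar.
Qed.

Lemma norm_mul_cos a x : `|a * cos x| <= `|a|.
Proof. by rewrite normrM ler_piMr// cos_max. Qed.

Lemma norm_mul_sin a x : `|a * sin x| <= `|a|.
Proof. by rewrite normrM ler_piMr// sin_max. Qed.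

(* Two consecutive values of the first coordinate along a rotation of angle f
   determine the second one, since rotx u (x + f) = X cos f + Y sin f. *)
Lemma roty_diff u v x y f g b r :
  3^-1 <= `|sin f| -> 0 <= r -> v.1 ^+ 2 + v.2 ^+ 2 <= r ^+ 2 ->
  `|rotx u x - rotx v y| <= b -> `|rotx u (x + f) - rotx v (y + g)| <= b ->
  `|roty u x - roty v y| <= 6 * b + 6 * r * `|f - g|.
Proof.
move=> sf r0 vr; rewrite !rotxD.
move: (rotx_le y r0 vr) (roty_le y r0 vr).
move: (rotx u x) (rotx v y) (roty u x) (roty v y) => X X' Y Y' X'r Y'r dX dX1.
have E : (Y - Y') * sin f = ((X * cos f + Y * sin f) - (X' * cos g + Y' * sin g))
   - (X - X') * cos f - X' * (cos f - cos g) - Y' * (sin f - sin g) by ring.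
have : `|(Y - Y') * sin f| <= 2 * b + 2 * r * `|f - g|.
  rewrite E.
  have h1 := norm_mul_cos (X - X') f.
  have h2 : `|X' * (cos f - cos g)| <= r * `|f - g|.
    by rewrite normrM ler_pM// cos_lip.
  have h3 : `|Y' * (sin f - sin g)| <= r * `|f - g|.
    by rewrite normrM ler_pM// sin_lip.
  apply: le_trans (ler_normB _ _) _.
  apply: le_trans (lerD (ler_normB _ _) h3) _.
  have := ler_normB (X * cos f + Y * sin f - (X' * cos g + Y' * sin g)) ((X - X') * cos f).
  lra.
rewrite normrM; have := normr_ge0 (Y - Y'); nra.
Qed.

(** An a priori estimate of the drift between two states turned by different angles; it brings
    values at distant offsets within [c0], where the cluster property takes over. *)
Lemma rotx_diff u v x y f g b c r :
  0 <= r -> v.1 ^+ 2 + v.2 ^+ 2 <= r ^+ 2 ->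
  `|rotx u x - rotx v y| <= b -> `|roty u x - roty v y| <= c ->
  `|rotx u (x + f) - rotx v (y + g)| <= b + c + 2 * r * `|f - g|.
Proof.
move=> r0 vr; rewrite !rotxD.
move: (rotx_le y r0 vr) (roty_le y r0 vr).
move: (rotx u x) (rotx v y) (roty u x) (roty v y) => X X' Y Y' X'r Y'r dX dY.
have -> : X * cos f + Y * sin f - (X' * cos g + Y' * sin g) =
  (X - X') * cos f + (Y - Y') * sin f + X' * (cos f - cos g) + Y' * (sin f - sin g).
  by ring.
have h0 := norm_mul_sin (Y - Y') f.
have h1 := norm_mul_cos (X - X') f.
have h2 : `|X' * (cos f - cos g)| <= r * `|f - g|.
  by rewrite normrM ler_pM// cos_lip.
have h3 : `|Y' * (sin f - sin g)| <= r * `|f - g|.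
  by rewrite normrM ler_pM// sin_lip.
apply: le_trans (ler_normD _ _) _.
apply: le_trans (lerD (ler_normD _ _) h3) _.
apply: le_trans (lerD (lerD (ler_normD _ _) h2) (lexx _)) _.
lra.
Qed.

(* While the step angle moves from f to g, the vector (rotx, roty) after d steps
   rotates d times faster than its reconstruction from the two initial values. *)
Lemma angle_gap u v x y f g b c0 r d :
  3^-1 <= `|sin f| -> 0 < c0 -> c0 <= r -> b <= c0 / 100 -> 100 * 70 <= d ->
  u.1 ^+ 2 + u.2 ^+ 2 <= r ^+ 2 -> v.1 ^+ 2 + v.2 ^+ 2 <= r ^+ 2 ->
  r ^+ 2 <= 100 ^+ 2 * (u.1 ^+ 2 + u.2 ^+ 2) ->
  `|rotx u x - rotx v y| <= b -> `|rotx u (x + f) - rotx v (y + g)| <= b ->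
  (`|rotx u (x + d * f) - rotx v (y + d * g)| <= c0 ->
   `|rotx u (x + d * f) - rotx v (y + d * g)| <= b) ->
  (`|rotx u (x + (d + 1) * f) - rotx v (y + (d + 1) * g)| <= c0 ->
   `|rotx u (x + (d + 1) * f) - rotx v (y + (d + 1) * g)| <= b) ->
  r * d * `|f - g| <= c0 / 50 -> r * d * `|f - g| <= 100 * 70 * b.
Proof.
move=> sf c0_gt0 c0r bc0 d0 ur vr ru h0 h1 hd hd1 gap.
have r_ge0 : 0 <= r := le_trans (ltW c0_gt0) c0r.
have b_ge0 : 0 <= b := le_trans (normr_ge0 _) h0.
have hy := roty_diff sf r_ge0 vr h0 h1.
have d_ge0 : 0 <= d by apply: le_trans d0; rewrite mulr_ge0 ?ler0n.
have D_ge0 : 0 <= `|f - g| by [].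
have rD_ge0 : 0 <= r * `|f - g| by exact: mulr_ge0.
set D := `|f - g| in hy gap D_ge0 rD_ge0 *.
have rdD : r * d * D = d * (r * D) by ring.
(* The drift estimate places the two values within [c0]; the assumed implication sharpens this to
   [b], whatever the size of [d]. *)
have {}hd : `|rotx u (x + d * f) - rotx v (y + d * g)| <= b.
  apply: hd; apply: le_trans (rotx_diff _ _ r_ge0 vr h0 hy) _.
  rewrite -mulrBr normrM (ger0_norm d_ge0) -/D.
  clear -rD_ge0 rdD gap bc0 d0; nra.
have {}hd1 : `|rotx u (x + (d + 1) * f) - rotx v (y + (d + 1) * g)| <= b.
  apply: hd1; apply: le_trans (rotx_diff _ _ r_ge0 vr h0 hy) _.
  rewrite -mulrBr normrM (@ger0_norm _ (d + 1)) ?addr_ge0// -/D.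
  clear -rD_ge0 rdD gap bc0 d0; nra.
have hyd : `|roty u (x + d * f) - roty v (y + d * g)| <= 6 * b + 6 * r * D.
  apply: roty_diff => //; move: hd1.
  by rewrite !mulrDl !mul1r !addrA.
have B1 : `|d * f - d * g| <= 1.
  rewrite -mulrBr normrM (ger0_norm d_ge0) -/D.
  clear -D_ge0 gap c0r c0_gt0 d_ge0; have : 0 <= d * D by exact: mulr_ge0.
  nra.
have [G GE] : exists G, G = 6 * b + 6 * r * D by eexists.
rewrite -GE in hy hyd.
have Gb : 6 * b <= G by rewrite GE -mulrA lerDl mulr_ge0.
(* Undoing the rotation by [d * g] leaves [u] turned by [d * f - d * g], and the coordinates move by
   at most [2 * G] and [3 * G]. With 1 - cos x >= x^2 / 4 this gives 26 = 2 (2^2 + 3^2). *)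
have key : (u.1 ^+ 2 + u.2 ^+ 2) * (d * f - d * g) ^+ 2 <= 26 * G ^+ 2.
  have E1 : rotx u x * (cos (d * f - d * g) - 1) + roty u x * sin (d * f - d * g)
     = (rotx u (x + d * f) - rotx v (y + d * g)) * cos (d * g)
       - (roty u (x + d * f) - roty v (y + d * g)) * sin (d * g)
       - (rotx u x - rotx v y).
    have -> : x + d * f = (x + (d * f - d * g)) + d * g by ring.
    rewrite !(rotxD _ _ (d * g)) !(rotyD _ _ (d * g)) (rotxD _ _ (d * f - d * g)).
    rewrite (rotyD _ _ (d * f - d * g)).
    have := cos2Dsin2 (d * g).
    move: (cos (d * g)) (sin (d * g)) (cos (d * f - d * g)) (sin (d * f - d * g)).
    move: (rotx u x) (rotx v y) (roty u x) (roty v y) => X X' Y Y' cg sg cb sb cs.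
    transitivity ((X * cb + Y * sb - X') * (cg ^+ 2 + sg ^+ 2) - (X - X')); last by ring.
    rewrite cs; ring.
  have E2 : roty u x * (cos (d * f - d * g) - 1) - rotx u x * sin (d * f - d * g)
     = (roty u (x + d * f) - roty v (y + d * g)) * cos (d * g)
       + (rotx u (x + d * f) - rotx v (y + d * g)) * sin (d * g)
       - (roty u x - roty v y).
    have -> : x + d * f = (x + (d * f - d * g)) + d * g by ring.
    rewrite !(rotxD _ _ (d * g)) !(rotyD _ _ (d * g)) (rotxD _ _ (d * f - d * g)).
    rewrite (rotyD _ _ (d * f - d * g)).
    have := cos2Dsin2 (d * g).
    move: (cos (d * g)) (sin (d * g)) (cos (d * f - d * g)) (sin (d * f - d * g)).
    move: (rotx u x) (rotx v y) (roty u x) (roty v y) => X X' Y Y' cg sg cb sb cs.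
    transitivity ((Y * cb - X * sb - Y') * (cg ^+ 2 + sg ^+ 2) - (Y - Y')); last by ring.
    rewrite cs; ring.
  have N1 : `|rotx u x * (cos (d * f - d * g) - 1) + roty u x * sin (d * f - d * g)|
      <= 2 * G.
    rewrite E1; apply: le_trans (ler_normB _ _) _.
    apply: le_trans (lerD (ler_normB _ _) (lexx _)) _.
    have := norm_mul_cos (rotx u (x + d * f) - rotx v (y + d * g)) (d * g).
    have := norm_mul_sin (roty u (x + d * f) - roty v (y + d * g)) (d * g).
    clear -h0 hd hd1 hy hyd Gb b_ge0; lra.
  have N2 : `|roty u x * (cos (d * f - d * g) - 1) - rotx u x * sin (d * f - d * g)|
      <= 3 * G.
    rewrite E2; apply: le_trans (ler_normB _ _) _.
    apply: le_trans (lerD (ler_normD _ _) (lexx _)) _.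
    have := norm_mul_sin (rotx u (x + d * f) - rotx v (y + d * g)) (d * g).
    have := norm_mul_cos (roty u (x + d * f) - roty v (y + d * g)) (d * g).
    clear -h0 hd hd1 hy hyd Gb b_ge0; lra.
  have {}N1 : (rotx u x * (cos (d * f - d * g) - 1) + roty u x * sin (d * f - d * g)) ^+ 2
      <= (2 * G) ^+ 2 by exact: norm_sqr_le.
  have {}N2 : (roty u x * (cos (d * f - d * g) - 1) - rotx u x * sin (d * f - d * g)) ^+ 2
      <= (3 * G) ^+ 2 by exact: norm_sqr_le.
  have E3 : (rotx u x * (cos (d * f - d * g) - 1) + roty u x * sin (d * f - d * g)) ^+ 2 +
    (roty u x * (cos (d * f - d * g) - 1) - rotx u x * sin (d * f - d * g)) ^+ 2 =
    (u.1 ^+ 2 + u.2 ^+ 2) * (2 * (1 - cos (d * f - d * g))).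
    rewrite -(rot_norm u x); have := cos2Dsin2 (d * f - d * g).
    move: (cos (d * f - d * g)) (sin (d * f - d * g)) (rotx u x) (roty u x) => cb sb X Y cs.
    transitivity ((X ^+ 2 + Y ^+ 2) * (cb ^+ 2 + sb ^+ 2 + 1 - 2 * cb)); first by ring.
    rewrite cs; ring.
  have := one_sub_cos_ge B1.
  have : 0 <= u.1 ^+ 2 + u.2 ^+ 2 by rewrite addr_ge0 ?sqr_ge0.
  move: N1 N2 E3; clear; move: (u.1 ^+ 2 + u.2 ^+ 2) => U.
  move: (_ ^+ 2) => A1; move: ((_ - _) ^+ 2) => A2; nra.
have G0 : 0 <= G by apply: le_trans Gb; rewrite mulr_ge0.
have G20 := sqr_ge0 G.
(* 510 exceeds 100 sqrt 26, the factor 100 coming from [ru]. *)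
have rb : r * d * D <= 510 * G.
  apply: le_trans (ler_norm _) _; apply: (@normr_le_sqr _ 0).
    exact: (mulr_ge0 (ler0n R 510) G0).
  have -> : (r * d * D) ^+ 2 = r ^+ 2 * (d * f - d * g) ^+ 2.
    have D2 : D ^+ 2 = (f - g) ^+ 2 by exact: (real_normK (num_real _)).
    by transitivity (r ^+ 2 * d ^+ 2 * D ^+ 2); [ring|rewrite D2; ring].
  rewrite expr0n addr0 [(510 * G) ^+ 2]exprMn.
  have := sqr_ge0 (d * f - d * g); move: ru key G20; clear.
  move: (r ^+ 2) (u.1 ^+ 2 + u.2 ^+ 2) ((d * f - d * g) ^+ 2) (G ^+ 2) => r2 U B G2.
  move=> rU UB G20 B0; apply: (@le_trans _ _ (100 ^+ 2 * (U * B))).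
    by rewrite mulrA ler_wpM2r.
  apply: le_trans (ler_wpM2l (exprn_ge0 2 (ler0n R 100)) UB) _.
  nra.
(* Since 6 * 510 = 3060 is less than half of 7000 <= [d], the term in [r * D] is absorbed on the
   left: this is the origin of 100 * 70. *)
rewrite GE in rb; clear -rb rD_ge0 d0 b_ge0; nra.
Qed.

End Rotation.

(** * Counting points of a line by clusters *)

Section FiniteCounting.
Context {R : realType}.

Lemma card_fiber_le (T : finType) (E : {set T}) (f : T -> nat) (m : nat) (c : R) :
  (forall x, x \in E -> (f x < m)%N) ->
  (forall i, #|[set x in E | f x == i]|%:R <= c) -> #|E|%:R <= m%:R * c.
Proof.
move=> fm fc.
apply: (@le_trans _ _ (\sum_(i < m) #|[set x in E | f x == i]|%:R)).
  rewrite -natr_sum ler_nat.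
  under eq_bigr do rewrite -sum1dep_card.
  rewrite (exchange_big_dep (mem E))/=; last by move=> i x _ /andP[].
  rewrite -sum1_card; apply: leq_sum => x xE.
  by rewrite (bigD1 (Ordinal (fm x xE)))//= xE eqxx.
apply: (@le_trans _ _ (\sum_(i < m) c)); first by apply: ler_sum.
by rewrite sumr_const card_ord mulr_natl.
Qed.

Lemma card_imset_fiber_le (T T' : finType) (E : {set T}) (f : T -> T') (c : R) :
  (forall y, #|[set x in E | f x == y]|%:R <= c) -> #|E|%:R <= #|f @: E|%:R * c.
Proof.
move=> fc.
apply: (@le_trans _ _ (\sum_(y in f @: E) #|[set x in E | f x == y]|%:R)).
  rewrite -natr_sum ler_nat.
  under eq_bigr do rewrite -sum1dep_card.
  rewrite (exchange_big_dep (mem E))/=; last by move=> i x _ /andP[].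
  rewrite -sum1_card; apply: leq_sum => x xE.
  by rewrite (bigD1 (f x))//= xE eqxx imset_f.
apply: (@le_trans _ _ (\sum_(y in f @: E) c)); first by apply: ler_sum.
by rewrite sumr_const mulr_natl.
Qed.

(** Cut the range into [L / a + 1] cells of length [a]. Two points of a cell are within [a], hence
    within [b], so a count at diameter [L] is reduced to one at the smaller diameter [b]. *)
Lemma card_cluster (T : finType) (E : {set T}) (g : T -> R) (a b L c : R) :
  0 < a -> 0 <= L -> 0 <= c ->
  {in E &, forall x y, `|g x - g y| <= L} ->
  {in E &, forall x y, `|g x - g y| <= a -> `|g x - g y| <= b} ->
  (forall F : {set T}, F \subset E -> {in F &, forall x y, `|g x - g y| <= b} ->
    #|F|%:R <= c) ->
  #|E|%:R <= (L / a + 1) * c.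
Proof.
move=> a0 L0 c0 EL Eab Fc.
have [->|[y0 y0E]] := set_0Vmem E.
  by rewrite cards0 mulr_ge0// addr_ge0// divr_ge0// ltW.
pose x0 := [arg min_(x < y0 in E) g x]%O.
have [x0E x0m] : x0 \in E /\ (forall x, x \in E -> g x0 <= g x).
  by rewrite /x0; case: arg_minP => // i iE im; split => // x xE; exact: im.
pose f x := Num.truncn ((g x - g x0) / a).
have fE x : x \in E -> 0 <= (g x - g x0) / a <= L / a.
  move=> xE; rewrite divr_ge0 ?subr_ge0 ?x0m//= ?(ltW a0)//.
  by rewrite ler_pM2r ?invr_gt0// (le_trans (ler_norm _))// EL.
have La0 : 0 <= L / a by rewrite divr_ge0// ltW.
apply: (@le_trans _ _ ((Num.truncn (L / a)).+1%:R * c)).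
  apply: (@card_fiber_le _ _ f).
    by move=> x /fE /andP[_]; rewrite ltnS; exact: le_truncn.
  move=> i; apply: Fc.
    by apply/fintype.subsetP => x; rewrite inE => /andP[].
  move=> x y; rewrite !inE => /andP[xE /eqP fx] /andP[yE /eqP fy].
  apply: Eab => //.
  have /andP[x1 _] := fE _ xE; have /andP[y1 _] := fE _ yE.
  have := truncn_itv x1; rewrite -/(f x) fx => /andP[x2 x3].
  have := truncn_itv y1; rewrite -/(f y) fy => /andP[y2 y3].
  have : `|(g x - g x0) / a - (g y - g x0) / a| <= 1.
    move: x2 x3 y2 y3; rewrite -natr1 ler_norml; clear; move: (_ / a) (_ / a) => u v.
    by move=> *; apply/andP; split; lra.
  rewrite -mulrBl.
  have -> : g x - g x0 - (g y - g x0) = g x - g y by ring.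
  by rewrite normrM normfV (gtr0_norm a0) ler_pdivrMr// mul1r.
by rewrite ler_wpM2r// -natr1 lerD2r; have /andP[] := truncn_itv La0.
Qed.

Lemma card_diam_le (T : finType) (E : {set T}) (g : T -> nat) (h W : R) :
  0 < h -> 0 <= W -> {in E &, injective g} ->
  {in E &, forall x y, `|h * (g x)%:R - h * (g y)%:R| <= W} -> #|E|%:R <= W / h + 1.
Proof.
move=> h0 W0 gi EW.
have [->|[y0 y0E]] := set_0Vmem E.
  by rewrite cards0 addr_ge0// divr_ge0// ltW.
pose x0 := [arg min_(x < y0 in E) g x]%N.
have [x0E x0m] : x0 \in E /\ (forall x, x \in E -> (g x0 <= g x)%N).
  by rewrite /x0; case: arg_minnP => // i iE im; split => // x xE; exact: im.
have Wh0 : 0 <= W / h by rewrite divr_ge0// ltW.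
apply: (@le_trans _ _ ((Num.truncn (W / h)).+1%:R * 1)).
  apply: (@card_fiber_le _ _ (fun x => g x - g x0)%N).
    move=> x xE; rewrite ltnS truncn_ge_nat// natrB ?x0m//.
    rewrite ler_pdivlMr// mulrC mulrBr.
    exact: le_trans (ler_norm _) (EW _ _ xE x0E).
  move=> i; rewrite (_ : 1 = 1%:R)// ler_nat; apply/card_le1P.
  move=> x; rewrite inE => /andP[xE /eqP fx] y; rewrite !inE.
  apply/andP/eqP => [[yE /eqP fy]|->]; last by split => //; apply/eqP.
  by apply: gi => //; move: fx fy (x0m _ xE) (x0m _ yE); lia.
by rewrite mulr1 -natr1 lerD2r; have /andP[] := truncn_itv Wh0.
Qed.

(** Each gap condition reduces the diameter further, at the cost of a factor that depends only on
    the ratio of consecutive scales; the last factor counts points of spacing [h]. *)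
Lemma card_nested (T : finType) (E : {set T}) (g : T -> nat) (h L a1 b1 a2 b2 a3 b3 : R) :
  0 < h -> 0 <= L -> 0 < a1 -> 0 < a2 -> 0 < a3 -> 0 <= b1 -> 0 <= b2 -> 0 <= b3 ->
  {in E &, injective g} ->
  let dist x y := `|h * (g x)%:R - h * (g y)%:R| in
  {in E &, forall x y, dist x y <= L} ->
  {in E &, forall x y, dist x y <= a1 -> dist x y <= b1} ->
  {in E &, forall x y, dist x y <= a2 -> dist x y <= b2} ->
  {in E &, forall x y, dist x y <= a3 -> dist x y <= b3} ->
  #|E|%:R <= (L / a1 + 1) * ((b1 / a2 + 1) * ((b2 / a3 + 1) * (b3 / h + 1))).
Proof.
move=> h0 L0 a10 a20 a30 b10 b20 b30 gi dist EL E1 E2 E3.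
have q0 (u v : R) : 0 <= u -> 0 < v -> 0 <= u / v + 1.
  by move=> u0 v0; rewrite addr_ge0// divr_ge0// ltW.
apply: (@card_cluster _ _ (fun x => h * (g x)%:R)) EL E1 _ => //.
  by rewrite !mulr_ge0// q0.
move=> F FE F1; have {}FE := fintype.subsetP FE.
apply: (@card_cluster _ _ (fun x => h * (g x)%:R)) F1 (sub_in2 FE E2) _ => //.
  by rewrite !mulr_ge0// q0.
move=> G GF G1; have {}GF x : x \in G -> x \in E by move=> /(fintype.subsetP GF)/FE.
apply: (@card_cluster _ _ (fun x => h * (g x)%:R)) G1 (sub_in2 GF E3) _ => //.
  by rewrite q0.
move=> H HG H1; apply: card_diam_le H1 => //.
by apply: sub_in2 gi => x /(fintype.subsetP HG)/GF.
Qed.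

End FiniteCounting.

(** * Counting pairs of an angle and a grid vector *)

Section LatticeCounting.
Context {R : realType}.
Variables (A : pred R) (b c0 Q d1 d2 d3 h L dl ka : R).
Hypothesis cluster : forall x y, A x -> A y -> `|x - y| <= c0 -> `|x - y| <= b.
Hypotheses (c0_gt0 : 0 < c0) (b_ge0 : 0 <= b) (bc0 : b <= c0 / 100).
Hypotheses (hd1 : 100 * 70 <= d1) (hd2 : 100 * 70 <= d2) (hd3 : 100 * 70 <= d3).
Hypotheses (h_gt0 : 0 < h) (L_ge0 : 0 <= L) (dl_gt0 : 0 < dl).

Variables (N M : nat) (x f : 'I_N -> R).
Hypothesis fh : forall k l, `|f k - f l| = `|h * k%:R - h * l%:R|.

Let vec (w : 'I_M * 'I_M) : R * R := (dl * w.1%:R - ka, dl * w.2%:R - ka).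
Let nrm (w : 'I_M * 'I_M) : R := (vec w).1 ^+ 2 + (vec w).2 ^+ 2.
Let ix (t : 'I_N * ('I_M * 'I_M)) : nat := t.1.
Let val (t : 'I_N * ('I_M * 'I_M)) (a : R) : R := rotx (vec t.2) (x t.1 + a * f t.1).

(** Offsets come in pairs d, d + 1 because a state has to be compared, and by [roty_diff] two
    consecutive values determine both of its coordinates. *)
Definition lattice_good (t : 'I_N * ('I_M * 'I_M)) : Prop :=
  [/\ 3^-1 <= `|sin (f t.1)|, c0 ^+ 2 <= nrm t.2, nrm t.2 <= Q ^+ 2 &
      [/\ A (val t 0), A (val t 1), A (val t d1), A (val t (d1 + 1)) &
      [/\ A (val t d2), A (val t (d2 + 1)), A (val t d3) & A (val t (d3 + 1))]]].

(** Number of angles times number of vectors per angle. The first factor bounds (10 s X + 1) (Y /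
    (10 s) + 1) for c0 <= s <= Q, with X = 50 L d1 / c0 and Y = 7000 b / (d3 h): in the leading
    product X Y the vector length s cancels. *)
Definition cell_bound : R :=
  ((50 * L * d1 / c0) * (100 * 70 * b / (d3 * h)) + 10 * (50 * L * d1 / c0) * Q
    + 100 * 70 * b / (d3 * h) / c0 + 1) *
  ((100 * 70 * 50 * b * d2 / (d1 * c0) + 1) * (100 * 70 * 50 * b * d3 / (d2 * c0) + 1)) *
  (7 * b / dl + 1) ^+ 2.

Lemma val0 t : val t 0 = rotx (vec t.2) (x t.1).
Proof. by rewrite /val mul0r addr0. Qed.

Lemma val1 t : val t 1 = rotx (vec t.2) (x t.1 + f t.1).
Proof. by rewrite /val mul1r. Qed.

Lemma le_sqr_of (u v : R) : 0 <= v -> u ^+ 2 <= v ^+ 2 -> u <= v.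
Proof.
move=> v0 uv; apply: le_trans (ler_norm _) _; apply: (@normr_le_sqr _ _ 0) => //.
by rewrite expr0n addr0.
Qed.

(** The first two values determine the vector up to its angle, because the sine of the step is at
    least 1/3. The squared norm is at most 37 (r + b)^2, which is below 100 r^2 since r + b <= 6 r /
    5. *)
Lemma nrm_cmp t t' : lattice_good t -> lattice_good t' ->
  `|val t 0 - val t' 0| <= c0 -> `|val t 1 - val t' 1| <= c0 ->
  nrm t.2 <= 100 * nrm t'.2.
Proof.
move=> [sf n0 _ [A0 A1 _ _ _]] [_ n0' _ [A0' A1' _ _ _]] h0 h1.
have {}h0 := cluster A0 A0' h0; have {}h1 := cluster A1 A1' h1.
have [r r0 r2] : exists2 r, 0 <= r & nrm t'.2 = r ^+ 2.
  by exists (Num.sqrt (nrm t'.2)); rewrite ?sqrtr_ge0// sqr_sqrtr// addr_ge0 ?sqr_ge0.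
have c0r : c0 <= r by apply: le_sqr_of => //; rewrite -r2.
have v0 : `|val t' 0| <= r by rewrite val0; apply: rotx_le => //; rewrite -r2.
have v1 : `|val t' 1| <= r by rewrite val1; apply: rotx_le => //; rewrite -r2.
have {v0} w0 : `|val t 0| <= r + b.
  have := ler_normD (val t 0 - val t' 0) (val t' 0); rewrite subrK.
  lra.
have {v1} w1 : `|val t 1| <= r + b.
  have := ler_normD (val t 1 - val t' 1) (val t' 1); rewrite subrK.
  lra.
have wy : `|roty (vec t.2) (x t.1)| <= 6 * (r + b).
  have : `|roty (vec t.2) (x t.1) * sin (f t.1)| <= 2 * (r + b).
    have -> : roty (vec t.2) (x t.1) * sin (f t.1) =
       val t 1 - val t 0 * cos (f t.1).
      by rewrite val0 val1 rotxD; ring.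
    apply: le_trans (ler_normB _ _) _.
    have := norm_mul_cos (val t 0) (f t.1); lra.
  rewrite normrM; have := normr_ge0 (roty (vec t.2) (x t.1)).
  nra.
rewrite /nrm -(rot_norm _ (x t.1)) -val0 -/(nrm t'.2) r2.
have rb : (r + b) ^+ 2 <= (6 / 5 * r) ^+ 2.
  apply: norm_sqr_le; rewrite ger0_norm; last exact: addr_ge0.
  by move: bc0 c0r b_ge0 c0_gt0; lra.
have r2_ge0 := sqr_ge0 r.
move: (norm_sqr_le w0) (norm_sqr_le wy); rewrite !exprMn in rb *; nra.
Qed.

Variable E : {set 'I_N * ('I_M * 'I_M)}.
Hypothesis Egood : {in E, forall t, lattice_good t}.
Hypothesis EL : {in E &, forall t t', `|h * (ix t)%:R - h * (ix t')%:R| <= L}.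

(** [angle_gap] at the offsets [d1], [d2], [d3] supplies the three gap conditions of [card_nested].
    Injectivity of [ix] means one vector per angle, so the vectors need not agree from one angle to
    the next. *)
Lemma angle_set_bound (K : {set 'I_N * ('I_M * 'I_M)}) (r : R) : K \subset E ->
  {in K &, injective ix} ->
  {in K &, forall t t', `|val t 0 - val t' 0| <= c0 /\ `|val t 1 - val t' 1| <= c0} ->
  c0 <= r -> {in K, forall t, nrm t.2 <= r ^+ 2 <= 100 ^+ 2 * nrm t.2} ->
  #|K|%:R <= (L / (c0 / 50 / (r * d1)) + 1) *
    (((100 * 70 * b / (r * d1)) / (c0 / 50 / (r * d2)) + 1) *
    (((100 * 70 * b / (r * d2)) / (c0 / 50 / (r * d3)) + 1) *
    ((100 * 70 * b / (r * d3)) / h + 1))).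
Proof.
move=> KE Ki Kc c0r Kr.
have r0 : 0 < r by exact: lt_le_trans c0r.
have p0 : (0 : R) < 100 * 70 by rewrite mulr_gt0 ?ltr0n.
have d0 d : 100 * 70 <= d -> 0 < r * d.
  by move=> dd; rewrite mulr_gt0//; exact: lt_le_trans dd.
have step d : 100 * 70 <= d ->
    {in K, forall t, A (val t d) /\ A (val t (d + 1))} ->
    {in K &, forall t t', `|h * (ix t)%:R - h * (ix t')%:R| <= c0 / 50 / (r * d) ->
     `|h * (ix t)%:R - h * (ix t')%:R| <= 100 * 70 * b / (r * d)}.
  move=> dd dA t t' tK t'K.
  rewrite -!fh ler_pdivlMr ?d0// mulrC => gap; rewrite ler_pdivlMr ?d0// mulrC.
  have [sf _ _ [A0 A1 _ _ _]] := Egood (fintype.subsetP KE _ tK).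
  have [_ _ _ [A0' A1' _ _ _]] := Egood (fintype.subsetP KE _ t'K).
  have [c1 c2] := Kc _ _ tK t'K.
  have [Ad Ad1] := dA _ tK; have [Ad' Ad1'] := dA _ t'K.
  apply: (@angle_gap _ (vec t.2) (vec t'.2) (x t.1) (x t'.1) _ _ _ c0) => //.
  - by have /andP[] := Kr _ tK.
  - by have /andP[] := Kr _ t'K.
  - by have /andP[] := Kr _ tK.
  - by rewrite -!val0; apply: cluster.
  - by rewrite -!val1; apply: cluster.
  - exact: cluster.
  - exact: cluster.
have c50 d : 100 * 70 <= d -> 0 < c0 / 50 / (r * d).
  by move=> dd; rewrite !divr_gt0 ?d0.
have b50 d : 100 * 70 <= d -> 0 <= 100 * 70 * b / (r * d).
  by move=> dd; rewrite divr_ge0 ?(ltW (d0 _ _))// mulr_ge0// ltW.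
apply: (@card_nested _ _ _ ix) => //; rewrite ?c50 ?b50//.
- by apply: sub_in2 EL; exact/fintype.subsetP.
- by apply: step => // t /(fintype.subsetP KE)/Egood [_ _ _ []].
- by apply: step => // t /(fintype.subsetP KE)/Egood [_ _ _ [_ _ _ _ []]].
- by apply: step => // t /(fintype.subsetP KE)/Egood [_ _ _ [_ _ _ _ []]].
Qed.


(** For equal angles the states differ by at most [b] and [6 * b], the angular term of [roty_diff]
    being zero; turning back gives the vectors themselves. *)
Lemma vec_diff t t' : lattice_good t -> lattice_good t' -> t.1 = t'.1 ->
  `|val t 0 - val t' 0| <= c0 -> `|val t 1 - val t' 1| <= c0 ->
  `|dl * t.2.1%:R - dl * t'.2.1%:R| <= 7 * b /\
  `|dl * t.2.2%:R - dl * t'.2.2%:R| <= 7 * b.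
Proof.
move=> [sf _ n1 [A0 A1 _ _ _]] [_ _ n1' [A0' A1' _ _ _]] tt' h0 h1.
have {}h0 := cluster A0 A0' h0; have {}h1 := cluster A1 A1' h1.
have Q2 : nrm t'.2 <= `|Q| ^+ 2 by rewrite real_normK ?num_real.
rewrite !val0 in h0; rewrite !val1 in h1.
have := roty_diff sf (normr_ge0 Q) Q2 h0 h1.
rewrite tt' subrr normr0 mulr0 addr0 in h0 *.
set X := (X in `|X - _| <= b) in h0; set X' := (X in `|_ - X| <= b) in h0.
set Y := roty _ _; set Y' := roty _ _ => hY.
have E1 : dl * t.2.1%:R - dl * t'.2.1%:R =
    (X - X') * cos (x t'.1) - (Y - Y') * sin (x t'.1).
  have := cos2Dsin2 (x t'.1); rewrite /X /X' /Y /Y' /rotx /roty/=.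
  move: (cos _) (sin _) => c s cs.
  transitivity ((dl * t.2.1%:R - dl * t'.2.1%:R) * (c ^+ 2 + s ^+ 2)).
    by rewrite cs mulr1.
  ring.
have E2 : dl * t.2.2%:R - dl * t'.2.2%:R =
    (X - X') * sin (x t'.1) + (Y - Y') * cos (x t'.1).
  have := cos2Dsin2 (x t'.1); rewrite /X /X' /Y /Y' /rotx /roty/=.
  move: (cos _) (sin _) => c s cs.
  transitivity ((dl * t.2.2%:R - dl * t'.2.2%:R) * (c ^+ 2 + s ^+ 2)).
    by rewrite cs mulr1.
  ring.
have b7 : 7 * b = b + 6 * b by ring.
split; rewrite b7.
  rewrite E1; apply: le_trans (ler_normB _ _) _; apply: lerD.
    exact: le_trans (norm_mul_cos _ _) h0.
  exact: le_trans (norm_mul_sin _ _) hY.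
rewrite E2; apply: le_trans (ler_normD _ _) _; apply: lerD.
  exact: le_trans (norm_mul_sin _ _) h0.
exact: le_trans (norm_mul_cos _ _) hY.
Qed.

Hypothesis Q_ge0 : 0 <= Q.

(** Angles are counted through one representative each, then the vectors over a fixed angle fill a
    square of side [7 * b]. *)
Lemma class_bound (K : {set 'I_N * ('I_M * 'I_M)}) : K \subset E ->
  {in K &, forall t t', `|val t 0 - val t' 0| <= c0 /\ `|val t 1 - val t' 1| <= c0} ->
  #|K|%:R <= cell_bound.
Proof.
move=> KE Kc.
have Kg t : t \in K -> lattice_good t by move=> /(fintype.subsetP KE)/Egood.
have dd0 d : 100 * 70 <= d -> 0 < d.
  by apply: lt_le_trans; rewrite mulr_gt0 ?ltr0n.
have [d10 d20 d30] : [/\ 0 < d1, 0 < d2 & 0 < d3] by split; exact: dd0.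
have b70 : 0 <= 100 * 70 * b by rewrite !mulr_ge0 ?ler0n.
have b7050 : 0 <= 100 * 70 * 50 * b by rewrite !mulr_ge0 ?ler0n.
have X0 : 0 <= 50 * L * d1 / c0.
  by rewrite !mulr_ge0 ?ler0n ?invr_ge0// ltW.
have Y0 : 0 <= 100 * 70 * b / (d3 * h).
  by rewrite mulr_ge0// invr_ge0 mulr_ge0// ltW.
have Z1 : 0 <= 100 * 70 * 50 * b * d2 / (d1 * c0).
  by rewrite mulr_ge0 ?invr_ge0 ?mulr_ge0// ltW.
have Z2 : 0 <= 100 * 70 * 50 * b * d3 / (d2 * c0).
  by rewrite mulr_ge0 ?invr_ge0 ?mulr_ge0// ltW.
have W0 : 0 <= 7 * b by rewrite mulr_ge0 ?ler0n.
have U0 : 0 <= 7 * b / dl + 1 by rewrite addr_ge0 ?divr_ge0 ?(ltW dl_gt0).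
have [->|[t0 t0K]] := set_0Vmem K.
  rewrite cards0 /cell_bound; apply: mulr_ge0; last exact: exprn_ge0.
  apply: mulr_ge0; last by apply: mulr_ge0; apply: addr_ge0.
  rewrite !addr_ge0 ?ler01//; first exact: mulr_ge0.
    by apply: mulr_ge0 => //; apply: mulr_ge0.
  by rewrite mulr_ge0// invr_ge0 ltW.
(* A representative of [K] over the angle [k]; the default [t0] is never reached for angles that
   occur in [K]. *)
pose sel (k : 'I_N) := odflt t0 [pick t in K | t.1 == k].
have selP t : t \in K -> sel t.1 \in K /\ (sel t.1).1 = t.1.
  move=> tK; rewrite /sel; case: pickP => [u /andP[uK /eqP]//|/(_ t)].
  by rewrite tK eqxx.
pose K1 := sel @: (fst @: K).
have K1K : K1 \subset K.
  apply/fintype.subsetP => _ /imsetP[_ /imsetP[t tK ->] ->].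
  by have [] := selP _ tK.
have cardK1 : #|fst @: K| = #|K1|.
  apply/esym/card_in_imset => _ _ /imsetP[t tK ->] /imsetP[t' t'K ->] E1.
  by have [_ <-] := selP _ tK; have [_ <-] := selP _ t'K; rewrite E1.
have n0 : 0 <= nrm t0.2 by rewrite addr_ge0 ?sqr_ge0.
have [s s0 s2] : exists2 s, 0 <= s & nrm t0.2 = s ^+ 2.
  by exists (Num.sqrt (nrm t0.2)); rewrite ?sqrtr_ge0// sqr_sqrtr.
have [_ ct0 tQ0 _] := Kg _ t0K.
have cs : c0 <= s by apply: le_sqr_of => //; rewrite -s2.
have sQ : s <= Q by apply: le_sqr_of => //; rewrite -s2.
have s_gt0 : 0 < s by exact: lt_le_trans cs.
have cs10 : c0 <= 10 * s by move: cs s0; lra.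
(* The radius is [10 * s] because squared norms in [K] agree with s^2 up to a factor 100 in both
   directions, by [nrm_cmp]. *)
have B1 : #|fst @: K|%:R <= (50 * L * d1 / c0 * (10 * s) + 1) *
   ((100 * 70 * 50 * b * d2 / (d1 * c0) + 1) *
   ((100 * 70 * 50 * b * d3 / (d2 * c0) + 1) *
   (100 * 70 * b / (d3 * h) / (10 * s) + 1))).
  rewrite cardK1; apply: le_trans (@angle_set_bound K1 (10 * s) _ _ _ _ _) _ => //.
  - exact: fintype.subset_trans KE.
  - move=> _ _ /imsetP[_ /imsetP[t tK ->] ->] /imsetP[_ /imsetP[t' t'K ->] ->].
    have [_ e1] := selP _ tK; have [_ e2] := selP _ t'K.
    rewrite /ix e1 e2 => /val_inj e3; by rewrite e3.
  - by move=> t t' /(fintype.subsetP K1K) tK /(fintype.subsetP K1K) t'K; exact: Kc.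
  - move=> t /(fintype.subsetP K1K) tK.
    have [c1 c2] := Kc _ _ tK t0K; have [c3 c4] := Kc _ _ t0K tK.
    have := nrm_cmp (Kg _ tK) (Kg _ t0K) c1 c2.
    have := nrm_cmp (Kg _ t0K) (Kg _ tK) c3 c4.
    rewrite s2; move: (nrm t.2) => n h1 h2; apply/andP; split; move: h1 h2.
      by rewrite exprMn; lra.
    by rewrite exprMn expr2; lra.
  have sn : s != 0 by rewrite gt_eqF.
  have cn : c0 != 0 by rewrite gt_eqF.
  have d1n : d1 != 0 by rewrite gt_eqF.
  have d2n : d2 != 0 by rewrite gt_eqF.
  have d3n : d3 != 0 by rewrite gt_eqF.
  have hn : h != 0 by rewrite gt_eqF.
  have gen (z y l i j k hh cc bb : R) : z != 0 -> i != 0 -> j != 0 -> k != 0 -> hh != 0 -> cc != 0 ->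
    (l / (cc / 50 / (z * i)) + 1) *
    (y * bb / (z * i) / (cc / 50 / (z * j)) + 1) *
    ((y * bb / (z * j) / (cc / 50 / (z * k)) + 1) *
     (y * bb / (z * k) / hh + 1)) =
   (50 * l * i / cc * z + 1) * (y * 50 * bb * j / (i * cc) + 1) *
   ((y * 50 * bb * k / (j * cc) + 1) *
   (y * bb / (k * hh) / z + 1)).
    by move=> *; field; do ![apply/andP; split].
  by rewrite mulrA gen ?mulf_neq0 ?pnatr_eq0// -mulrA.
apply: (@le_trans _ _ (#|fst @: K|%:R * (7 * b / dl + 1) ^+ 2)).
  apply: card_imset_fiber_le => k.
  set F := [set _ in _ | _].
  have FP t : t \in F -> t \in K /\ t.1 = k by rewrite inE => /andP[? /eqP].
  have FF t t' : t \in F -> t' \in F ->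
     `|dl * t.2.1%:R - dl * t'.2.1%:R| <= 7 * b /\
     `|dl * t.2.2%:R - dl * t'.2.2%:R| <= 7 * b.
    move=> /FP[tK e1] /FP[t'K e2]; have [c1 c2] := Kc _ _ tK t'K.
    by apply: vec_diff => //; [exact: Kg|exact: Kg|rewrite e1].
  rewrite expr2; apply: (@le_trans _ _ (#|(fun t => t.2.1) @: F|%:R * (7 * b / dl + 1))).
    apply: card_imset_fiber_le => p.
    apply: (@card_diam_le _ _ _ (fun t : 'I_N * ('I_M * 'I_M) => nat_of_ord t.2.2)) => //.
      move=> t t'; rewrite !inE => /andP[/andP[_ /eqP e1] /eqP e2].
      move=> /andP[/andP[_ /eqP e1'] /eqP e2'] /val_inj e3.
      case: t t' e1 e2 e1' e2' e3 => [? [? ?]] [? [? ?]] /=.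
      by move=> -> -> -> -> ->.
    move=> t t'; rewrite !inE => /andP[tF _] /andP[t'F _].
    by have [|| _] := FF t t'; rewrite ?inE.
  rewrite ler_wpM2r ?addr_ge0 ?divr_ge0 ?(ltW dl_gt0)//.
  apply: (@card_diam_le _ _ _ (@nat_of_ord M)) => //.
    by move=> ? ? _ _ /val_inj.
  by move=> _ _ /imsetP[t tF ->] /imsetP[t' t'F ->]; have [] := FF _ _ tF t'F.
rewrite /cell_bound ler_wpM2r ?exprn_ge0 ?addr_ge0 ?divr_ge0 ?(ltW dl_gt0)//.
apply: le_trans B1 _.
move: X0 Y0 Z1 Z2 cs sQ s_gt0 Q_ge0.
move: (50 * L * d1 / c0) (100 * 70 * b / (d3 * h)) => X Y.
move: (100 * 70 * 50 * b * d2 / (d1 * c0)) (100 * 70 * 50 * b * d3 / (d2 * c0)) => Z1 Z2.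
move=> X0 Y0 Z10 Z20 cs' sQ' s_gt0' Q0'.
have -> : (X * (10 * s) + 1) * ((Z1 + 1) * ((Z2 + 1) * (Y / (10 * s) + 1))) =
  ((X * (10 * s) + 1) * (Y / (10 * s) + 1)) * ((Z1 + 1) * (Z2 + 1)) by ring.
rewrite ler_wpM2r ?mulr_ge0 ?addr_ge0//.
have sn : s != 0 by rewrite gt_eqF.
have -> : (X * (10 * s) + 1) * (Y / (10 * s) + 1) =
  X * Y + 10 * X * s + Y / (10 * s) + 1 by field.
rewrite lerD2r; apply: lerD.
  by rewrite lerD2l ler_wpM2l// mulr_ge0.
rewrite ler_wpM2l// lef_pV2 ?posrE// ?mulr_gt0//.
Qed.

(** Sort the pairs by the cells of width [c0] containing their values at offsets 0 and 1; these
    values lie in [-Q, Q]. *)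
Lemma lattice_count : #|E|%:R <=
  (Num.truncn (2 * Q / c0)).+1%:R * ((Num.truncn (2 * Q / c0)).+1%:R * cell_bound).
Proof.
pose cell t a := Num.truncn ((val t a + Q) / c0).
have bd t a : t \in E -> (val t a + Q) / c0 <= 2 * Q / c0 /\ 0 <= (val t a + Q) / c0.
  move=> /Egood[_ _ tQ _]; have := rotx_le (x t.1 + a * f t.1) Q_ge0 tQ.
  rewrite -/(val t a) ler_norml => /andP[h1 h2].
  split; first by rewrite ler_pM2r ?invr_gt0//; move: h2; lra.
  by rewrite divr_ge0 ?(ltW c0_gt0)//; move: h1; lra.
have same t t' a : t \in E -> t' \in E -> cell t a = cell t' a ->
    `|val t a - val t' a| <= c0.
  move=> tE t'E ct; have [_ t1] := bd t a tE; have [_ t2] := bd t' a t'E.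
  have := truncn_itv t1; have := truncn_itv t2; rewrite -/(cell t a) -/(cell t' a) ct.
  rewrite -natr1 => /andP[x2 x3] /andP[y2 y3].
  have : `|(val t a + Q) / c0 - (val t' a + Q) / c0| <= 1.
    move: x2 x3 y2 y3; rewrite ler_norml; move: (_ / c0) (_ / c0) => u v.
    by move=> *; apply/andP; split; lra.
  rewrite -mulrBl.
  have -> : val t a + Q - (val t' a + Q) = val t a - val t' a by ring.
  by rewrite normrM normfV (gtr0_norm c0_gt0) ler_pdivrMr// mul1r.
have lt t a : t \in E -> (cell t a < (Num.truncn (2 * Q / c0)).+1)%N.
  by move=> tE; rewrite ltnS; apply: le_truncn; have [] := bd t a tE.
apply: (@card_fiber_le _ _ _ (cell^~ 0)) => [t tE|i]; first exact: lt.
apply: (@card_fiber_le _ _ _ (cell^~ 1)) => [t|j].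
  by rewrite inE => /andP[tE _]; exact: lt.
apply: class_bound.
  by apply/fintype.subsetP => t; rewrite !inE => /andP[/andP[]].
move=> t t'; rewrite !inE => /andP[/andP[tE /eqP e1] /eqP e2].
move=> /andP[/andP[t'E /eqP e1'] /eqP e2'].
by split; apply: same => //; rewrite ?e1 ?e2.
Qed.

End LatticeCounting.

(** * Exponential sums over a grid *)

Section Averaging.
Context {R : realType}.

(** With X, Z the two values and c = cos f, the left side is half of X^2 + Z^2 - 2 c X Z, which is
    at most 2 (X^2 + Z^2) since |c| <= 1. *)
Lemma pair_quad_ge (u : R * R) (x f : R) :
  sin f ^+ 2 * (u.1 ^+ 2 + u.2 ^+ 2) / 2 <= rotx u x ^+ 2 + rotx u (x + f) ^+ 2.
Proof.
rewrite -(rot_norm u x) rotxD.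
have := cos2Dsin2 f.
move: (rotx u x) (roty u x) (cos f) (sin f) => X Y c s cs.
have -> : s ^+ 2 * (X ^+ 2 + Y ^+ 2) / 2 =
  (X ^+ 2 + (X * c + Y * s) ^+ 2 - 2 * c * (X * (X * c + Y * s))) / 2
   + (c ^+ 2 + s ^+ 2 - 1) * X ^+ 2 / 2 by field.
rewrite cs subrr mul0r mul0r addr0.
have c2 : c ^+ 2 <= 1 by rewrite -cs lerDl sqr_ge0.
have c1 : -1 <= c <= 1 by rewrite -ler_norml -(@expr_le1 _ 2%N)// real_normK ?num_real.
move: (X * c + Y * s) c1 => Z /andP[c3 c4].
have := sqr_ge0 (X - Z); have := sqr_ge0 (X + Z); nra.
Qed.

Lemma sum_shift_le (g : nat -> R) (m n o : nat) : (forall j, 0 <= g j) ->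
  (m + o <= n)%N -> \sum_(0 <= j < m) g (j + o)%N <= \sum_(0 <= j < n) g j.
Proof.
move=> g0 mon.
have := big_addn 0 (m + o) o xpredT g; rewrite addnK => <-.
rewrite [leRHS](@big_cat_nat _ _ _ o)//=; last by rewrite (leq_trans _ mon)// leq_addl.
rewrite [X in _ <= _ + X](@big_cat_nat _ _ _ (m + o)%N)/= ?leq_addl//.
by rewrite addrCA lerDl addr_ge0 ?sumr_ge0.
Qed.

(** Pair each index j < n - e with j + e. There are at least n / 2 pairs and each index is used at
    most twice. A suitable [e] makes the sine large even when [th] itself is close to a multiple of
    pi. *)
Lemma quad_lower (n e : nat) (u : R * R) (th : R) : (2 * e <= n)%N ->
  n%:R / 8 * (sin (e%:R * th) ^+ 2 * (u.1 ^+ 2 + u.2 ^+ 2)) <=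
  \sum_(j < n) rotx u (j%:R * th) ^+ 2.
Proof.
move=> en.
set q := sin _ ^+ 2 * _.
have q0 : 0 <= q by rewrite mulr_ge0 ?addr_ge0 ?sqr_ge0.
pose g j := rotx u (j%:R * th) ^+ 2.
have g0 j : 0 <= g j by exact: sqr_ge0.
have n1 : \sum_(0 <= j < (n - e)%N) g j <= \sum_(0 <= j < n) g j.
  have := @sum_shift_le g (n - e) n 0 g0; rewrite addn0 leq_subr => /(_ isT).
  by under eq_bigr do rewrite addn0.
have n2 : \sum_(0 <= j < (n - e)%N) g (j + e)%N <= \sum_(0 <= j < n) g j.
  by apply: sum_shift_le => //; rewrite subnK// (leq_trans _ en)// leq_pmull.
have n3 : (n - e)%:R * (q / 2) <= \sum_(0 <= j < (n - e)%N) (g j + g (j + e)%N).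
  rewrite -[(n - e)%N in leLHS]subn0 mulr_natl -sumr_const_nat; apply: ler_sum => j _.
  have := pair_quad_ge u (j%:R * th) (e%:R * th).
  by rewrite -mulrDl -natrD.
rewrite big_split/= in n3; rewrite -(big_mkord xpredT g).
have : n%:R / 2 <= (n - e)%:R :> R.
  rewrite natrB ?(leq_trans _ en) ?leq_pmull//.
  have : (2 * e)%:R <= n%:R :> R by rewrite ler_nat.
  by rewrite natrM; clear; lra.
move: n1 n2 n3 q0; clear; nra.
Qed.

(** Averaging over shifts: a bad pair is seen by at least half of the shifts, so some shift sees at
    least half of the bad pairs. *)
Lemma card_double_count (T : finType) (B : {set T}) (m : nat)
    (good : 'I_m -> T -> bool) (c : R) : (0 < m)%N ->
  (forall t, t \in B -> (m <= 2 * #|[set s | good s t]%SET|)%N) ->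
  (forall s, #|[set t in B | good s t]%SET|%:R <= c) -> #|B|%:R <= 2 * c.
Proof.
move=> m0 Bg gc.
have h1 : (#|B| * m <= 2 * \sum_(s < m) #|[set t in B | good s t]%SET|)%N.
  rewrite -sum_nat_const.
  have -> : (\sum_(s < m) #|[set t in B | good s t]%SET| =
    \sum_(t in B) #|[set s | good s t]%SET|)%N.
    transitivity (\sum_(t in B) \sum_(s < m | good s t) 1)%N; last first.
      by apply: eq_bigr => t _; rewrite sum1dep_card.
    transitivity (\sum_(s < m) \sum_(t | (t \in B) && good s t) 1)%N.
      by apply: eq_bigr => s _; rewrite sum1dep_card.
    rewrite (exchange_big_dep (mem B))/= => [|s t _ /andP[]//].
    by apply: eq_bigr => t ->.
  by rewrite big_distrr/=; apply: leq_sum => t tB; exact: Bg.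
have m0' : (0 : R) < m%:R by rewrite ltr0n.
rewrite -(ler_pM2r m0') -natrM.
apply: le_trans (_ : (2 * \sum_(s < m) #|[set t in B | good s t]%SET|)%:R <= _).
  by rewrite ler_nat.
rewrite natrM natr_sum -mulrA ler_wpM2l//.
apply: (@le_trans _ _ (\sum_(s < m) c)); first by apply: ler_sum.
by rewrite sumr_const card_ord mulr_natr.
Qed.

(** Markov's inequality over the shifts: a shift that fails at some offset contributes more than
    [eta2] to a double sum bounded by [size os] times [T]. *)
Lemma shift_good_count (g : nat -> R) (n m : nat) (os : seq nat) (T eta2 : R) :
  (forall j, 0 <= g j) -> \sum_(j < n) g j <= T -> 0 <= T ->
  (forall o, o \in os -> (o + m <= n)%N) -> 0 < eta2 ->
  2 * (size os)%:R * T <= eta2 * m%:R ->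
  (m <= 2 * #|[set s : 'I_m | all (fun o => (g (s + o)%N <= eta2)%R) os]%SET|)%N.
Proof.
move=> g0 gT T0 osn e0 eT.
set G := [set s | _]%SET.
have h1 : #|~: G|%:R * eta2 <= (size os)%:R * T.
  apply: (@le_trans _ _ (\sum_(s < m) \sum_(o <- os) g (s + o)%N)).
    rewrite mulr_natl -sumr_const [leRHS](bigID (mem (~: G)))/=.
    rewrite -[leLHS]addr0 lerD//; last first.
      by apply: sumr_ge0 => s _; apply: sumr_ge0.
    apply: ler_sum => s; rewrite !inE -has_predC => /hasP[i oos /=].
    rewrite -ltNge => go; rewrite (perm_big _ (perm_to_rem oos)) big_cons.
    rewrite (le_trans (ltW go))// lerDl; exact: sumr_ge0.
  rewrite exchange_big/= mulr_natl -[size os]subn0.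
  have -> : T *+ (size os - 0) = \sum_(o <- os) T.
    by rewrite big_const_seq count_predT iter_addr_0 subn0.
  rewrite big_seq [leRHS]big_seq; apply: ler_sum => o oos; apply: le_trans gT.
  have om := osn _ oos.
  rewrite -(big_mkord xpredT g) -(big_mkord xpredT (fun s => g (s + o)%N)).
  by apply: sum_shift_le => //; rewrite addnC.
have h2 : 2 * #|~: G|%:R <= m%:R :> R.
  rewrite -(ler_pM2r e0); move: h1 eT; clear; nra.
have := cardsC G; rewrite card_ord; move: h2; rewrite -natrM ler_nat; lia.
Qed.

End Averaging.

Lemma shift_offset_le (a d1 d2 d3 : nat) : (d1 <= d2)%N -> (d2 <= d3)%N ->
  a \in [:: 0; 1; d1; d1 + 1; d2; d2 + 1; d3; d3 + 1]%N -> (a <= d3 + 1)%N.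
Proof.
by move=> d12 d23; rewrite !inE => /or4P[|||/or4P[|||/orP[]]] /eqP ->; lia.
Qed.

Section ExponentialSums.
Context {R : realType}.
Variables (psi : R -> R) (c c0 C1 : R).
Hypothesis psi_ge0 : forall x, 0 <= psi x.
Hypothesis psi_cluster : forall eta x y, 0 <= eta -> psi x <= eta ^+ 2 ->
  psi y <= eta ^+ 2 -> `|x - y| <= c0 -> `|x - y| <= C1 * eta.
Hypothesis psi_quad : forall x, `|x| <= c0 -> c * x ^+ 2 <= psi x.
Hypotheses (c_gt0 : 0 < c) (c0_gt0 : 0 < c0).

(** The index [K] stands for 0, so that with [M] equal to [2 * K] the grid contains all differences
    of two points with indices below [K]. *)
Definition grid_vec (dl : R) (K : nat) (M : nat) (w : 'I_M * 'I_M) : R * R :=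
  (dl * w.1%:R - dl * K%:R, dl * w.2%:R - dl * K%:R).

(** Bounds the modulus of the characteristic function of the sum at the grid vector, since |phi|^2 =
    1 - psi <= exp (- psi). *)
Definition grid_weight (n : nat) (th dl : R) (K : nat) (w : 'I_(2 * K) * 'I_(2 * K)) : R :=
  expR (- (\sum_(j < n) psi (rotx (grid_vec dl K w) (j%:R * th))) / 2).

(** The square of an integer is at least its absolute value, so each half of the sum is below a
    geometric series of ratio exp (- a) <= 1 / (1 + a). *)
Lemma gauss_sum_le (a : R) (K : nat) : 0 < a ->
  \sum_(p < 2 * K) expR (- a * (p%:R - K%:R) ^+ 2) <= 2 + 2 / a.
Proof.
move=> a0.
have geo m : \sum_(0 <= p < m) expR (- a * p%:R) <= 1 + 1 / a.
  have a1 : 0 < 1 + a by rewrite addr_gt0.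
  apply: (@le_trans _ _ (\sum_(0 <= p < m) (1 + a)^-1 ^+ p)).
    apply: ler_sum => p _; rewrite mulrC expRM_natl lerXn2r ?nnegrE ?expR_ge0//.
      by rewrite invr_ge0 ltW.
    by rewrite expRN lef_pV2 ?posrE ?expR_gt0// expR_ge1Dx.
  have gs : (1 - (1 + a)^-1) * \sum_(0 <= p < m) (1 + a)^-1 ^+ p = 1 - (1 + a)^-1 ^+ m.
    elim: m => [|m IH]; first by rewrite big_geq// mulr0 expr0 subrr.
    by rewrite big_nat_recr//= mulrDr IH exprS; ring.
  have q0 : 1 - (1 + a)^-1 = a / (1 + a) by field; rewrite gt_eqF.
  have a2 : 0 < a / (1 + a) by rewrite divr_gt0.
  rewrite -(ler_pM2l a2) -{1}q0 gs.
  have -> : a / (1 + a) * (1 + 1 / a) = 1 by field; rewrite !gt_eqF.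
  by rewrite lerBlDr lerDl exprn_ge0// invr_ge0 ltW.
have sqn (i : nat) : (i%:R : R) <= i%:R ^+ 2.
  by rewrite -natrX ler_nat; case: i => // i; rewrite leq_pmulr.
rewrite -(big_mkord xpredT (fun p => expR (- a * (p%:R - K%:R) ^+ 2))).
rewrite (@big_cat_nat _ _ _ K)//=; last by rewrite mul2n -addnn leq_addr.
have -> : 2 + 2 / a = (1 + 1 / a) + (1 + 1 / a) by ring.
apply: lerD.
  apply: le_trans (geo K); rewrite big_nat_rev/= [leLHS]big_nat [leRHS]big_nat.
  apply: ler_sum => p pK; rewrite ler_expR !mulNr lerN2 ler_wpM2l ?(ltW a0)//.
  rewrite add0n natrB//; have -> : K%:R - p.+1%:R - K%:R = - p.+1%:R :> R by ring.
  rewrite sqrrN.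
  by apply: le_trans (sqn _) _; rewrite lerXn2r ?nnegrE ?ler_nat.
apply: le_trans (geo K).
have := big_addn 0 (2 * K) K xpredT (fun p => expR (- a * (p%:R - K%:R) ^+ 2)).
rewrite add0n mul2n -addnn addnK => ->; apply: ler_sum => p _.
by rewrite natrD addrK ler_expR !mulNr lerN2 ler_wpM2l// ltW.
Qed.

Lemma grid_weight_small n e th dl K (w : 'I_(2 * K) * 'I_(2 * K)) : (2 * e <= n)%N ->
  (grid_vec dl K w).1 ^+ 2 + (grid_vec dl K w).2 ^+ 2 <= c0 ^+ 2 ->
  grid_weight n th dl w <=
  expR (- (c * n%:R * dl ^+ 2 * sin (e%:R * th) ^+ 2 / 16) * (w.1%:R - K%:R) ^+ 2) *
  expR (- (c * n%:R * dl ^+ 2 * sin (e%:R * th) ^+ 2 / 16) * (w.2%:R - K%:R) ^+ 2).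
Proof.
move=> en wc0; rewrite -expRD ler_expR.
have h1 : c * \sum_(j < n) rotx (grid_vec dl K w) (j%:R * th) ^+ 2 <=
    \sum_(j < n) psi (rotx (grid_vec dl K w) (j%:R * th)).
  rewrite mulr_sumr; apply: ler_sum => j _; apply: psi_quad.
  exact: rotx_le (ltW c0_gt0) wc0.
have h2 := quad_lower (grid_vec dl K w) th en.
have := le_trans (ler_wpM2l (ltW c_gt0) h2) h1.
move: (\sum_(j < n) psi _) => S; rewrite /grid_vec/=; clear.
have -> : dl * w.1%:R - dl * K%:R = dl * (w.1%:R - K%:R) by ring.
have -> : dl * w.2%:R - dl * K%:R = dl * (w.2%:R - K%:R) by ring.
move: (w.1%:R - K%:R) (w.2%:R - K%:R) (sin _) => p q s; rewrite !exprMn.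
lra.
Qed.

Lemma gauss_weight_sum (a : R) (K : nat) : 0 < a ->
  \sum_(w : 'I_(2 * K) * 'I_(2 * K))
    expR (- a * (w.1%:R - K%:R) ^+ 2) * expR (- a * (w.2%:R - K%:R) ^+ 2)
  <= (2 + 2 / a) ^+ 2.
Proof.
move=> a0; rewrite -(pair_bigA _ (fun p q : 'I_(2 * K) =>
  expR (- a * (p%:R - K%:R) ^+ 2) * expR (- a * (q%:R - K%:R) ^+ 2)))/=.
rewrite expr2; under eq_bigr do rewrite -mulr_sumr.
rewrite -mulr_suml; apply: ler_pM; try exact: gauss_sum_le.
  by apply: sumr_ge0 => *; exact: expR_ge0.
by apply: sumr_ge0 => *; exact: expR_ge0.
Qed.

Lemma grid_weight_gauss n e th dl K (a : R) (w : 'I_(2 * K) * 'I_(2 * K)) :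
  (2 * e <= n)%N ->
  (grid_vec dl K w).1 ^+ 2 + (grid_vec dl K w).2 ^+ 2 <= c0 ^+ 2 ->
  a <= c * n%:R * dl ^+ 2 * sin (e%:R * th) ^+ 2 / 16 ->
  grid_weight n th dl w <=
  expR (- a * (w.1%:R - K%:R) ^+ 2) * expR (- a * (w.2%:R - K%:R) ^+ 2).
Proof.
move=> en wc aa; apply: le_trans (grid_weight_small _ en wc) _.
by rewrite ler_pM ?expR_ge0// ler_expR !mulNr lerN2 ler_wpM2r// sqr_ge0.
Qed.

(** The whole grid lies in the disc of radius [c0], so every vector is short. Used close to the real
    axis, where the sine may be small. *)
Lemma low_freq_sum n e th dl K (a : R) : (2 * e <= n)%N ->
  2 * (dl * K%:R) ^+ 2 <= c0 ^+ 2 ->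
  0 < a -> a <= c * n%:R * dl ^+ 2 * sin (e%:R * th) ^+ 2 / 16 ->
  \sum_(w : 'I_(2 * K) * 'I_(2 * K)) grid_weight n th dl w <= (2 + 2 / a) ^+ 2.
Proof.
move=> en Kc a0 aa; apply: le_trans (gauss_weight_sum K a0).
apply: ler_sum => w _; apply: grid_weight_gauss en _ aa.
apply: le_trans Kc; rewrite /grid_vec/= -!mulrBr !exprMn -mulrDr mulrCA.
have sq (p : 'I_(2 * K)) : (p%:R - K%:R) ^+ 2 <= K%:R ^+ 2 :> R.
  rewrite -(real_normK (num_real (_ - _))) lerXn2r ?nnegrE// ler_norml.
  have : p%:R <= (2 * K)%:R :> R by rewrite ler_nat ltnW.
  by rewrite natrM => h; rewrite lerBlDr lerBrDr addNr ler0n; lra.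
rewrite ler_wpM2l ?sqr_ge0//.
move: (sq w.1) (sq w.2); move: (_ ^+ 2) (_ ^+ 2) (_ ^+ 2) => u v z; lra.
Qed.

Variables (n N K m : nat) (th : 'I_N -> R) (h0 dl eta lam : R) (e d2 d3 : nat).
Variable JJ : {set 'I_N}.
Hypothesis thh : forall k l, `|th k - th l| = `|h0 * k%:R - h0 * l%:R|.
Hypothesis JJsin : {in JJ, forall k, 3^-1 <= `|sin (e%:R * th k)|}.
Hypothesis JJdiam : {in JJ &, forall k l : 'I_N, e%:R * `|h0 * k%:R - h0 * l%:R| <= 1}.
Hypotheses (h0_gt0 : 0 < h0) (dl_gt0 : 0 < dl) (eta_gt0 : 0 < eta) (lam_ge0 : 0 <= lam).
Hypotheses (e_gt0 : (0 < e)%N) (en : (2 * e <= n)%N) (m_gt0 : (0 < m)%N).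
Hypotheses (d21 : (100 * 70 <= d2)%N) (d32 : (d2 <= d3)%N) (d3n : ((d3 + 1) * e + m <= n)%N).
Hypotheses (etac0 : C1 * eta <= c0 / 100) (C1_ge0 : 0 <= C1).
Hypothesis etam : 16 * lam <= eta ^+ 2 * m%:R.

Let T : finType := ('I_N * ('I_(2 * K) * 'I_(2 * K)))%type.
Let val (t : T) (a : nat) : R := rotx (grid_vec dl K t.2) (a%:R * th t.1).
Let nrm (t : T) := (grid_vec dl K t.2).1 ^+ 2 + (grid_vec dl K t.2).2 ^+ 2.
Let bad : {set T} := [set t | [&& t.1 \in JJ, c0 ^+ 2 <= nrm t &
  \sum_(j < n) psi (val t j) <= lam]]%SET.

Definition bad_bound : R :=
  2 * ((Num.truncn (2 * (2 * dl * K%:R) / c0)).+1%:R *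
      ((Num.truncn (2 * (2 * dl * K%:R) / c0)).+1%:R *
  cell_bound (C1 * eta) c0 (2 * dl * K%:R) (100 * 70) d2%:R d3%:R (e%:R * h0) 1 dl)).

(** For at least half of the shifts s all eight values have psi at most [eta ^+ 2]: this is 2 * 8 *
    lam <= eta^2 m. For a fixed s the rotation starts at [s%:R * th k] and steps by [e%:R * th k],
    and [lattice_count] applies to the set where psi is small. *)
Lemma card_bad : #|bad|%:R <= bad_bound.
Proof.
pose os := [seq (a * e)%N | a <- [:: 0; 1; 100 * 70; 100 * 70 + 1; d2; d2 + 1; d3; d3 + 1]]%N.
have osm i : i \in os -> (i + m <= n)%N.
  move=> /mapP[a + ->]; move=> ha; apply: leq_trans d3n.
  rewrite leq_add2r leq_mul2r; apply/orP; right.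
  exact: shift_offset_le d21 d32 ha.
apply: (@card_double_count R _ _ m
  (fun s t => all (fun i => psi (val t (s + i)) <= eta ^+ 2) os)) => //.
  move=> t; rewrite inE => /and3P[_ _ tl].
  apply: (@shift_good_count R (fun j => psi (val t j)) n m os lam) => //.
    exact: exprn_gt0.
  have -> : (size os)%:R = 8 :> R by [].
  by apply: le_trans etam; rewrite -natrM.
move=> s.
pose A := [pred z : R | psi z <= eta ^+ 2].
pose f (k : 'I_N) := e%:R * th k.
pose x (k : 'I_N) := s%:R * th k.
set E := [set t in bad | _]%SET.
have ps : (0 : R) <= 100 * 70 by rewrite mulr_ge0 ?ler0n.
apply: (@lattice_count R A (C1 * eta) c0 (2 * dl * K%:R) (100 * 70) d2%:R d3%:R
    (e%:R * h0) 1 dl (dl * K%:R) _ _ _ _ _ _ _ _ _ _ N (2 * K) x f _ E) => //.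
- by move=> u v uA vA; apply: psi_cluster => //; exact: ltW.
- by rewrite mulr_ge0// ltW.
- by rewrite -natrM ler_nat.
- by rewrite -natrM ler_nat (leq_trans d21).
- by rewrite mulr_gt0// ltr0n.
- by move=> k l; rewrite /f -mulrBr -!mulrA -mulrBr !normrM thh.
- move=> t; rewrite inE => /andP[]; rewrite inE => /and3P[tJ tc tl] /allP tA.
  have AA a : (a * e)%N \in os -> A (rotx (grid_vec dl K t.2) (x t.1 + a%:R * f t.1)).
    move=> aos; have := tA _ aos; rewrite /val /=.
    by rewrite /x /f natrD natrM mulrDl mulrA.
  have mos a : a \in [:: 0; 1; 100 * 70; 100 * 70 + 1; d2; d2 + 1; d3; d3 + 1]%N ->
    (a * e)%N \in os by move=> ha; apply/mapP; exists a.
  have e70 : 100 * 70 = (100 * 70)%N%:R :> R by rewrite natrM.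
  have e1 (i : nat) : i%:R + 1 = (i + 1)%N%:R :> R by rewrite natrD.
  split.
  + exact: JJsin.
  + exact: tc.
  + rewrite /grid_vec/= -!mulrBr !exprMn -mulrDr.
    have sq (p : 'I_(2 * K)) : (p%:R - K%:R) ^+ 2 <= K%:R ^+ 2 :> R.
      rewrite -(real_normK (num_real (_ - _))) lerXn2r ?nnegrE// ler_norml.
      have : p%:R <= (2 * K)%:R :> R by rewrite ler_nat ltnW.
      by rewrite natrM => h; rewrite lerBlDr lerBrDr addNr ler0n; lra.
    rewrite mulrAC [leRHS]mulrC ler_wpM2l ?sqr_ge0//.
    move: (sq t.2.1) (sq t.2.2) (sqr_ge0 (K%:R : R)).
    by move: (_ ^+ 2) (_ ^+ 2) (_ ^+ 2) => u v z; lra.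
  + split.
    * by apply: (AA 0%N); apply: mos; rewrite inE eqxx.
    * by apply: (AA 1%N); apply: mos; rewrite !inE eqxx ?orbT.
    * by rewrite e70; apply: AA; apply: mos; rewrite !inE eqxx ?orbT.
    * by rewrite e70 e1; apply: AA; apply: mos; rewrite !inE eqxx ?orbT.
    * split.
      - by apply: AA; apply: mos; rewrite !inE eqxx ?orbT.
      - by rewrite e1; apply: AA; apply: mos; rewrite !inE eqxx ?orbT.
      - by apply: AA; apply: mos; rewrite !inE eqxx ?orbT.
      - by rewrite e1; apply: AA; apply: mos; rewrite !inE eqxx ?orbT.
- move=> t t'; rewrite !inE => /andP[/and3P[tJ _ _] _] /andP[/and3P[t'J _ _] _].
  by rewrite -!mulrA -mulrBr normrM ger0_norm ?ler0n//; exact: JJdiam.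
- by rewrite !mulr_ge0// ltW.
Qed.

(** A weight is Gaussian for a short vector, at most [expR (- lam / 2)] for a long vector that is
    not bad, and at most 1 for a bad pair. The 144 is 16 * 9, the squared sine being at least
    1/9. *)
Lemma main_freq_sum (a : R) : 0 < a -> a <= c * n%:R * dl ^+ 2 / 144 ->
  \sum_(k in JJ) \sum_(w : 'I_(2 * K) * 'I_(2 * K)) grid_weight n (th k) dl w <=
  #|JJ|%:R * ((2 + 2 / a) ^+ 2 + 4 * K%:R ^+ 2 * expR (- lam / 2)) + bad_bound.
Proof.
move=> a0 aa.
pose bd k w : R := ((k, w) \in bad)%:R.
have pw k (w : 'I_(2 * K) * 'I_(2 * K)) : k \in JJ -> grid_weight n (th k) dl w <=
   expR (- a * (w.1%:R - K%:R) ^+ 2) * expR (- a * (w.2%:R - K%:R) ^+ 2) +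
   expR (- lam / 2) + bd k w.
  move=> kJ.
  have e0 := mulr_ge0 (expR_ge0 (- a * (w.1%:R - K%:R) ^+ 2))
                      (expR_ge0 (- a * (w.2%:R - K%:R) ^+ 2)).
  have [wc|/ltW wc] := leP (nrm (k, w)) (c0 ^+ 2).
    apply: le_trans (grid_weight_gauss (a := a) en wc _) _; last first.
      by rewrite -addrA lerDl addr_ge0 ?expR_ge0 ?ler0n.
    apply: le_trans aa _.
    have := norm_sqr_le (a := 3^-1) (r := `|sin (e%:R * th k)|).
    rewrite ger0_norm// => /(_ (JJsin kJ)); rewrite real_normK ?num_real// => h1.
    have : 0 <= c * n%:R * dl ^+ 2 by rewrite !mulr_ge0 ?sqr_ge0// ltW.
    move: h1; move: (sin _ ^+ 2) (c * _ * _) => S Z; nra.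
  have [wl|/ltW wl] := leP (\sum_(j < n) psi (val (k, w) j)) lam.
    rewrite /bd inE kJ wc wl /=; apply: (@le_trans _ _ 1); last first.
      by rewrite lerDr addr_ge0 ?expR_ge0.
    rewrite -expR0 ler_expR /val/= mulNr oppr_le0 divr_ge0//.
    by apply: sumr_ge0.
  apply: (@le_trans _ _ (expR (- lam / 2))); last first.
    by rewrite addrAC lerDr addr_ge0 ?ler0n.
  by rewrite ler_expR ler_pM2r ?invr_gt0// lerN2.
apply: le_trans (_ : _ <= \sum_(k in JJ) ((2 + 2 / a) ^+ 2 + 4 * K%:R ^+ 2 * expR (- lam / 2)
    + \sum_(w : 'I_(2 * K) * 'I_(2 * K)) bd k w)) _.
  apply: ler_sum => k kJ; apply: le_trans (ler_sum _ (fun w _ => pw k w kJ)) _.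
  rewrite !big_split/= lerD2r lerD ?gauss_weight_sum//.
  rewrite sumr_const card_prod !card_ord -[leLHS]mulr_natl !natrM.
  by rewrite le_eqVlt; apply/orP; left; apply/eqP; ring.
rewrite big_split/= lerD//.
  by rewrite sumr_const -[leLHS]mulr_natl.
apply: le_trans card_bad.
have -> : #|bad|%:R = \sum_k \sum_(w : 'I_(2 * K) * 'I_(2 * K)) bd k w.
  rewrite (pair_bigA _ bd)/= -sum1_card natr_sum big_mkcond/=.
  by apply: eq_bigr => -[k w] _; rewrite /bd/=; case: (_ \in _).
rewrite [leRHS](bigID (mem JJ))/= lerDl.
by apply: sumr_ge0 => k _; apply: sumr_ge0 => w _; rewrite ler0n.
Qed.

End ExponentialSums.

(** * Characteristic functions and small-ball probabilities *)

Section Mean.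
Context d (T : measurableType d) (R : realType) (P : probability T R).
Implicit Types f g X : T -> R.

Definition mean f : R := Rintegral P setT f.

Definition intg f : Prop := P.-integrable setT (EFin \o f).

Lemma intg_bounded f (M : R) : measurable_fun setT f -> (forall w, `|f w| <= M) -> intg f.
Proof.
move=> mf fM; apply: measurable_bounded_integrable => //.
  exact: le_lt_trans (probability_le1 P measurableT) (ltry _).
exists M; split; first exact: num_real.
by move=> x Mx w _ /=; exact: le_trans (fM w) (ltW Mx).
Qed.

Lemma intg_cst (c : R) : intg (fun=> c).
Proof. exact: (@intg_bounded _ `|c|). Qed.

Lemma intgD f g : intg f -> intg g -> intg (fun w => f w + g w).
Proof.
move=> fi gi; rewrite /intg.
rewrite (_ : _ \o _ = (EFin \o f) \+ (EFin \o g))%E; first exact: integrableD.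
by apply/funext => w.
Qed.

Lemma intgZ (c : R) f : intg f -> intg (fun w => c * f w).
Proof.
move=> fi; rewrite /intg.
rewrite (_ : _ \o _ = (fun w => c%:E * (EFin \o f) w))%E; first exact: integrableZl.
by apply/funext => w.
Qed.

Lemma intgB f g : intg f -> intg g -> intg (fun w => f w - g w).
Proof.
move=> fi gi; rewrite /intg.
rewrite (_ : _ \o _ = (EFin \o f) \- (EFin \o g))%E; first exact: integrableB.
by apply/funext => w.
Qed.

Lemma intg_le f g : measurable_fun setT f -> (forall w, `|f w| <= g w) -> intg g -> intg f.
Proof.
move=> mf fg gi; apply: le_integrable gi => //; first exact/measurable_EFinP.
by move=> w _ /=; rewrite lee_fin (le_trans (fg w))// ler_norm.
Qed.

Lemma intg_sum (I : Type) (s : seq I) (F : I -> T -> R) :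
  (forall i, intg (F i)) -> intg (fun w => \sum_(i <- s) F i w).
Proof.
move=> Fi; elim: s => [|i s IH].
  by rewrite (_ : (fun w => _) = (fun=> 0)); [exact: intg_cst|apply/funext => w; rewrite big_nil].
rewrite (_ : (fun w => _) = (fun w => F i w + \sum_(j <- s) F j w)); first exact: intgD.
by apply/funext => w; rewrite big_cons.
Qed.

Lemma mean_cst (c : R) : mean (fun=> c) = c.
Proof. by rewrite /mean Rintegral_cst// -[X in _ * fine X]/(P setT) probability_setT mulr1. Qed.

Lemma meanD f g : intg f -> intg g -> mean (fun w => f w + g w) = mean f + mean g.
Proof. by move=> fi gi; rewrite /mean RintegralD. Qed.

Lemma meanB f g : intg f -> intg g -> mean (fun w => f w - g w) = mean f - mean g.
Proof. by move=> fi gi; rewrite /mean RintegralB. Qed.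

Lemma meanZ (c : R) f : intg f -> mean (fun w => c * f w) = c * mean f.
Proof. by move=> fi; rewrite /mean RintegralZl. Qed.

Lemma mean_ge0 f : (forall w, 0 <= f w) -> 0 <= mean f.
Proof. by move=> f0; apply: Rintegral_ge0. Qed.

Lemma mean_le f g : intg f -> intg g -> (forall w, f w <= g w) -> mean f <= mean g.
Proof. by move=> fi gi fg; apply: le_Rintegral. Qed.

Lemma mean_sum (I : Type) (s : seq I) (F : I -> T -> R) :
  (forall i, intg (F i)) -> mean (fun w => \sum_(i <- s) F i w) = \sum_(i <- s) mean (F i).
Proof.
move=> Fi; elim: s => [|i s IH].
  by rewrite big_nil -[RHS](mean_cst 0); congr mean; apply/funext => w; rewrite big_nil.
rewrite big_cons -IH -meanD//; last exact: intg_sum.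
by congr mean; apply/funext => w; rewrite big_cons.
Qed.

Lemma mean_norm_le f (M : R) : measurable_fun setT f -> (forall w, `|f w| <= M) ->
  `|mean f| <= M.
Proof.
move=> mf fM; have fi := intg_bounded mf fM.
rewrite ler_norml; apply/andP; split.
  rewrite -[leLHS]mean_cst; apply: mean_le => //; first exact: intg_cst.
  by move=> w; have := fM w; rewrite ler_norml => /andP[].
rewrite -[leRHS]mean_cst; apply: mean_le => //; first exact: intg_cst.
by move=> w; have := fM w; rewrite ler_norml => /andP[].
Qed.

Definition ecos X (x : R) : R := mean (fun w => cos (x * X w)).

Definition esin X (x : R) : R := mean (fun w => sin (x * X w)).

(* 1 - |phi|^2, where phi is the characteristic function of X *)
Definition psi X (x : R) : R := 1 - ecos X x ^+ 2 - esin X x ^+ 2.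

Section CharacteristicFunction.
Variables (X : T -> R) (mX : measurable_fun setT X).

Lemma measurable_cosM (x : R) : measurable_fun setT (fun w => cos (x * X w)).
Proof.
apply: (measurableT_comp (f := cos)); last exact: measurable_funM.
by apply: continuous_measurable_fun; exact: continuous_cos.
Qed.

Lemma measurable_sinM (x : R) : measurable_fun setT (fun w => sin (x * X w)).
Proof.
apply: (measurableT_comp (f := sin)); last exact: measurable_funM.
by apply: continuous_measurable_fun; exact: continuous_sin.
Qed.

Lemma intg_cosM (x : R) : intg (fun w => cos (x * X w)).
Proof. by apply: intg_bounded (measurable_cosM x) _ => w; exact: cos_max. Qed.

Lemma intg_sinM (x : R) : intg (fun w => sin (x * X w)).
Proof. by apply: intg_bounded (measurable_sinM x) _ => w; exact: sin_max. Qed.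

(** Squared distance from e^(i x X) to a + i b. Its mean is variance plus squared bias, which
    exhibits [psi] as the variance of e^(i x X). *)
Let dev (x a b : R) (w : T) : R := (cos (x * X w) - a) ^+ 2 + (sin (x * X w) - b) ^+ 2.

Let devE (x a b : R) : dev x a b =
  fun w => (1 + a ^+ 2 + b ^+ 2) - ((2 * a) * cos (x * X w) + (2 * b) * sin (x * X w)).
Proof.
apply/funext => w; rewrite /dev.
transitivity ((cos (x * X w) ^+ 2 + sin (x * X w) ^+ 2 + a ^+ 2 + b ^+ 2) -
  ((2 * a) * cos (x * X w) + (2 * b) * sin (x * X w))); first by ring.
by rewrite cos2Dsin2.
Qed.

Let intg_dev (x a b : R) : intg (dev x a b).
Proof.
rewrite devE; apply: intgB; first exact: intg_cst.
by apply: intgD; apply: intgZ; [exact: intg_cosM|exact: intg_sinM].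
Qed.

Let mean_dev (x a b : R) :
  mean (dev x a b) = psi X x + (ecos X x - a) ^+ 2 + (esin X x - b) ^+ 2.
Proof.
rewrite devE meanB; [|exact: intg_cst|]; last first.
  by apply: intgD; apply: intgZ; [exact: intg_cosM|exact: intg_sinM].
rewrite mean_cst meanD; [|apply: intgZ; exact: intg_cosM|apply: intgZ; exact: intg_sinM].
rewrite !meanZ; [|exact: intg_sinM|exact: intg_cosM].
rewrite /psi -/(ecos X x) -/(esin X x); ring.
Qed.

Lemma psi_ge0 (x : R) : 0 <= psi X x.
Proof.
have := mean_dev x (ecos X x) (esin X x); rewrite !subrr expr0n !addr0 => <-.
by apply: mean_ge0 => w; rewrite addr_ge0 ?sqr_ge0.
Qed.

Lemma psiN (x : R) : psi X (- x) = psi X x.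
Proof.
rewrite /psi; congr (_ - _ - _).
  by congr (_ ^+ 2); congr mean; apply/funext => w; rewrite mulNr cosN.
rewrite -sqrrN; congr (_ ^+ 2).
rewrite -mulN1r -meanZ; last exact: intg_sinM.
by congr mean; apply/funext => w; rewrite (mulNr x) sinN mulN1r opprK.
Qed.

(* sqrt psi is subadditive up to a factor: e^(ix) e^(iy) - phi_x phi_y =
   e^(ix) (e^(iy) - phi_y) + phi_y (e^(ix) - phi_x) *)
Lemma psiD_le (x y : R) : psi X (x + y) <= 2 * psi X x + 2 * psi X y.
Proof.
set Cx := ecos X x; set Sx := esin X x; set Cy := ecos X y; set Sy := esin X y.
(* The constant a + i b is phi_x phi_y; the variance is the least mean squared distance to a
   constant, so any choice gives an upper bound. *)
pose a := Cx * Cy - Sx * Sy; pose b := Sx * Cy + Cx * Sy.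
apply: (@le_trans _ _ (mean (dev (x + y) a b))).
  by rewrite mean_dev -addrA lerDl addr_ge0 ?sqr_ge0.
apply: (@le_trans _ _ (mean (fun w => 2 * dev y Cy Sy w +
    2 * (Cy ^+ 2 + Sy ^+ 2) * dev x Cx Sx w))).
  apply: mean_le; first exact: intg_dev.
    by apply: intgD; apply: intgZ; exact: intg_dev.
  move=> w; rewrite /dev mulrDl cosD sinD /a /b.
  have := cos2Dsin2 (x * X w).
  move: (cos (x * X w)) (sin (x * X w)) (cos (y * X w)) (sin (y * X w)) => c s c' s' cs.
  pose p1 := c * (c' - Cy) - s * (s' - Sy).
  pose p2 := s * (c' - Cy) + c * (s' - Sy).
  pose q1 := Cy * (c - Cx) - Sy * (s - Sx).
  pose q2 := Sy * (c - Cx) + Cy * (s - Sx).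
  have -> : c * c' - s * s' - (Cx * Cy - Sx * Sy) = p1 + q1 by rewrite /p1 /q1; ring.
  have -> : s * c' + c * s' - (Sx * Cy + Cx * Sy) = p2 + q2 by rewrite /p2 /q2; ring.
  have -> : 2 * ((c' - Cy) ^+ 2 + (s' - Sy) ^+ 2) = 2 * (p1 ^+ 2 + p2 ^+ 2).
    transitivity (2 * ((c' - Cy) ^+ 2 + (s' - Sy) ^+ 2) * (c ^+ 2 + s ^+ 2)).
      by rewrite cs mulr1.
    by rewrite /p1 /p2; ring.
  have -> : 2 * (Cy ^+ 2 + Sy ^+ 2) * ((c - Cx) ^+ 2 + (s - Sx) ^+ 2) =
      2 * (q1 ^+ 2 + q2 ^+ 2) by rewrite /q1 /q2; ring.
  have gen (u v u' v' : R) :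
      (u + u') ^+ 2 + (v + v') ^+ 2 <= 2 * (u ^+ 2 + v ^+ 2) + 2 * (u' ^+ 2 + v' ^+ 2).
    have := sqr_ge0 (u - u'); have := sqr_ge0 (v - v'); nra.
  exact: gen.
rewrite meanD; [|apply: intgZ; exact: intg_dev|apply: intgZ; exact: intg_dev].
rewrite !meanZ; [|exact: intg_dev|exact: intg_dev].
rewrite !mean_dev !subrr expr0n !addr0 addrC lerD2r.
apply: ler_wpM2r; first exact: psi_ge0.
have := psi_ge0 y; rewrite /psi -/Cy -/Sy; lra.
Qed.

Variable sig2 : R.
Hypotheses (iX1 : intg X) (iX2 : intg (fun w => X w ^+ 2)) (iX4 : intg (fun w => X w ^+ 4)).
Hypotheses (EX1 : mean X = 0) (EX2 : mean (fun w => X w ^+ 2) = sig2) (sig2_gt0 : 0 < sig2).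

(** Expand the cosine to fourth order: psi x = sig2 x^2 + O(x^4). The radius depends on the fourth
    moment, but the coefficient only on the variance, as the final constant requires. *)
Lemma psi_quad_near0 : exists2 c0 : R, 0 < c0 &
  forall x, `|x| <= c0 -> sig2 / 4 * x ^+ 2 <= psi X x.
Proof.
pose K4 := mean (fun w => X w ^+ 4).
have K40 : 0 <= K4 by apply: mean_ge0 => w; rewrite (exprM _ 2 2) sqr_ge0.
have hC1 x : ecos X x <= 1 - x ^+ 2 * (sig2 / 2) + x ^+ 4 * (K4 / 24).
  have -> : 1 - x ^+ 2 * (sig2 / 2) + x ^+ 4 * (K4 / 24) =
     mean (fun w => 1 - (x ^+ 2 / 2) * X w ^+ 2 + (x ^+ 4 / 24) * X w ^+ 4).
    rewrite meanD; [|apply: intgB; [exact: intg_cst|exact: intgZ]|exact: intgZ].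
    rewrite meanB; [|exact: intg_cst|exact: intgZ].
    by rewrite !meanZ// mean_cst EX2 -/K4; field.
  apply: mean_le; first exact: intg_cosM.
    apply: intgD; last exact: intgZ.
    by apply: intgB; [exact: intg_cst|exact: intgZ].
  move=> w; apply: le_trans (cos_le_quartic _) _; rewrite !exprMn.
  by rewrite le_eqVlt; apply/orP; left; apply/eqP; field.
have hC2 x : 1 - x ^+ 2 * (sig2 / 2) <= ecos X x.
  have -> : 1 - x ^+ 2 * (sig2 / 2) = mean (fun w => 1 - (x ^+ 2 / 2) * X w ^+ 2).
    rewrite meanB; [|exact: intg_cst|exact: intgZ].
    by rewrite !meanZ// mean_cst EX2; field.
  apply: mean_le; [|exact: intg_cosM|].
    by apply: intgB; [exact: intg_cst|exact: intgZ].
  move=> w; apply: le_trans (cos_ge_quad _); rewrite exprMn.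
  by rewrite le_eqVlt; apply/orP; left; apply/eqP; field.
(* The mean being zero, x X may be subtracted from sin (x X), which makes the expectation quadratic
   in x. *)
have hS x : `|esin X x| <= x ^+ 2 * (sig2 / 2).
  have -> : esin X x = mean (fun w => sin (x * X w) - x * X w).
    by rewrite meanB ?meanZ ?EX1 ?mulr0 ?subr0//; [exact: intg_sinM|exact: intgZ].
  have -> : x ^+ 2 * (sig2 / 2) = mean (fun w => (x ^+ 2 / 2) * X w ^+ 2).
    by rewrite meanZ// EX2; field.
  have i1 : intg (fun w => (x ^+ 2 / 2) * X w ^+ 2) by exact: intgZ.
  have i2 : intg (fun w => sin (x * X w) - x * X w).
    by apply: intgB; [exact: intg_sinM|exact: intgZ].
  have le1 w : `|sin (x * X w) - x * X w| <= (x ^+ 2 / 2) * X w ^+ 2.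
    apply: le_trans (sin_sub_id_le _) _; rewrite exprMn.
    by rewrite le_eqVlt; apply/orP; left; apply/eqP; field.
  rewrite ler_norml; apply/andP; split; last first.
    by apply: mean_le => // w; exact: le_trans (ler_norm _) (le1 w).
  rewrite -mulN1r -meanZ//; apply: mean_le => //; first exact: intgZ.
  by move=> w; rewrite mulN1r; have := le1 w; rewrite ler_norml => /andP[].
pose D := K4 / 24 + sig2 ^+ 2 / 4 + sig2 + 1.
have D0 : 0 < D by rewrite /D; have := sqr_ge0 sig2; move: K40 sig2_gt0; lra.
pose q := sig2 / 4 / D.
have q0 : 0 < q by rewrite !divr_gt0.
have qD : q * D = sig2 / 4 by rewrite /q divfK// gt_eqF.
exists (Num.min 1 q); first by rewrite lt_min ltr01.
move=> x; rewrite le_min => /andP[x1 xq].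
have x2 : x ^+ 2 <= q.
  rewrite -real_normK ?num_real// expr2 (le_trans _ xq)// ler_piMl//.
have x4 : x ^+ 4 = x ^+ 2 * x ^+ 2 by rewrite -exprD.
have xx := sqr_ge0 x.
have {}x2 : x ^+ 2 * D <= sig2 / 4 by rewrite -qD ler_wpM2r// ltW.
have s2 : x ^+ 2 * sig2 <= 1.
  have h1 : x ^+ 2 * sig2 <= x ^+ 2 * sig2 * 1 by rewrite mulr1.
  have q4 : q * sig2 <= 1.
    rewrite /q mulrAC ler_pdivrMr// mul1r /D; move: K40 sig2_gt0; have := sqr_ge0 sig2; nra.
  apply: le_trans q4; rewrite ler_wpM2r ?(ltW sig2_gt0)//.
  by move: x2; rewrite -qD ler_pM2r.
have := hC1 x; have := hC2 x; have := norm_sqr_le (hS x).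
rewrite /psi x4 exprMn.
move: (ecos X x) (esin X x ^+ 2) => C S2 hS2 h1 h2.
have C0 : 0 <= C by move: h1 s2; lra.
have C1 : C <= 1.
  apply: le_trans h2 _; move: x2 xx K40 sig2_gt0; rewrite /D.
  move: (x ^+ 2) (sig2 ^+ 2) (sqr_ge0 sig2) => z s4 s40.
  nra.
have CC : C ^+ 2 <= C by rewrite expr2 ler_piMl.
have : x ^+ 2 * x ^+ 2 * (K4 / 24) + (x ^+ 2) ^+ 2 * (sig2 / 2) ^+ 2 <= x ^+ 2 * (sig2 / 4).
  rewrite -expr2 -mulrDr expr2 -mulrA ler_wpM2l//.
  apply: le_trans x2; rewrite ler_wpM2l// /D exprMn.
  move: sig2_gt0; have := sqr_ge0 sig2; lra.
move: hS2 h2 CC; lra.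
Qed.

End CharacteristicFunction.

(** By subadditivity psi (x - y) <= 4 eta^2, and psi (x - y) >= c (x - y)^2 when x and y are within
    [c0]. *)
Lemma psi_cluster X (mX : measurable_fun setT X) (c c0 : R) : 0 < c ->
  (forall x, `|x| <= c0 -> c * x ^+ 2 <= psi X x) ->
  forall eta x y, 0 <= eta -> psi X x <= eta ^+ 2 -> psi X y <= eta ^+ 2 ->
  `|x - y| <= c0 -> `|x - y| <= 2 / Num.sqrt c * eta.
Proof.
move=> c_gt0 pq eta x y e0 px py xy.
have := pq _ xy; have := psiD_le mX x (- y); rewrite psiN// => h1 h2.
have s0 : 0 < Num.sqrt c by rewrite sqrtr_gt0.
have h3 : c * (x - y) ^+ 2 <= 4 * eta ^+ 2.
  move: h1 h2 px py; move: (_ ^+ 2) (_ ^+ 2) => u v; lra.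
have E : (2 / Num.sqrt c * eta) ^+ 2 * c = 4 * eta ^+ 2.
  rewrite !exprMn exprVn sqr_sqrtr ?ltW//; field; rewrite gt_eqF//.
have := @normr_le_sqr _ (x - y) 0 (2 / Num.sqrt c * eta); apply.
  by rewrite mulr_ge0// divr_ge0// ltW.
by rewrite expr0n addr0 -(ler_pM2r c_gt0) E mulrC.
Qed.

End Mean.

(** * Product formula for independent variables *)

Section Independence.
Context d (T : measurableType d) (R : realType) (P : probability T R).

Lemma measurable_comp_RV (X : T -> R) (f : R -> R) :
  measurable_fun setT X -> measurable_fun setT f -> measurable_fun setT (fun w => f (X w)).
Proof. by move=> mX mf; apply: (measurableT_comp (f := f)). Qed.

(* Uniform approximation of f by the step functions truncn (l (f + M)) / l - M. *)
Lemma mean_mul_indep (g X : T -> R) (f : R -> R) (G : R) (M : nat) :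
  measurable_fun setT g -> (forall w, `|g w| <= G) -> measurable_fun setT X ->
  (forall B, measurable B ->
    mean P (fun w => g w * \1_B (X w)) = mean P g * mean P (fun w => \1_B (X w))) ->
  measurable_fun setT f -> (forall x, `|f x| <= M%:R) ->
  mean P (fun w => g w * f (X w)) = mean P g * mean P (fun w => f (X w)).
Proof.
move=> mg gG mX indB mf fM.
(* A sample point is needed to deduce [0 <= G]; without one, all functions on [T] coincide. *)
have [w0|T0] := pselect (exists w : T, True); last first.
  have E (u v : T -> R) : u = v by apply/funext => w; case: T0; exists w.
  by rewrite (E (fun w => g w * f (X w)) (fun=> 0)) (E g (fun=> 0)) !mean_cst mul0r.
have G0 : 0 <= G by case: w0 => w _; exact: le_trans (gG w).
apply/eqP; rewrite -subr_eq0 -normr_le0; apply/ler_addgt0Pr => eps eps0; rewrite add0r.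
pose l := (Num.truncn (2 * G / eps)).+1.
have l0 : (0 : R) < l%:R by rewrite ltr0n.
have lG : 2 * G / l%:R <= eps.
  rewrite ler_pdivrMr// [leRHS]mulrC -ler_pdivrMr// ltW// /l -natr1.
  have h : 0 <= 2 * G / eps by rewrite divr_ge0 ?mulr_ge0// ltW.
  by have /andP[_] := truncn_itv h; rewrite -natr1.
pose v x : R := l%:R * (f x + M%:R).
have v0 x : 0 <= v x.
  by rewrite mulr_ge0// -lerBlDr sub0r; have := fM x; rewrite ler_norml => /andP[].
pose N := (l * (2 * M)).+1.
have vN x : (Num.truncn (v x) < N)%N.
  rewrite ltnS -(ler_nat R); apply: le_trans (_ : v x <= _).
    by have /andP[] := truncn_itv (v0 x).
  rewrite natrM ler_wpM2l// natrM.
  by have := le_trans (ler_norm _) (fM x); lra.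
pose B i := [set x : R | i%:R <= v x < i.+1%:R].
have mv : measurable_fun setT v.
  by apply: measurable_funM => //; apply: measurable_funD.
have mB i : measurable (B i).
  rewrite (_ : B i = v @^-1` `[i%:R, i.+1%:R[%classic).
    by rewrite -[X in measurable X]setTI; apply: mv.
  by apply/seteqP; split => x /=; rewrite in_itv.
pose s x : R := \sum_(i < N) (i%:R / l%:R - M%:R) * \1_(B i) x.
have sE x : s x = (Num.truncn (v x))%:R / l%:R - M%:R.
  rewrite /s (bigD1 (Ordinal (vN x)))//= indicE mem_set ?mulr1; last first.
    by rewrite /B/=; exact: truncn_itv.
  rewrite big1 ?addr0// => i /eqP ix.
  rewrite indicE memNset ?mulr0// => /= /andP[ia ib]; apply: ix; apply/val_inj => /=.
  by apply/esym/eqP; rewrite truncn_eq// ia ib.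
have fs x : `|f x - s x| <= l%:R^-1.
  have -> : f x - s x = (v x - (Num.truncn (v x))%:R) / l%:R.
    by rewrite sE /v; field; rewrite gt_eqF.
  rewrite normrM normfV (gtr0_norm l0) ler_piMl ?invr_ge0 ?(ltW l0)//.
  have /andP[h1 h2] := truncn_itv (v0 x).
  by rewrite ger0_norm ?subr_ge0// lerBlDr addrC; rewrite -natr1 in h2; exact: ltW.
have mind (C : set R) : measurable C -> measurable_fun setT (fun w => \1_C (X w) : R).
  by move=> mC; apply: measurable_comp_RV => //; exact: measurable_indic.
have ind1 (C : set R) x : `|\1_C x : R| <= 1.
  by rewrite indicE ger0_norm ?ler0n// -[leRHS]/(1%:R) ler_nat leq_b1.
have ms : measurable_fun setT s.
  by apply: measurable_sum => i; apply: measurable_funM => //; exact: measurable_indic.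
have sM x : `|s x| <= M%:R + l%:R^-1.
  rewrite -[s x](subKr (f x)) (le_trans (ler_normB _ _))// lerD//.
have i1 : intg P (fun w => g w * f (X w)).
  apply: (@intg_bounded _ _ _ _ _ (G * M%:R)).
    by apply: measurable_funM => //; exact: measurable_comp_RV.
  by move=> w; rewrite normrM ler_pM.
have i2 : intg P (fun w => g w * s (X w)).
  apply: (@intg_bounded _ _ _ _ _ (G * (M%:R + l%:R^-1))).
    by apply: measurable_funM => //; exact: measurable_comp_RV.
  by move=> w; rewrite normrM ler_pM.
have i3 : intg P (fun w => f (X w)).
  by apply: (@intg_bounded _ _ _ _ _ M%:R) => //; exact: measurable_comp_RV.
have i4 : intg P (fun w => s (X w)).
  by apply: (@intg_bounded _ _ _ _ _ (M%:R + l%:R^-1)) => //; exact: measurable_comp_RV.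
have iB i : intg P (fun w => \1_(B i) (X w)).
  by apply: (@intg_bounded _ _ _ _ _ 1) => //; exact: mind.
have igB i : intg P (fun w => g w * \1_(B i) (X w)).
  apply: (@intg_bounded _ _ _ _ _ (G * 1)).
    by apply: measurable_funM => //; exact: mind.
  by move=> w; rewrite normrM ler_pM.
have Es : mean P (fun w => g w * s (X w)) = mean P g * mean P (fun w => s (X w)).
  have -> : (fun w => g w * s (X w)) =
     (fun w => \sum_(i < N) (i%:R / l%:R - M%:R) * (g w * \1_(B i) (X w))).
    by apply/funext => w; rewrite /s mulr_sumr; apply: eq_bigr => i _; rewrite mulrCA.
  rewrite /s !mean_sum; [|by move=> i; exact: intgZ|by move=> i; exact: intgZ].
  rewrite mulr_sumr; apply: eq_bigr => i _; rewrite !meanZ//.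
  by rewrite indB// mulrCA.
have d1 : `|mean P (fun w => g w * f (X w)) - mean P (fun w => g w * s (X w))| <= G / l%:R.
  rewrite -meanB//; apply: mean_norm_le.
    by apply: measurable_funB; apply: measurable_funM => //; exact: measurable_comp_RV.
  by move=> w; rewrite -mulrBr normrM ler_pM.
have d2 : `|mean P (fun w => f (X w)) - mean P (fun w => s (X w))| <= l%:R^-1.
  rewrite -meanB//; apply: mean_norm_le => //.
  by apply: measurable_funB; exact: measurable_comp_RV.
have d3 : `|mean P g * (mean P (fun w => f (X w)) - mean P (fun w => s (X w)))| <= G / l%:R.
  by rewrite normrM ler_pM// mean_norm_le.
apply: le_trans lG; have -> : 2 * G / l%:R = G / l%:R + G / l%:R by ring.
move: d1 d3; rewrite Es mulrBr.
set a := mean P (fun w => g w * f (X w)); set b := mean P g * mean P (fun w => s (X w)).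
set c := mean P g * mean P _ => h1 h3.
rewrite (_ : a - c = (a - b) - (c - b)); last by ring.
by rewrite (le_trans (ler_normB _ _))// lerD.
Qed.

Variable X : nat -> T -> R.
Hypothesis mX : forall j, measurable_fun setT (X j).
Hypothesis indX : forall (n : nat) (B : nat -> set R), (forall i, measurable (B i)) ->
  mean P (fun w => \prod_(j < n) \1_(B j) (X j w)) =
  \prod_(j < n) mean P (fun w => \1_(B j) (X j w)).

Lemma norm_prod_le (n : nat) (F : nat -> R) (M : R) : 0 <= M ->
  (forall j, `|F j| <= M) -> `|\prod_(j < n) F j| <= M ^+ n.
Proof.
move=> M0 FM; rewrite normr_prod -[n in leRHS]card_ord -prodr_const.
by apply: ler_prod => i _; rewrite normr_ge0 FM.
Qed.

(** A hybrid argument: start from indicators in every coordinate and replace them by the functions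
    [f j] one at a time. *)
Lemma mean_prod (n : nat) (f : nat -> R -> R) (M : nat) :
  (forall j, measurable_fun setT (f j)) -> (forall j x, `|f j x| <= M%:R) ->
  mean P (fun w => \prod_(j < n) f j (X j w)) = \prod_(j < n) mean P (fun w => f j (X j w)).
Proof.
move=> mf fM.
pose F (k : nat) (B : nat -> set R) (j : nat) : R -> R :=
  if (j < k)%N then f j else \1_(B j).
suff claim k B : (k <= n)%N -> (forall i, measurable (B i)) ->
    mean P (fun w => \prod_(j < n) F k B j (X j w)) =
    \prod_(j < n) mean P (fun w => F k B j (X j w)).
  have := claim n (fun=> setT) (leqnn n) (fun=> measurableT).
  rewrite (eq_bigr (fun j : 'I_n => mean P (fun w => f j (X j w)))); last first.
    by move=> j _; congr mean; apply/funext => w; rewrite /F ltn_ord.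
  move=> <-; congr mean; apply/funext => w; apply: eq_bigr => j _.
  by rewrite /F ltn_ord.
elim: k B => [|k IH] B kn mB; first exact: indX.
pose k' := Ordinal kn.
have FE C j : j != k' -> F k.+1 C j = F k C j.
  move=> jk; rewrite /F ltnS leq_eqVlt; case: eqP => //= jk1.
  by move: jk; rewrite -val_eqE/= jk1 eqxx.
pose M' := (M + 1)%N.
have FM k1 C j x : `|F k1 C j x| <= M'%:R.
  rewrite /F; case: ifP => _; last first.
    by rewrite indicE ger0_norm ?ler0n// ler_nat (leq_trans (leq_b1 _))// leq_addl.
  by rewrite (le_trans (fM _ _))// ler_nat leq_addr.
have mF k1 C j : (forall i, measurable (C i)) -> measurable_fun setT (F k1 C j).
  by move=> mC; rewrite /F; case: ifP => _ //; exact: measurable_indic.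
pose g w := \prod_(j < n | j != k') F k.+1 B j (X j w).
have gE w : \prod_(j < n) F k.+1 B j (X j w) = g w * f k (X k w).
  by rewrite (bigD1 k')//= mulrC /F ltnSn.
have upd C (mC : measurable C) i : measurable ((fun j => if j == k then C else B j) i).
  by case: ifP.
(* The induction hypothesis is used with the k-th set replaced by an arbitrary [C]; this is
   independence of [g] and [X k] against indicators, as [mean_mul_indep] requires. *)
have IH1 C : measurable C -> mean P (fun w => g w * \1_C (X k w)) =
   (\prod_(j < n | j != k') mean P (fun w => F k.+1 B j (X j w))) *
    mean P (fun w => \1_C (X k w)).
  move=> mC; pose B' j := if j == k then C else B j.
  have := IH B' (ltnW kn) (upd _ mC).
  have FB' : F k B' k = \1_C by rewrite /F ltnn /B' eqxx.
  have FB j : j != k' -> F k.+1 B j = F k B' j.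
    move=> jk; rewrite FE//; rewrite /F; case: ifP => // _; rewrite /B'.
    by case: eqP => // jk1; move: jk; rewrite -val_eqE/= jk1 eqxx.
  rewrite (bigD1 k')//= FB' mulrC => e1.
  rewrite (eq_bigr (fun j : 'I_n => mean P (fun w => F k B' j (X j w)))); last first.
    by move=> j jk; rewrite FB.
  rewrite -e1; congr mean; apply/funext => w.
  rewrite [RHS](bigD1 k')//= FB' mulrC; congr (_ * _).
  by apply: eq_bigr => j jk; rewrite FB.
have mg : measurable_fun setT g.
  have -> : g = fun w => \prod_(j < n) (if j != k' then F k.+1 B j (X j w) else 1).
    by apply/funext => w; rewrite /g big_mkcond.
  apply: measurable_prod => j _; case: (j != k') => //.
  by apply: measurable_comp_RV => //; exact: mF.
have gM w : `|g w| <= M'%:R ^+ n.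
  pose H (i : nat) := if i != k then F k.+1 B i (X i w) else 1.
  have -> : g w = \prod_(i < n) H i by rewrite /g big_mkcond.
  apply: norm_prod_le => // j; rewrite /H; case: ifP => // _.
  by rewrite normr1 ler1n /M' addn1.
have Eg : mean P g = \prod_(j < n | j != k') mean P (fun w => F k.+1 B j (X j w)).
  have := IH1 setT measurableT.
  rewrite (_ : (fun w => \1_setT (X k w)) = (fun=> 1)); last first.
    by apply/funext => w; rewrite indicE in_setT.
  rewrite mean_cst mulr1 => <-; congr mean; apply/funext => w.
  by rewrite indicE in_setT mulr1.
rewrite (_ : (fun w => \prod_(j < n) _) = (fun w => g w * f k (X k w))); last first.
  by apply/funext => w; exact: gE.
rewrite (@mean_mul_indep g (X k) (f k) (M'%:R ^+ n) M)//; last first.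
  by move=> C mC; rewrite IH1// Eg.
by rewrite Eg [RHS](bigD1 k')//= mulrC /F ltnSn.
Qed.

End Independence.

(** * Esseen's inequality on a grid *)

Section SmallBall.
Context d (T : measurableType d) (R : realType) (P : probability T R).
Variable X : nat -> T -> R.
Hypothesis mX : forall j, measurable_fun setT (X j).
Hypothesis indX : forall (n : nat) (B : nat -> set R), (forall i, measurable (B i)) ->
  mean P (fun w => \prod_(j < n) \1_(B j) (X j w)) =
  \prod_(j < n) mean P (fun w => \1_(B j) (X j w)).
Variable ps : R -> R.
Hypothesis psE : forall j x, psi P (X j) x = ps x.

(** Real and imaginary parts of the product over j < k of the characteristic functions of [X j] at
    [x j]. *)
Fixpoint cs_prod (x : nat -> R) (k : nat) : R * R :=
  if k is k'.+1 then
    let c := ecos P (X k') (x k') in let s := esin P (X k') (x k') in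
    let u := cs_prod x k' in (u.1 * c - u.2 * s, u.2 * c + u.1 * s)
  else (1, 0).

Lemma cs_prod_norm x k : (cs_prod x k).1 ^+ 2 + (cs_prod x k).2 ^+ 2 <=
  expR (- \sum_(j < k) ps (x j)).
Proof.
elim: k => [|k IH] /=; first by rewrite big_ord0 oppr0 expR0 expr1n expr0n addr0.
rewrite big_ord_recr/= opprD expRD.
move: (cs_prod x k) IH => [u v] /= IH.
set c := ecos _ _ _; set s := esin _ _ _.
have -> : (u * c - v * s) ^+ 2 + (v * c + u * s) ^+ 2 =
  (u ^+ 2 + v ^+ 2) * (c ^+ 2 + s ^+ 2) by ring.
have cs1 : c ^+ 2 + s ^+ 2 = 1 - ps (x k) by rewrite -(psE k) /psi -/c -/s; ring.
apply: ler_pM => //; try by rewrite addr_ge0 ?sqr_ge0.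
by rewrite cs1; exact: expR_ge1Dx.
Qed.

Lemma measurable_lin (x : nat -> R) (n : nat) :
  measurable_fun setT (fun w => \sum_(j < n) x j * X j w).
Proof. by apply: measurable_sum => j; exact: measurable_funM. Qed.

(** Independence is known for products of real functions, so the complex exponential is expanded one
    index at a time by the addition formulas. The arbitrary factors [f j] make room for the cosine
    or sine that is split off. *)
Lemma mean_cs_prod (n : nat) (x : nat -> R) (k : nat) : (k <= n)%N ->
  forall f : nat -> R -> R, (forall j, measurable_fun setT (f j)) ->
  (forall j z, `|f j z| <= 1) ->
  mean P (fun w => cos (\sum_(j < k) x j * X j w) * \prod_(k <= j < n) f j (X j w)) =
    (cs_prod x k).1 * \prod_(k <= j < n) mean P (fun w => f j (X j w)) /\
  mean P (fun w => sin (\sum_(j < k) x j * X j w) * \prod_(k <= j < n) f j (X j w)) =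
    (cs_prod x k).2 * \prod_(k <= j < n) mean P (fun w => f j (X j w)).
Proof.
elim: k => [_ f mf f1|k IH kn f mf f1].
  have E := @mean_prod _ _ _ P X mX indX n f 1 mf f1.
  split => /=.
    rewrite mul1r [RHS]big_mkord -E; congr mean; apply/funext => w.
    by rewrite big_ord0 cos0 mul1r big_mkord.
  rewrite mul0r -[RHS](mean_cst P 0); congr mean; apply/funext => w.
  by rewrite big_ord0 sin0 mul0r.
pose upd (g : R -> R) j := if j == k then g else f j.
have prodE (g : R -> R) w : \prod_(k <= j < n) upd g j (X j w) =
    g (X k w) * \prod_(k.+1 <= j < n) f j (X j w).
  rewrite big_ltn// {1}/upd eqxx; congr (_ * _); apply: eq_big_nat => j /andP[jk _].
  by rewrite /upd gtn_eqF.
have prodmE (g : R -> R) : \prod_(k <= j < n) mean P (fun w => upd g j (X j w)) =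
    mean P (fun w => g (X k w)) * \prod_(k.+1 <= j < n) mean P (fun w => f j (X j w)).
  rewrite big_ltn// {1}/upd eqxx; congr (_ * _); apply: eq_big_nat => j /andP[jk _].
  by rewrite /upd gtn_eqF.
have mc (t : R) : measurable_fun setT (fun z : R => cos (t * z)).
  apply: (measurableT_comp (f := cos)); last exact: measurable_funM.
  by apply: continuous_measurable_fun; exact: continuous_cos.
have msn (t : R) : measurable_fun setT (fun z : R => sin (t * z)).
  apply: (measurableT_comp (f := sin)); last exact: measurable_funM.
  by apply: continuous_measurable_fun; exact: continuous_sin.
have mu g : measurable_fun setT g -> forall j, measurable_fun setT (upd g j).
  by move=> mg j; rewrite /upd; case: ifP.
have u1 g : (forall z, `|g z| <= 1) -> forall j z, `|upd g j z| <= 1.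
  by move=> g1 j z; rewrite /upd; case: ifP.
have {IH} IH g := IH (ltnW kn) (upd g).
have [c1 c2] := IH _ (mu _ (mc (x k))) (u1 _ (fun z => cos_max _)).
have [s1 s2] := IH _ (mu _ (msn (x k))) (u1 _ (fun z => sin_max _)).
rewrite !prodmE -/(ecos P (X k) (x k)) -/(esin P (X k) (x k)) in c1 c2 s1 s2.
have mprod (g : nat -> R -> R) : (forall j, measurable_fun setT (g j)) ->
    measurable_fun setT (fun w => \prod_(k <= j < n) g j (X j w)).
  by move=> mg; apply: measurable_prod => j _; exact: measurable_comp_RV.
have bprod (g : nat -> R -> R) w : (forall j z, `|g j z| <= 1) -> `|\prod_(k <= j < n) g j (X j w)| <= 1.
  move=> g1; rewrite normr_prod; apply: prodr_ile1 => j _.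
  by rewrite normr_ge0 g1.
have it (tr g : R -> R) : measurable_fun setT tr -> (forall z, `|tr z| <= 1) ->
    measurable_fun setT g -> (forall z, `|g z| <= 1) ->
    intg P (fun w => tr (\sum_(j < k) x j * X j w) * \prod_(k <= j < n) upd g j (X j w)).
  move=> mtr tr1 mg g1; apply: (@intg_bounded _ _ _ _ _ 1).
    apply: measurable_funM; last by apply: mprod; exact: mu.
    by apply: (measurableT_comp (f := tr)) => //; exact: measurable_lin.
  by move=> w; rewrite normrM mulr_ile1 ?bprod//; exact: u1.
have mcos : measurable_fun setT (@cos R).
  by apply: continuous_measurable_fun; exact: continuous_cos.
have msin : measurable_fun setT (@sin R).
  by apply: continuous_measurable_fun; exact: continuous_sin.
have icc := it cos _ mcos (@cos_max R) (mc (x k)) (fun z => cos_max _).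
have iss := it sin _ msin (@sin_max R) (msn (x k)) (fun z => sin_max _).
have ics := it cos _ mcos (@cos_max R) (msn (x k)) (fun z => sin_max _).
have isc := it sin _ msin (@sin_max R) (mc (x k)) (fun z => cos_max _).
split => /=.
  rewrite mulrBl -!mulrA -c1 -s2 -meanB//; congr mean; apply/funext => w.
  by rewrite big_ord_recr/= cosD !prodE; ring.
rewrite mulrDl -!mulrA -c2 -s1 -meanD//; congr mean; apply/funext => w.
by rewrite big_ord_recr/= sinD !prodE; ring.
Qed.

Lemma char_fun_le (n : nat) (x : nat -> R) :
  mean P (fun w => cos (\sum_(j < n) x j * X j w)) <= expR (- (\sum_(j < n) ps (x j)) / 2).
Proof.
have [] := @mean_cs_prod n x n (leqnn n) (fun _ _ => 1).
- by move=> j; exact: measurable_cst.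
- by move=> j z; rewrite normr1.
under [in X in mean P X]eq_fun do rewrite big_geq//.
rewrite big_geq// mulr1 => c1 _.
rewrite (_ : (fun w => _) =
  (fun w => cos (\sum_(j < n) x j * X j w) * 1)); last first.
  by apply/funext => w; rewrite mulr1.
rewrite c1; apply: le_trans (ler_norm _) _.
apply: (@normr_le_sqr _ _ (cs_prod x n).2); first exact: expR_ge0.
apply: le_trans (cs_prod_norm _ _) _.
by rewrite -expRM_natl mulrC divfK.
Qed.

Lemma mean_indic (A : set T) : measurable A -> mean P (\1_A) = fine (P A).
Proof. by move=> mA; rewrite /mean /Rintegral integral_indic// setIT. Qed.

Lemma sum_cos_sin_sqr (I : finType) (Y : I -> R) :
  (\sum_i cos (Y i)) ^+ 2 + (\sum_i sin (Y i)) ^+ 2 = \sum_i \sum_j cos (Y i - Y j).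
Proof.
rewrite !expr2 !mulr_suml -big_split/=; apply: eq_bigr => i _.
rewrite !mulr_sumr -big_split/=; apply: eq_bigr => j _.
by rewrite cosB.
Qed.

(* Fejer-kernel version of Esseen's inequality: on the event the K1 K2 phases
   dl (a Y1 + b Y2) all lie in [-1/2, 1/2]. *)
Lemma esseen_grid (n : nat) (th dl eps : R) (K1 K2 : nat) : (0 < K1)%N -> (0 < K2)%N ->
  0 <= dl -> dl * K1%:R * eps <= 4^-1 -> dl * K2%:R * eps <= 4^-1 ->
  fine (P [set w | `|\sum_(j < n) cos (j%:R * th) * X j w| <= eps /\
                   `|\sum_(j < n) sin (j%:R * th) * X j w| <= eps]) <=
  4 / (K1%:R * K2%:R) ^+ 2 *
    \sum_(v : 'I_K1 * 'I_K2) \sum_(v' : 'I_K1 * 'I_K2)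
      expR (- (\sum_(j < n) ps (rotx (dl * (v.1%:R - v'.1%:R), dl * (v.2%:R - v'.2%:R))
         (j%:R * th))) / 2).
Proof.
move=> K10 K20 dl0 e1 e2.
pose Y1 w := \sum_(j < n) cos (j%:R * th) * X j w.
pose Y2 w := \sum_(j < n) sin (j%:R * th) * X j w.
set A := [set w | _].
have mY1 : measurable_fun setT Y1 by exact: (measurable_lin (fun j => cos (j%:R * th))).
have mY2 : measurable_fun setT Y2 by exact: (measurable_lin (fun j => sin (j%:R * th))).
have mabs (Y : T -> R) : measurable_fun setT Y -> measurable [set w | `|Y w| <= eps].
  move=> mY; rewrite (_ : [set w | _] = (Num.norm \o Y) @^-1` `]-oo, eps]%classic).
    by rewrite -[X in measurable X]setTI; apply: measurableT_comp.
  by apply/seteqP; split => w /=; rewrite in_itv.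
have mA : measurable A.
  rewrite (_ : A = [set w | `|Y1 w| <= eps] `&` [set w | `|Y2 w| <= eps])//.
  by apply: measurableI; exact: mabs.
have D0 : (0 : R) < K1%:R * K2%:R by rewrite mulr_gt0 ?ltr0n.
rewrite -mean_indic//.
pose ph (v : 'I_K1 * 'I_K2) w := dl * (v.1%:R * Y1 w + v.2%:R * Y2 w).
have phE v v' w : ph v w - ph v' w =
  \sum_(j < n) rotx (dl * (v.1%:R - v'.1%:R), dl * (v.2%:R - v'.2%:R)) (j%:R * th) * X j w.
  rewrite /ph /Y1 /Y2 /rotx/=.
  transitivity (dl * (v.1%:R - v'.1%:R) * (\sum_(j < n) cos (j%:R * th) * X j w) +
     dl * (v.2%:R - v'.2%:R) * (\sum_(j < n) sin (j%:R * th) * X j w)); first by ring.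
  rewrite !mulr_sumr -big_split/=; apply: eq_bigr => j _; ring.
have mcosd v v' : measurable_fun setT (fun w => cos (ph v w - ph v' w)).
  apply: (measurableT_comp (f := cos)).
    by apply: continuous_measurable_fun; exact: continuous_cos.
  under eq_fun do rewrite phE.
  exact: (measurable_lin (fun j => rotx _ (j%:R * th))).
have icosd v v' : intg P (fun w => cos (ph v w - ph v' w)).
  by apply: intg_bounded (mcosd v v') _ => w; exact: cos_max.
apply: (@le_trans _ _ (mean P (fun w => 4 / (K1%:R * K2%:R) ^+ 2 *
    \sum_v \sum_v' cos (ph v w - ph v' w)))).
  apply: mean_le.
  - apply: (@intg_bounded _ _ _ _ _ 1); first exact: measurable_indic.
    by move=> w; rewrite indicE ger0_norm ?ler0n// -[leRHS]/(1%:R) ler_nat leq_b1.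
  - by apply: intgZ; apply: intg_sum => v; apply: intg_sum.
  move=> w; rewrite -sum_cos_sin_sqr indicE.
  have C0 : 0 < 4 / (K1%:R * K2%:R) ^+ 2 :> R by rewrite divr_gt0// exprn_gt0.
  have [wA|wA] := boolP (w \in A); last first.
    by rewrite mulr_ge0 ?(ltW C0)// addr_ge0 ?sqr_ge0.
  move: wA; rewrite inE => -[/= w1 w2].
  (* Phases of modulus at most 1/2 have cosine at least 7/8. The cosines then sum to at least K1 K2
     / 2, and squaring explains the prefactor 4 / (K1 K2)^2. *)
  have cosph v : 2^-1 <= cos (ph v w).
    have : `|ph v w| <= 2^-1.
      have h (K : nat) (a : 'I_K) (y : R) : dl * K%:R * eps <= 4^-1 -> `|y| <= eps ->
          `|dl * (a%:R * y)| <= 4^-1.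
        move=> Ke ye; rewrite !normrM ger0_norm// ger0_norm ?ler0n//.
        apply: le_trans Ke; rewrite -mulrA ler_wpM2l// ler_pM ?ler0n//.
        by rewrite ler_nat ltnW.
      rewrite /ph mulrDr (le_trans (ler_normD _ _))//.
      have := h _ v.1 _ e1 w1; have := h _ v.2 _ e2 w2; rewrite /Y1 /Y2; lra.
    move=> /norm_sqr_le; have := cos_ge_quad (ph v w); lra.
  have hs : K1%:R * K2%:R / 2 <= \sum_v cos (ph v w).
    apply: (@le_trans _ _ (\sum_(v : 'I_K1 * 'I_K2) 2^-1)); last exact: ler_sum.
    by rewrite sumr_const card_prod !card_ord -[leRHS]mulr_natl natrM.
  have hs2 : (K1%:R * K2%:R / 2) ^+ 2 <= (\sum_v cos (ph v w)) ^+ 2.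
    by rewrite lerXn2r ?nnegrE ?(le_trans _ hs)// divr_ge0// ltW.
  have -> : true%:R = 4 / (K1%:R * K2%:R) ^+ 2 * (K1%:R * K2%:R / 2) ^+ 2 :> R.
    transitivity (1 : R) => //; field.
    by rewrite !pnatr_eq0 -!lt0n K10 K20.
  by rewrite ler_wpM2l ?(ltW C0)// (le_trans hs2)// lerDl sqr_ge0.
rewrite meanZ; last by apply: intg_sum => v; apply: intg_sum.
rewrite ler_wpM2l ?divr_ge0 ?exprn_ge0 ?(ltW D0)//.
rewrite mean_sum; last by move=> v; apply: intg_sum.
apply: ler_sum => v _; rewrite mean_sum//; apply: ler_sum => v' _.
apply: le_trans (char_fun_le n (fun j => rotx _ (j%:R * th))).
rewrite le_eqVlt; apply/orP; left; apply/eqP; congr mean; apply/funext => w.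
by rewrite phE.
Qed.

End SmallBall.

Section GridReindexing.
Context {R : realType}.

(** A difference is attained by at most [K] pairs: for fixed b, the shifted differences a - b + K
    are distinct indices below 2 K. *)
Lemma sum_diff_le (g : R -> R) (K : nat) : (forall x, 0 <= g x) ->
  \sum_(a < K) \sum_(b < K) g (a%:R - b%:R) <= K%:R * \sum_(p < 2 * K) g (p%:R - K%:R).
Proof.
move=> g0; rewrite exchange_big/=.
apply: (@le_trans _ _ (\sum_(b < K) \sum_(p < 2 * K) g (p%:R - K%:R))); last first.
  by rewrite sumr_const card_ord mulr_natl.
apply: ler_sum => b _.
rewrite -(big_mkord xpredT (fun a => g (a%:R - b%:R))).
rewrite -(big_mkord xpredT (fun p => g (p%:R - K%:R))).
apply: le_trans (@sum_shift_le _ (fun p => g (p%:R - K%:R)) K (2 * K) (K - b) _ _).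
- apply: ler_sum => a _; rewrite natrD natrB ?(ltnW (ltn_ord b))//.
  by have -> : a%:R + (K%:R - b%:R) - K%:R = a%:R - b%:R :> R by ring.
- by move=> p; exact: g0.
- by rewrite mul2n -addnn leq_add2l leq_subr.
Qed.

Lemma sum_diff2_le (F : R -> R -> R) (K : nat) : (forall x y, 0 <= F x y) ->
  \sum_(v : 'I_K * 'I_K) \sum_(v' : 'I_K * 'I_K) F (v.1%:R - v'.1%:R) (v.2%:R - v'.2%:R) <=
  K%:R ^+ 2 * \sum_(w : 'I_(2 * K) * 'I_(2 * K)) F (w.1%:R - K%:R) (w.2%:R - K%:R).
Proof.
move=> F0.
have -> : \sum_(v : 'I_K * 'I_K) \sum_(v' : 'I_K * 'I_K)
    F (v.1%:R - v'.1%:R) (v.2%:R - v'.2%:R) =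
   \sum_(a < K) \sum_(a' < K) \sum_(b < K) \sum_(b' < K) F (a%:R - a'%:R) (b%:R - b'%:R).
  rewrite -(pair_bigA _ (fun a b : 'I_K => \sum_(v' : 'I_K * 'I_K)
    F (a%:R - v'.1%:R) (b%:R - v'.2%:R)))/=.
  apply: eq_bigr => a _; rewrite exchange_big/=.
  rewrite -(pair_bigA _ (fun a' b' : 'I_K => \sum_(b < K)
     F (a%:R - a'%:R) (b%:R - b'%:R)))/=.
  by apply: eq_bigr => a' _; rewrite exchange_big.
apply: le_trans (@sum_diff_le (fun x => \sum_(b < K) \sum_(b' < K) F x (b%:R - b'%:R)) K _) _.
  by move=> x; apply: sumr_ge0 => b _; apply: sumr_ge0.
rewrite expr2 -mulrA ler_wpM2l ?ler0n//.
rewrite -(pair_bigA _ (fun p q : 'I_(2 * K) => F (p%:R - K%:R) (q%:R - K%:R)))/=.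
by rewrite mulr_sumr; apply: ler_sum => p _; exact: sum_diff_le.
Qed.

End GridReindexing.

Section SmallBallCorollaries.
Context d (T : measurableType d) (R : realType) (P : probability T R).
Variable X : nat -> T -> R.
Hypothesis mX : forall j, measurable_fun setT (X j).
Hypothesis indX : forall (n : nat) (B : nat -> set R), (forall i, measurable (B i)) ->
  mean P (fun w => \prod_(j < n) \1_(B j) (X j w)) =
  \prod_(j < n) mean P (fun w => \1_(B j) (X j w)).
Variable ps : R -> R.
Hypothesis psE : forall j x, psi P (X j) x = ps x.

Definition small_value (n : nat) (th eps : R) : set T :=
  [set w | `|\sum_(j < n) cos (j%:R * th) * X j w| <= eps /\
           `|\sum_(j < n) sin (j%:R * th) * X j w| <= eps].

Lemma small_ball_2d (n : nat) (th dl eps : R) (K : nat) : (0 < K)%N ->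
  0 <= dl -> dl * K%:R * eps <= 4^-1 ->
  fine (P (small_value n th eps)) <=
  4 / K%:R ^+ 2 * \sum_(w : 'I_(2 * K) * 'I_(2 * K)) grid_weight ps n th dl w.
Proof.
move=> K0 dl0 e1.
apply: le_trans (esseen_grid mX indX psE n th K0 K0 dl0 e1 e1) _.
have := @sum_diff2_le R (fun x y => expR (- (\sum_(j < n)
   ps (rotx (dl * x, dl * y) (j%:R * th))) / 2)) K (fun _ _ => expR_ge0 _).
have K0' : (0 : R) < K%:R ^+ 2 by rewrite exprn_gt0 ?ltr0n.
set S := \sum_(w : 'I_(2 * K) * 'I_(2 * K)) _ => h.
have -> : \sum_(w : 'I_(2 * K) * 'I_(2 * K)) grid_weight ps n th dl w = S.
  rewrite /S; apply: eq_bigr => w _; rewrite /grid_weight; congr (expR (- _ / 2)).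
  by apply: eq_bigr => j _; rewrite /grid_vec -!mulrBr.
have -> : 4 / K%:R ^+ 2 * S = 4 / (K%:R * K%:R) ^+ 2 * (K%:R ^+ 2 * S).
  by field; rewrite pnatr_eq0 -lt0n.
by rewrite ler_wpM2l// divr_ge0// exprn_ge0// mulr_ge0.
Qed.

(** Meant for the angles 0 and pi, where the sum is real: a grid of width 1 in the second direction
    suffices, and the bound has order 1/K instead of 1/K^2. *)
Lemma small_ball_1d (n : nat) (th dl eps c c0 : R) (K : nat) : (0 < K)%N -> (0 < n)%N ->
  0 < dl -> dl * K%:R * eps <= 4^-1 -> dl * K%:R <= c0 -> 0 < c ->
  (forall j : nat, cos (j%:R * th) ^+ 2 = 1) ->
  (forall x, `|x| <= c0 -> c * x ^+ 2 <= ps x) ->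
  fine (P (small_value n th eps)) <=
  4 / K%:R * (2 + 2 / (c * n%:R * dl ^+ 2 / 2)).
Proof.
move=> K0 n0 dl0 e1 Kc0 c_gt0 cos1 psq.
have K1 : (1 : R) <= K%:R by rewrite ler1n.
have e2 : dl * 1%:R * eps <= 4^-1.
  have [eps0|/ltW eps0] := leP 0 eps.
    by apply: le_trans e1; rewrite ler_wpM2r// ler_pM2l.
  by rewrite (le_trans (mulr_ge0_le0 _ eps0))// mulr1 ltW.
apply: le_trans (esseen_grid mX indX psE n th K0 (ltnSn 0) (ltW dl0) e1 e2) _.
rewrite mulr1.
pose G x := expR (- (\sum_(j < n) ps (rotx (dl * x, 0) (j%:R * th))) / 2).
have -> : \sum_(v : 'I_K * 'I_1) \sum_(v' : 'I_K * 'I_1)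
   expR (- (\sum_(j < n) ps (rotx (dl * (v.1%:R - v'.1%:R),
      dl * (v.2%:R - v'.2%:R)) (j%:R * th))) / 2) =
   \sum_(a < K) \sum_(b < K) G (a%:R - b%:R).
  rewrite -(pair_bigA _ (fun (a : 'I_K) (b : 'I_1) => \sum_(v' : 'I_K * 'I_1)
    expR (- (\sum_(j < n) ps (rotx (dl * (a%:R - v'.1%:R),
      dl * (b%:R - v'.2%:R)) (j%:R * th))) / 2)))/=.
  apply: eq_bigr => a _; rewrite big_ord1.
  rewrite -(pair_bigA _ (fun (a' : 'I_K) (b : 'I_1) =>
    expR (- (\sum_(j < n) ps (rotx (dl * (a%:R - a'%:R),
      dl * (0%:R - b%:R)) (j%:R * th))) / 2)))/=.
  by apply: eq_bigr => b _; rewrite big_ord1 subrr mulr0.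
have K0' : (0 : R) < K%:R by rewrite ltr0n.
have h := @sum_diff_le R G K (fun _ => expR_ge0 _).
have a0 : 0 < c * n%:R * dl ^+ 2 / 2 by rewrite !mulr_gt0 ?ltr0n ?exprn_gt0// invr_gt0.
have hG : \sum_(p < 2 * K) G (p%:R - K%:R) <= 2 + 2 / (c * n%:R * dl ^+ 2 / 2).
  apply: le_trans (gauss_sum_le K a0); apply: ler_sum => p _.
  rewrite /G ler_expR mulNr mulNr lerN2.
  have pK : `|p%:R - K%:R| <= K%:R :> R.
    have := ltn_ord p; rewrite -(ltr_nat R) natrM ler_norml => pK.
    by have := ler0n R p; move=> p0; apply/andP; split; lra.
  have : \sum_(j < n) c * (dl * (p%:R - K%:R)) ^+ 2 <=
      \sum_(j < n) ps (rotx (dl * (p%:R - K%:R), 0) (j%:R * th)).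
    apply: ler_sum => j _; rewrite /rotx/= mul0r addr0.
    have -> : (dl * (p%:R - K%:R)) ^+ 2 = (dl * (p%:R - K%:R) * cos (j%:R * th)) ^+ 2.
      by rewrite [RHS]exprMn cos1 mulr1.
    apply: psq; rewrite (le_trans (norm_mul_cos _ _))// normrM (gtr0_norm dl0).
    by rewrite (le_trans _ Kc0)// ler_pM2l.
  rewrite sumr_const card_ord -[X in X <= _ -> _]mulr_natl exprMn.
  move: (\sum_(j < n) _) => S hS.
  have -> : c * n%:R * dl ^+ 2 / 2 * (p%:R - K%:R) ^+ 2 =
     n%:R * (c * (dl ^+ 2 * (p%:R - K%:R) ^+ 2)) / 2 by ring.
  by rewrite ler_pM2r ?invr_gt0.
have -> : 4 / K%:R * (2 + 2 / (c * n%:R * dl ^+ 2 / 2)) =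
   4 / K%:R ^+ 2 * (K%:R * (2 + 2 / (c * n%:R * dl ^+ 2 / 2))).
  move: (2 + _) => z; field; by rewrite pnatr_eq0 -lt0n.
rewrite ler_wpM2l ?divr_ge0 ?exprn_ge0 ?(ltW K0')//.
by rewrite (le_trans h)// ler_pM2l.
Qed.

End SmallBallCorollaries.

(** * Moment generating functions and deviations *)

Section MomentGeneratingFunction.
Context d (T : measurableType d) (R : realType) (P : probability T R).

Lemma cube_le_expR (y : R) : 0 <= y -> y ^+ 3 <= 27 * expR y.
Proof.
move=> y0; have h : y / 3 <= expR (y / 3) by apply: le_trans (expR_ge1Dx _); lra.
have h3 : (y / 3) ^+ 3 <= expR (y / 3) ^+ 3.
  by rewrite lerXn2r ?nnegrE ?divr_ge0 ?expR_ge0.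
have -> : y ^+ 3 = 27 * (y / 3) ^+ 3 by field.
apply: ler_wpM2l; first by rewrite ler0n.
by apply: le_trans h3 _; rewrite -expRM_natl mulrC divfK.
Qed.

Lemma quartic_le_expR (y : R) : 0 <= y -> y ^+ 4 <= 4 ^+ 4 * expR y.
Proof.
move=> y0; have h : y / 4 <= expR (y / 4) by apply: le_trans (expR_ge1Dx _); lra.
have h3 : (y / 4) ^+ 4 <= expR (y / 4) ^+ 4.
  by rewrite lerXn2r ?nnegrE ?divr_ge0 ?expR_ge0.
have -> : y ^+ 4 = 4 ^+ 4 * (y / 4) ^+ 4 by field.
apply: ler_wpM2l; first by rewrite exprn_ge0.
by apply: le_trans h3 _; rewrite -expRM_natl mulrC divfK.
Qed.

Lemma expR_norm_le (y : R) : expR `|y| <= expR y + expR (- y).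
Proof.
have [y0|y0] := ger0P y; first by rewrite lerDl expR_ge0.
by rewrite lerDr expR_ge0.
Qed.

Variable X : T -> R.
Hypothesis mX : measurable_fun setT X.
Variable delta : R.
Hypothesis delta_gt0 : 0 < delta.
Hypothesis iexp : forall s, `|s| <= delta -> intg P (fun w => expR (s * X w)).

Lemma intg_exp_norm : intg P (fun w => expR (delta * `|X w|)).
Proof.
apply: (@intg_le _ _ _ _ _ (fun w => expR (delta * X w) + expR (- delta * X w))).
- apply: (measurableT_comp (f := expR)) => //; apply: measurable_funM => //.
  exact: measurableT_comp.
- move=> w; rewrite ger0_norm ?expR_ge0//.
  by have := expR_norm_le (delta * X w); rewrite normrM (gtr0_norm delta_gt0) mulNr.
- by apply: intgD; apply: iexp; rewrite ?normrN gtr0_norm.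
Qed.

Lemma intg_pow4 : intg P (fun w => X w ^+ 4).
Proof.
apply: (@intg_le _ _ _ _ _ (fun w => (4 ^+ 4 / delta ^+ 4) * expR (delta * `|X w|))).
- exact: measurable_funX.
- move=> w; rewrite normrX.
  have := @quartic_le_expR (delta * `|X w|); rewrite mulr_ge0 ?(ltW delta_gt0)// => /(_ isT).
  have d4 : 0 < delta ^+ 4 by rewrite exprn_gt0.
  by rewrite exprMn [in X in _ -> X]mulrAC ler_pdivlMr// [X in _ -> X <= _]mulrC.
- by apply: intgZ; exact: intg_exp_norm.
Qed.

Lemma intg_pow2 : intg P (fun w => X w ^+ 2).
Proof.
apply: (@intg_le _ _ _ _ _ (fun w => 1 + X w ^+ 4)).
- exact: measurable_funX.
- move=> w; rewrite ger0_norm ?sqr_ge0// (exprM _ 2 2); have := sqr_ge0 (X w).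
  by move: (X w ^+ 2) => z z0; nra.
- by apply: intgD; [exact: intg_cst|exact: intg_pow4].
Qed.

Lemma intg_pow1 : intg P X.
Proof.
apply: (@intg_le _ _ _ _ _ (fun w => 1 + X w ^+ 2)) => //.
- move=> w; have := sqr_ge0 (`|X w| - 1); rewrite -[X w ^+ 2]real_normK ?num_real//; nra.
- by apply: intgD; [exact: intg_cst|exact: intg_pow2].
Qed.

Lemma intg_norm : intg P (fun w => `|X w|).
Proof.
apply: (@intg_le _ _ _ _ _ (fun w => 1 + X w ^+ 2)) => //.
- exact: measurableT_comp.
- move=> w; rewrite normr_id.
  have := sqr_ge0 (`|X w| - 1); rewrite -[X w ^+ 2]real_normK ?num_real//; nra.
- by apply: intgD; [exact: intg_cst|exact: intg_pow2].
Qed.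

Variable w2 : R.
Hypotheses (EX1 : mean P X = 0) (EX2 : mean P (fun w => X w ^+ 2) = w2).

(** Half of the exponent delta absorbs the factor |X|^3 of the Taylor remainder, the other half its
    exponential factor. *)
Lemma mgf_third_order : exists C, forall s, `|s| <= delta / 2 ->
  `|mean P (fun w => expR (s * X w)) - 1 - w2 * s ^+ 2 / 2| <= C * `|s| ^+ 3.
Proof.
pose D := mean P (fun w => expR (delta * `|X w|)).
exists (27 / (delta / 2) ^+ 3 * D) => s sd.
have d20 : 0 < delta / 2 by rewrite divr_gt0.
have d3 : 0 < (delta / 2) ^+ 3 by rewrite exprn_gt0.
have sd1 : `|s| <= delta by apply: le_trans sd _; move: delta_gt0; lra.
have i1 := iexp sd1.
have iX := intg_pow1; have iX2 := intg_pow2.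
have -> : mean P (fun w => expR (s * X w)) - 1 - w2 * s ^+ 2 / 2 =
   mean P (fun w => expR (s * X w) - (1 + s * X w + (s ^+ 2 / 2) * X w ^+ 2)).
  rewrite meanB//; last by do ?[apply: intgD|apply: intgZ|exact: intg_cst].
  rewrite meanD; [|by apply: intgD; [exact: intg_cst|exact: intgZ]|exact: intgZ].
  rewrite meanD; [|exact: intg_cst|exact: intgZ].
  by rewrite !meanZ// mean_cst EX1 EX2; ring.
have i2 : intg P (fun w => expR (s * X w) - (1 + s * X w + (s ^+ 2 / 2) * X w ^+ 2)).
  apply: intgB => //; apply: intgD; last exact: intgZ.
  by apply: intgD; [exact: intg_cst|exact: intgZ].
have i3 : intg P (fun w => (27 / (delta / 2) ^+ 3 * `|s| ^+ 3) * expR (delta * `|X w|)).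
  by apply: intgZ; exact: intg_exp_norm.
have pw w : `|expR (s * X w) - (1 + s * X w + (s ^+ 2 / 2) * X w ^+ 2)| <=
    (27 / (delta / 2) ^+ 3 * `|s| ^+ 3) * expR (delta * `|X w|).
  have := expR_third_order (s * X w).
  have -> : expR (s * X w) - 1 - s * X w - (s * X w) ^+ 2 / 2 =
    expR (s * X w) - (1 + s * X w + (s ^+ 2 / 2) * X w ^+ 2) by rewrite exprMn; ring.
  move=> h; apply: le_trans h _; rewrite normrM exprMn.
  have h1 : `|X w| ^+ 3 <= 27 / (delta / 2) ^+ 3 * expR (delta / 2 * `|X w|).
    have := @cube_le_expR (delta / 2 * `|X w|); rewrite mulr_ge0 ?(ltW d20)// => /(_ isT).
    by rewrite exprMn [in X in _ -> X]mulrAC ler_pdivlMr// [X in _ -> X <= _]mulrC.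
  have h2 : expR (`|s| * `|X w|) <= expR (delta / 2 * `|X w|).
    by rewrite ler_expR ler_wpM2r.
  have -> : delta * `|X w| = delta / 2 * `|X w| + delta / 2 * `|X w| by field.
  rewrite expRD; set E := expR _ in h1 h2 *.
  have -> : 27 / (delta / 2) ^+ 3 * `|s| ^+ 3 * (E * E) =
     `|s| ^+ 3 * ((27 / (delta / 2) ^+ 3 * E) * E) by ring.
  by rewrite -[leLHS]mulrA ler_wpM2l ?exprn_ge0// ler_pM ?expR_ge0 ?exprn_ge0.
have -> : 27 / (delta / 2) ^+ 3 * D * `|s| ^+ 3 =
    mean P (fun w => (27 / (delta / 2) ^+ 3 * `|s| ^+ 3) * expR (delta * `|X w|)).
  by rewrite meanZ; [rewrite /D; ring|exact: intg_exp_norm].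
rewrite ler_norml; apply/andP; split; last first.
  by apply: mean_le => // w; exact: le_trans (ler_norm _) (pw w).
rewrite -mulN1r -meanZ//; apply: mean_le => //; first exact: intgZ.
by move=> w; rewrite mulN1r; have := pw w; rewrite ler_norml => /andP[].
Qed.

End MomentGeneratingFunction.

Section SecondOrderCoefficient.
Context {R : realType}.

Definition second_order_at0 (m : R -> R) (v : R) : Prop :=
  exists C s0, 0 < s0 /\ forall s, `|s| <= s0 -> `|m s - 1 - v * s ^+ 2 / 2| <= C * `|s| ^+ 3.

(** Used in both directions, it recovers the variance from the moment generating function; this
    allows the constant to be fixed before the law is given. *)
Lemma second_order_unique m v v' :
  second_order_at0 m v -> second_order_at0 m v' -> v <= v'.
Proof.
move=> [C [s0 [s00 H]]] [C' [s0' [s00' H']]].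
rewrite leNgt; apply/negP => vv'.
have C0 := normr_ge0 C; have C0' := normr_ge0 C'.
pose D := `|C| + `|C'| + 1.
have D0 : 0 < D by rewrite ltr_wpDl// addr_ge0.
pose s := Num.min (Num.min s0 s0') ((v - v') / (4 * D)).
have s_gt0 : 0 < s by rewrite !lt_min s00 s00'/= divr_gt0 ?mulr_gt0// subr_gt0.
have [ss0 ss0' sv] : [/\ s <= s0, s <= s0' & s <= (v - v') / (4 * D)].
  by rewrite /s; split; rewrite !ge_min lexx ?orbT.
have := H s; have := H' s; rewrite (gtr0_norm s_gt0) => /(_ ss0') h' /(_ ss0) h.
have sD : s * (4 * D) <= v - v' by rewrite -ler_pdivlMr ?mulr_gt0.
have s2 : 0 < s ^+ 2 by rewrite exprn_gt0.
have E : (v - v') / 2 * s ^+ 2 <= (C + C') * s ^+ 3.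
  move: h h'; rewrite !ler_norml => /andP[h1 h2] /andP[h3 h4]; lra.
have E1 : (v - v') / 2 <= (C + C') * s.
  rewrite -(ler_pM2r s2).
  by have -> : (C + C') * s * s ^+ 2 = (C + C') * s ^+ 3 by ring.
have E2 : (C + C') * s <= D * s.
  by rewrite ler_wpM2r ?(ltW s_gt0)// /D; have := ler_norm C; have := ler_norm C'; lra.
have : 0 < D * s by rewrite mulr_gt0.
have sD' : 4 * (D * s) <= v - v' by rewrite mulrA mulrC.
move: (D * s) ((C + C') * s) E1 E2 sD' => Ds x; clear; lra.
Qed.

(** Doubling the coefficient v / 2 leaves room for the cubic error near 0; the rate then depends on
    the variance alone. *)
Lemma second_order_subgauss m v : 0 < v -> second_order_at0 m v ->
  exists2 s1, 0 < s1 & forall s, `|s| <= s1 -> m s <= expR (v * s ^+ 2).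
Proof.
move=> v0 [C [s0 [s00 H]]].
have C1 : 0 < `|C| + 1 by rewrite ltr_wpDl.
exists (Num.min s0 (v / (2 * (`|C| + 1)))).
  by rewrite lt_min s00 divr_gt0// mulr_gt0.
move=> s; rewrite le_min => /andP[ss0 sv].
apply: le_trans (expR_ge1Dx _).
have := H s ss0; rewrite ler_norml => /andP[_ h].
have E : C * `|s| ^+ 3 <= v / 2 * s ^+ 2.
  rewrite -[s ^+ 2]real_normK ?num_real// exprS mulrA ler_wpM2r ?exprn_ge0//.
  apply: (@le_trans _ _ ((`|C| + 1) * `|s|)).
    by rewrite ler_wpM2r// (le_trans (ler_norm _))// lerDl.
  move: sv; rewrite ler_pdivlMr ?mulr_gt0//; lra.
lra.
Qed.

End SecondOrderCoefficient.

(** * Deviation bounds for weighted sums *)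

Section Deviation.
Context d (T : measurableType d) (R : realType) (P : probability T R).
Variable X : nat -> T -> R.
Hypothesis mX : forall j, measurable_fun setT (X j).
Hypothesis indX : forall (n : nat) (B : nat -> set R), (forall i, measurable (B i)) ->
  mean P (fun w => \prod_(j < n) \1_(B j) (X j w)) =
  \prod_(j < n) mean P (fun w => \1_(B j) (X j w)).
Variables (v s1 : R).
Hypothesis iexp : forall j s, `|s| <= s1 -> intg P (fun w => expR (s * X j w)).
Hypothesis subgauss : forall j s, `|s| <= s1 ->
  mean P (fun w => expR (s * X j w)) <= expR (v * s ^+ 2).
Hypothesis v_ge0 : 0 <= v.

Lemma measurable_sum_abs n : measurable_fun setT (fun w => \sum_(j < n) `|X j w|).
Proof. by apply: measurable_sum => j; exact: measurableT_comp. Qed.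

Lemma measurable_set_le (Y : T -> R) (a : R) : measurable_fun setT Y ->
  measurable [set w | Y w <= a].
Proof.
move=> mY; rewrite (_ : [set w | _] = Y @^-1` `]-oo, a]%classic).
  by rewrite -[X in measurable X]setTI; apply: mY.
by apply/seteqP; split => w /=; rewrite in_itv.
Qed.

Lemma measurable_set_ge (Y : T -> R) (a : R) : measurable_fun setT Y ->
  measurable [set w | a <= Y w].
Proof.
move=> mY; rewrite (_ : [set w | _] = Y @^-1` `[a, +oo[%classic).
  by rewrite -[X in measurable X]setTI; apply: mY.
by apply/seteqP; split => w /=; rewrite in_itv/= andbT.
Qed.

(* Chernoff's bound; the exponentials are truncated because independence is
   only available for bounded functions. *)
Lemma chernoff_truncated (n : nat) (b : nat -> R) (B s lam Q : R) :
  (forall j, `|b j| <= B) -> 0 < s -> s * B <= s1 ->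
  fine (P [set w | \sum_(j < n) `|X j w| <= Q /\ lam <= \sum_(j < n) b j * X j w]) <=
  expR (- (s * lam) + n%:R * (v * (s * B) ^+ 2)).
Proof.
move=> bB s0 sB.
have B0 : 0 <= B by exact: le_trans (normr_ge0 _) (bB 0%N).
have [Q0|Q0] := ltP Q 0.
  rewrite (_ : [set w | _] = set0) ?measure0 ?expR_ge0//.
  apply/seteqP; split => w //= -[h _].
  have : 0 <= \sum_(j < n) `|X j w| by apply: sumr_ge0.
  by rewrite leNgt (le_lt_trans h).
(* On the event every |X_j| is at most [Q], so no exponential exceeds [M] there and the truncation
   changes nothing. *)
pose M := (Num.truncn (expR (s * B * Q))).+1.
have MQ : expR (s * B * Q) <= M%:R.
  by rewrite ltW//; have /andP[] := truncn_itv (expR_ge0 (s * B * Q)).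
pose f j z : R := Num.min (expR (s * b j * z)) M%:R.
have f0 j z : 0 <= f j z by rewrite le_min expR_ge0 ler0n.
have mf j : measurable_fun setT (f j).
  apply: measurable_minr; last exact: measurable_cst.
  by apply: (measurableT_comp (f := expR)) => //; exact: measurable_funM.
have fM j z : `|f j z| <= M%:R by rewrite ger0_norm// ge_min lexx orbT.
set A := [set w | _].
have mA : measurable A.
  rewrite (_ : A = [set w | \sum_(j < n) `|X j w| <= Q] `&`
    [set w | lam <= \sum_(j < n) b j * X j w])//.
  apply: measurableI; first exact: measurable_set_le (measurable_sum_abs n).
  exact: measurable_set_ge (measurable_lin mX b n).
rewrite -mean_indic//.
have mprod : measurable_fun setT (fun w => \prod_(j < n) f j (X j w)).
  by apply: measurable_prod => j _; exact: measurable_comp_RV.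
have iprod : intg P (fun w => \prod_(j < n) f j (X j w)).
  apply: intg_bounded mprod _ => w.
  by apply: (@norm_prod_le _ n (fun j => f j (X j w)) M%:R).
apply: (@le_trans _ _ (mean P (fun w => expR (- (s * lam)) * \prod_(j < n) f j (X j w)))).
  apply: mean_le; last 1 first.
  - move=> w; rewrite indicE.
    have p0 : 0 <= \prod_(j < n) f j (X j w) by apply: prodr_ge0.
    have [|wA] := boolP (w \in A); last by rewrite mulr_ge0 ?expR_ge0.
    rewrite inE => -[/= w1 w2].
    have -> : \prod_(j < n) f j (X j w) = expR (s * \sum_(j < n) b j * X j w).
      rewrite mulr_sumr expR_sum; apply: eq_bigr => j _; rewrite /f mulrA.
      apply/min_idPl; apply: le_trans MQ; rewrite ler_expR.
      apply: le_trans (ler_norm _) _; rewrite !normrM (gtr0_norm s0).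
      have Xj : `|X j w| <= Q.
        apply: le_trans w1; rewrite (bigD1 j)//= lerDl.
        by apply: sumr_ge0.
      by rewrite ler_pM ?mulr_ge0 ?(ltW s0)// ler_wpM2l ?(ltW s0).
    rewrite -expRD -[leLHS]/(1%:R) -[leLHS]expR0 ler_expR addrC subr_ge0.
    by rewrite ler_wpM2l// ltW.
  - apply: (@intg_bounded _ _ _ _ _ 1); first exact: measurable_indic.
    by move=> w; rewrite indicE ger0_norm ?ler0n// -[leRHS]/(1%:R) ler_nat leq_b1.
  - exact: intgZ.
rewrite meanZ// (@mean_prod _ _ _ P X mX indX n f M)// expRD ler_wpM2l ?expR_ge0//.
rewrite expRM_natl -[n in leRHS]card_ord -prodr_const.
apply: ler_prod => j _; rewrite mean_ge0//=.
have sb : `|s * b j| <= s1.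
  by rewrite normrM (gtr0_norm s0) (le_trans _ sB)// ler_pM2l.
apply: (@le_trans _ _ (mean P (fun w => expR (s * b j * X j w)))).
  apply: mean_le; [|exact: iexp|by move=> w; rewrite ge_min lexx].
  by apply: (@intg_bounded _ _ _ _ _ M%:R) => //; exact: measurable_comp_RV.
apply: le_trans (subgauss j sb) _; rewrite ler_expR ler_wpM2l//.
rewrite -(real_normK (num_real (s * b j))) lerXn2r ?nnegrE ?mulr_ge0 ?(ltW s0)//.
by rewrite normrM (gtr0_norm s0) ler_pM2l.
Qed.

Lemma markov_sum_abs (n : nat) (m1 Q : R) : 0 < Q ->
  (forall j, intg P (fun w => `|X j w|)) -> (forall j, mean P (fun w => `|X j w|) <= m1) ->
  fine (P [set w | Q < \sum_(j < n) `|X j w|]) <= n%:R * m1 / Q.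
Proof.
move=> Q0 iX Xm.
have mA : measurable [set w | Q < \sum_(j < n) `|X j w|].
  rewrite (_ : [set w | _] = ~` [set w | \sum_(j < n) `|X j w| <= Q]).
    by apply: measurableC; exact: measurable_set_le (measurable_sum_abs n).
  by apply/seteqP; split => w /=; rewrite ltNge => /negP.
rewrite -mean_indic//.
apply: (@le_trans _ _ (mean P (fun w => Q^-1 * \sum_(j < n) `|X j w|))).
  apply: mean_le.
  - apply: (@intg_bounded _ _ _ _ _ 1); first exact: measurable_indic.
    by move=> w; rewrite indicE ger0_norm ?ler0n// -[leRHS]/(1%:R) ler_nat leq_b1.
  - by apply: intgZ; apply: intg_sum.
  move=> w; rewrite indicE; have S0 : 0 <= \sum_(j < n) `|X j w| by apply: sumr_ge0.
  have [|_] := boolP (w \in _); last by rewrite mulr_ge0// invr_ge0 ltW.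
  by rewrite inE /= => /ltW wQ; rewrite mulrC -[leLHS]/(1%:R) ler_pdivlMr// mul1r.
rewrite meanZ; last exact: intg_sum.
rewrite mulrC ler_pM2r ?invr_gt0// mean_sum//.
apply: (@le_trans _ _ (\sum_(j < n) m1)); first by apply: ler_sum.
by rewrite sumr_const card_ord mulr_natl.
Qed.

End Deviation.

(** * Polynomials near the unit circle *)

Section ComplexModulus.
Context {R : realType}.
Local Open Scope complex_scope.
Implicit Types z w : R[i].

Lemma cmodE (a b : R) : cmod (a +i* b) = Num.sqrt (a ^+ 2 + b ^+ 2).
Proof. by []. Qed.

Lemma cmodM z w : cmod (z * w) = cmod z * cmod w.
Proof. exact: Normc.normcM. Qed.

Lemma cmod_ge0 z : 0 <= cmod z.
Proof. by case: z => a b; rewrite cmodE sqrtr_ge0. Qed.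

Lemma cmodD z w : cmod (z + w) <= cmod z + cmod w.
Proof.
have := ler_normD z w.
by rewrite -lecR rmorphD.
Qed.

Lemma cmod_sum (I : Type) (s : seq I) (F : I -> R[i]) :
  cmod (\sum_(i <- s) F i) <= \sum_(i <- s) cmod (F i).
Proof.
elim: s => [|i s IH]; first by rewrite !big_nil /cmod Normc.normc0.
by rewrite !big_cons (le_trans (cmodD _ _))// lerD2l.
Qed.

Lemma cmodN z : cmod (- z) = cmod z.
Proof. by case: z => a b; rewrite /cmod/= !sqrrN. Qed.

Lemma cmodB z w : cmod (z - w) <= cmod z + cmod w.
Proof. by rewrite -(cmodN w); exact: cmodD. Qed.

Lemma cmodX z n : cmod (z ^+ n) = cmod z ^+ n.
Proof.
elim: n => [|n IH]; first by rewrite !expr0 /cmod Normc.normc1.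
by rewrite !exprS cmodM IH.
Qed.

Lemma cmod_real (a : R) : cmod a%:C = `|a|.
Proof. by rewrite /cmod/= expr0n/= addr0 sqrtr_sqr. Qed.

Lemma cmod_nat n : cmod (n%:R : R[i]) = n%:R.
Proof. by rewrite -(rmorph_nat (real_complex R)) cmod_real ger0_norm. Qed.

Definition cis (x : R) : R[i] := cos x +i* sin x.

Lemma cmod_cis x : cmod (cis x) = 1.
Proof. by rewrite cmodE cos2Dsin2 sqrtr1. Qed.

Lemma cisD x y : cis (x + y) = cis x * cis y.
Proof. by rewrite /cis cosD sinD; apply/eqP; rewrite eq_complex/= eqxx addrC mulrC eqxx. Qed.

Lemma cisX x n : cis x ^+ n = cis (n%:R * x).
Proof.
elim: n => [|n IH]; first by rewrite expr0 mul0r /cis cos0 sin0.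
by rewrite exprS IH -cisD -add1n natrD mulrDl mul1r.
Qed.

Lemma cmod_cis_sub1 x : cmod (cis x - 1) <= `|x|.
Proof.
rewrite /cis -[_ - 1]/((cos x - 1) +i* (sin x - 0)) cmodE subr0.
rewrite -[leRHS]sqrtr_sqr ler_wsqrtr//.
have -> : (cos x - 1) ^+ 2 + sin x ^+ 2 = (cos x ^+ 2 + sin x ^+ 2) + 1 - 2 * cos x by ring.
by rewrite cos2Dsin2; have := cos_ge_quad x; lra.
Qed.

(** Allowing the conjugate restricts the argument to [0, pi]; by [kac_conj] this loses nothing for
    real coefficients. *)
Lemma polar_form z : exists x, [/\ 0 <= x, x <= pi &
  z = (cmod z)%:C * cis x \/ z^*%C = (cmod z)%:C * cis x].
Proof.
case: z => a b.
set r := cmod _; have rE : r = Num.sqrt (a ^+ 2 + b ^+ 2) by [].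
have r0 : 0 <= r by exact: cmod_ge0.
have r2 : r ^+ 2 = a ^+ 2 + b ^+ 2 by rewrite rE sqr_sqrtr// addr_ge0 ?sqr_ge0.
have [rz|rz] := eqVneq r 0.
  exists 0; split; rewrite ?pi_ge0//; left.
  move/eqP: r2; rewrite rz expr0n/= eq_sym paddr_eq0 ?sqr_ge0// !sqrf_eq0 => /andP[/eqP-> /eqP->].
  by rewrite mul0r.
have r_gt0 : 0 < r by rewrite lt_neqAle eq_sym rz.
have ar : -1 <= a / r <= 1.
  by rewrite -ler_norml normrM normfV (gtr0_norm r_gt0) ler_pdivrMr// mul1r;
    apply: (@normr_le_sqr _ _ b) => //; rewrite r2.
exists (acos (a / r)); split; [exact: acos_ge0|exact: acos_lepi|].
have c1 : cos (acos (a / r)) = a / r by rewrite acosK// in_itv.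
have s1 : sin (acos (a / r)) = `|b| / r.
  rewrite sin_acos//; have -> : 1 - (a / r) ^+ 2 = (b / r) ^+ 2.
    by rewrite !exprMn exprVn -[1](divff (x := r ^+ 2)) ?expf_neq0// -mulrBl r2; congr (_ * _); ring.
  by rewrite sqrtr_sqr normrM normfV (gtr0_norm r_gt0).
rewrite /cis c1 s1.
have E : r%:C * (a / r +i* (`|b| / r)) = a +i* `|b|.
  by apply/eqP; rewrite eq_complex/= !mul0r subr0 addr0 !(mulrC r) !divfK ?eqxx.
rewrite E; have [b0|b0] := ger0P b; [left|right] => //.
Qed.

Lemma kac_conj (a : nat -> R) n z : kac_poly a n z^*%C = (kac_poly a n z)^*%C.
Proof.
rewrite /kac_poly rmorph_sum; apply: eq_bigr => j _.
rewrite rmorphM rmorphXn/=; congr (_ * _).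
by apply/eqP; rewrite eq_complex/= oppr0 !eqxx.
Qed.

Lemma cmod_conj z : cmod z^*%C = cmod z.
Proof. by case: z => u v; rewrite /cmod/= sqrrN. Qed.

Lemma kac_cis (a : nat -> R) n x : kac_poly a n (cis x) =
  (\sum_(j < n) cos (j%:R * x) * a j) +i* (\sum_(j < n) sin (j%:R * x) * a j).
Proof.
rewrite /kac_poly; elim/big_ind3 : _ => //= [? ? ? ? ? ? -> -> //|j _].
by rewrite cisX; apply/eqP; rewrite eq_complex/= !mul0r subr0 addr0 !(mulrC (a j)) !eqxx.
Qed.

Lemma cmod_le_parts (u v eps : R) : 0 <= eps -> cmod (u +i* v) <= eps -> `|u| <= eps /\ `|v| <= eps.
Proof.
move=> e0; rewrite cmodE => h.
have h2 : u ^+ 2 + v ^+ 2 <= eps ^+ 2.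
  by rewrite -[leLHS]sqr_sqrtr ?addr_ge0 ?sqr_ge0// lerXn2r ?nnegrE ?sqrtr_ge0.
by split; [exact: (@normr_le_sqr _ _ v)|apply: (@normr_le_sqr _ _ u); rewrite // addrC].
Qed.

Lemma cmod_ge_parts (u v : R) : cmod (u +i* v) <= `|u| + `|v|.
Proof.
rewrite cmodE -[leRHS]ger0_norm ?addr_ge0// -sqrtr_sqr ler_wsqrtr//.
have := mulr_ge0 (normr_ge0 u) (normr_ge0 v).
rewrite -[u ^+ 2]real_normK ?num_real// -[v ^+ 2]real_normK ?num_real//.
nra.
Qed.

(* Second-order Taylor bound, proved by w^(j+1) - 1 - (j+1)(w-1) =
   w (w^j - 1 - j(w-1)) + j (w-1)^2. *)
Lemma cmod_taylor w (k : R) j : cmod (w - 1) <= k ->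
  cmod (w ^+ j - 1 - j%:R * (w - 1)) <= j%:R ^+ 2 * k ^+ 2 * (1 + k) ^+ j.
Proof.
move=> wk; have k0 : 0 <= k by exact: le_trans (cmod_ge0 _) wk.
have w1 : cmod w <= 1 + k.
  by rewrite -[w](subrK 1) addrC (le_trans (cmodD _ _))// {1}/cmod Normc.normc1 lerD2l.
elim: j => [|j IH].
  by rewrite expr0 subrr mul0r subr0 /cmod Normc.normc0 expr0n/= !mul0r.
have -> : w ^+ j.+1 - 1 - j.+1%:R * (w - 1) =
    w * (w ^+ j - 1 - j%:R * (w - 1)) + j%:R * (w - 1) ^+ 2.
  by rewrite exprS -natr1; ring.
apply: le_trans (cmodD _ _) _; rewrite (cmodM w) (cmodM j%:R) cmodX cmod_nat.
have h1 : cmod w * cmod (w ^+ j - 1 - j%:R * (w - 1)) <=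
    (1 + k) * (j%:R ^+ 2 * k ^+ 2 * (1 + k) ^+ j) by rewrite ler_pM ?cmod_ge0.
have h2 : cmod (w - 1) ^+ 2 <= k ^+ 2 by rewrite lerXn2r ?nnegrE ?cmod_ge0.
have h3 : 1 <= (1 + k) ^+ j.+1 by rewrite exprn_ege1// lerDl.
have h4 : j%:R * cmod (w - 1) ^+ 2 <= j%:R * k ^+ 2 * (1 + k) ^+ j.+1.
  apply: (@le_trans _ _ (j%:R * k ^+ 2)); first by apply: ler_wpM2l.
  by rewrite -[leLHS]mulr1 ler_wpM2l// mulr_ge0 ?sqr_ge0.
apply: le_trans (lerD h1 h4) _.
have -> : (1 + k) * (j%:R ^+ 2 * k ^+ 2 * (1 + k) ^+ j) + j%:R * k ^+ 2 * (1 + k) ^+ j.+1 =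
   (j%:R ^+ 2 + j%:R) * (k ^+ 2 * (1 + k) ^+ j.+1) by rewrite (exprS (1 + k) j); ring.
rewrite -mulrA ler_wpM2r ?mulr_ge0 ?sqr_ge0 ?exprn_ge0 ?addr_ge0//.
by rewrite -natr1; have := ler0n R j; nra.
Qed.

(** The polynomial with coefficients j a_j is z G'(z), so the first term is the multiplicative
    first-order variation. The factor 4 bounds (1 + k)^j <= exp (n k) <= e. *)
Lemma kac_taylor (a : nat -> R) n z w (k : R) : cmod z = 1 -> cmod (w - 1) <= k ->
  n%:R * k <= 1 ->
  cmod (kac_poly a n (z * w) - kac_poly a n z) <=
  k * cmod (kac_poly (fun j => j%:R * a j) n z) +
  4 * n%:R ^+ 2 * k ^+ 2 * \sum_(j < n) `|a j|.
Proof.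
move=> z1 wk nk; have k0 : 0 <= k by exact: le_trans (cmod_ge0 _) wk.
have -> : kac_poly a n (z * w) - kac_poly a n z =
  (w - 1) * kac_poly (fun j => j%:R * a j) n z +
  \sum_(j < n) (a j)%:C * z ^+ j * (w ^+ j - 1 - j%:R * (w - 1)).
  rewrite /kac_poly mulr_sumr -big_split/= -sumrB; apply: eq_bigr => j _.
  rewrite exprMn rmorphM/= rmorph_nat; ring.
apply: le_trans (cmodD _ _) _; rewrite cmodM; apply: lerD.
  by rewrite ler_wpM2r ?cmod_ge0.
apply: le_trans (cmod_sum _ _) _; rewrite mulr_sumr; apply: ler_sum => j _.
rewrite !cmodM cmodX z1 expr1n mulr1 cmod_real mulrC ler_wpM2r//.
apply: le_trans (cmod_taylor j wk) _.
have jn : (j%:R : R) <= n%:R by rewrite ler_nat ltnW.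
have h1 : (1 + k) ^+ j <= 4.
  apply: (@le_trans _ _ (expR k ^+ j)).
    by rewrite lerXn2r ?nnegrE ?expR_ge0 ?addr_ge0// expR_ge1Dx.
  rewrite -expRM_natl.
  (* e <= 4 because exp (- 1/2) >= 1/2. *)
  apply: (@le_trans _ _ (expR 1)); last first.
    have h : expR (- 2^-1) >= 2^-1 :> R by apply: le_trans (expR_ge1Dx _); lra.
    have -> : expR 1 = (expR (- 2^-1))^-1 ^+ 2 :> R.
      by rewrite expRN invrK -expRM_natl divff.
    have -> : 4 = 2 ^+ 2 :> R by rewrite -natrX.
    by rewrite lerXn2r ?nnegrE ?invr_ge0 ?expR_ge0// invf_ple ?posrE ?expR_gt0.
  by rewrite ler_expR (le_trans _ nk)// ler_wpM2r.
have -> : 4 * n%:R ^+ 2 * k ^+ 2 = (n%:R ^+ 2 * k ^+ 2) * 4 by ring.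
rewrite ler_pM ?mulr_ge0 ?sqr_ge0 ?exprn_ge0 ?addr_ge0//.
by rewrite ler_wpM2r ?sqr_ge0// lerXn2r ?nnegrE ?ler0n.
Qed.

End ComplexModulus.

(** * The minimum modulus through rational parameters *)

Section MinModulus.
Context {R : realType}.
Local Open Scope complex_scope.

Lemma cmod_expn_sub (z z' : R[i]) (B : R) j : 1 <= B -> cmod z <= B -> cmod z' <= B ->
  cmod (z' ^+ j - z ^+ j) <= j%:R * B ^+ j * cmod (z' - z).
Proof.
move=> B1 zB z'B; have B0 : 0 <= B by exact: le_trans B1.
elim: j => [|j IH]; first by rewrite !expr0 subrr /cmod Normc.normc0 mul0r mul0r.
have -> : z' ^+ j.+1 - z ^+ j.+1 = z' * (z' ^+ j - z ^+ j) + (z' - z) * z ^+ j.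
  by rewrite !exprS; ring.
apply: le_trans (cmodD _ _) _; rewrite !cmodM cmodX.
have h1 : cmod z' * cmod (z' ^+ j - z ^+ j) <= B * (j%:R * B ^+ j * cmod (z' - z)).
  by rewrite ler_pM ?cmod_ge0.
have h2 : cmod (z' - z) * cmod z ^+ j <= cmod (z' - z) * B ^+ j.+1.
  apply: ler_wpM2l; first exact: cmod_ge0.
  apply: (@le_trans _ _ (B ^+ j)); first by rewrite lerXn2r ?nnegrE ?cmod_ge0.
  by rewrite exprS ler_peMl ?exprn_ge0.
apply: le_trans (lerD h1 h2) _.
by rewrite (exprS B j) -natr1 le_eqVlt; apply/orP; left; apply/eqP; ring.
Qed.

Lemma kac_lip (a : nat -> R) n (z z' : R[i]) (B : R) : 1 <= B -> cmod z <= B -> cmod z' <= B ->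
  cmod (kac_poly a n z') <= cmod (kac_poly a n z) +
    (\sum_(j < n) `|a j| * (j%:R * B ^+ j)) * cmod (z' - z).
Proof.
move=> B1 zB z'B.
have -> : kac_poly a n z' = kac_poly a n z + (kac_poly a n z' - kac_poly a n z) by ring.
apply: le_trans (cmodD _ _) _; rewrite lerD2l /kac_poly -sumrB mulr_suml.
apply: le_trans (cmod_sum _ _) _; apply: ler_sum => j _.
rewrite -mulrBr cmodM cmod_real -mulrA ler_wpM2l//.
exact: cmod_expn_sub.
Qed.

(** Clamping the radial parameter makes [annulus_point] land in the annulus for all real arguments,
    so that unrestricted rationals can serve as a countable dense family. *)
Definition clamp1 (u : R) : R := Num.max (-1) (Num.min 1 u).

Lemma clamp1_lip u v : `|clamp1 u - clamp1 v| <= `|u - v|.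
Proof.
have lmin (x y : R) : `|Num.min 1 x - Num.min 1 y| <= `|x - y|.
  rewrite /Num.min; have := ler_norm (x - y); have := ler_norm (y - x).
  rewrite (distrC y x); move: `|x - y| => D h1 h2; rewrite ler_norml.
  by case: (ltP 1 x) => hx; case: (ltP 1 y) => hy; apply/andP; split; lra.
have lmax (x y : R) : `|Num.max (-1) x - Num.max (-1) y| <= `|x - y|.
  rewrite /Num.max; have := ler_norm (x - y); have := ler_norm (y - x).
  rewrite (distrC y x); move: `|x - y| => D h1 h2; rewrite ler_norml.
  by case: (ltP (-1) x) => hx; case: (ltP (-1) y) => hy; apply/andP; split; lra.
exact: le_trans (lmax _ _) (lmin _ _).
Qed.

Lemma clamp1_itv u : -1 <= clamp1 u <= 1.
Proof.
rewrite /clamp1 le_max lexx/= ge_max ge_min lexx/= andbT; lra.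
Qed.

Lemma clamp1_id u : -1 <= u <= 1 -> clamp1 u = u.
Proof.
by move=> /andP[u1 u2]; rewrite /clamp1 (min_idPr u2) (max_idPr u1).
Qed.

Definition annulus_point (r : R) (p q : R) : R[i] := (1 + r * clamp1 p)%:C * cis q.

Lemma cmod_annulus_point r p q : 0 <= r <= 1 ->
  cmod (annulus_point r p q) = 1 + r * clamp1 p.
Proof.
move=> /andP[r0 r1]; rewrite /annulus_point cmodM cmod_cis mulr1 cmod_real ger0_norm//.
have /andP[c1 c2] := clamp1_itv p; move: r0 r1 c1 c2; nra.
Qed.

Lemma annulus_pointP r p q : 0 <= r <= 1 -> unit_circle_nbhd r (annulus_point r p q).
Proof.
move=> r01; change (`|cmod (annulus_point r p q) - 1| <= r).
rewrite cmod_annulus_point// addrC addKr.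
have /andP[r0 r1] := r01; rewrite normrM (ger0_norm r0) ler_piMr// ler_norml.
exact: clamp1_itv.
Qed.

Lemma cmod_annulus_point_sub r p q p' q' : 0 <= r <= 1 ->
  cmod (annulus_point r p' q' - annulus_point r p q) <= `|p' - p| + 2 * `|q' - q|.
Proof.
move=> r01; have /andP[r0 r1] := r01.
have -> : annulus_point r p' q' - annulus_point r p q =
   (r * (clamp1 p' - clamp1 p))%:C * cis q' +
   annulus_point r p q * (cis (q' - q) - 1).
  rewrite /annulus_point.
  have -> : cis q' = cis q * cis (q' - q) by rewrite -cisD; congr cis; ring.
  have -> : r * (clamp1 p' - clamp1 p) = (1 + r * clamp1 p') - (1 + r * clamp1 p) by ring.
  rewrite (rmorphB (real_complex R))/=.
  move: (_%:C) (_%:C) (cis q) (cis (q' - q)) => u v x y; ring.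
apply: le_trans (cmodD _ _) _; rewrite (cmodM _ (cis q')) (cmodM (annulus_point r p q)).
rewrite cmod_cis mulr1 cmod_annulus_point// cmod_real.
apply: lerD.
  rewrite normrM (ger0_norm r0) (le_trans _ (clamp1_lip p' p))// ler_piMl//.
have h := cmod_cis_sub1 (q' - q); have /andP[c1 c2] := clamp1_itv p.
apply: ler_pM => //; first by move: r0 r1 c1 c2; nra.
  exact: cmod_ge0.
by move: r0 r1 c1 c2; nra.
Qed.

Lemma annulus_point_surj r z : 0 < r -> unit_circle_nbhd r z -> exists p q,
  0 <= q <= pi /\ forall a n,
    cmod (kac_poly a n z) = cmod (kac_poly a n (annulus_point r p q)).
Proof.
move=> r0; rewrite /unit_circle_nbhd/= => zr.
have [x [x0 xpi zx]] := polar_form z.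
exists ((cmod z - 1) / r), x; split; first exact/andP.
move=> a n; rewrite /annulus_point clamp1_id; last first.
  by rewrite -ler_norml normrM normfV (gtr0_norm r0) ler_pdivrMr// mul1r.
rewrite [r * _]mulrC divfK ?gt_eqF// addrC subrK.
by case: zx => <-//; rewrite kac_conj cmod_conj.
Qed.

(** By Lipschitz continuity the infimum is approached at rational parameters; this countable
    description gives measurability of the event. *)
Lemma min_modulus_leP (a : nat -> R) n r c : 0 < r <= 1 ->
  (min_modulus a n r <= c) <->
  (forall e, 0 < e -> exists p q : rat,
     cmod (kac_poly a n (annulus_point r (ratr p) (ratr q))) < c + e).
Proof.
move=> /andP[r0 r1]; have r01 : 0 <= r <= 1 by rewrite ltW.
rewrite /min_modulus; set E := [set _ | _ in _].
have lbE : has_lbound E by exists 0 => _ [z _ <-]; exact: cmod_ge0.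
have hE : has_inf E.
  split => //; exists (cmod (kac_poly a n (annulus_point r 0 0))).
  by exists (annulus_point r 0 0) => //; exact: annulus_pointP.
split; last first.
  move=> H; apply/ler_addgt0Pr => e /H[p [q pq]].
  apply: le_trans (ltW pq); apply: (ge_inf lbE).
  by exists (annulus_point r (ratr p) (ratr q)) => //; exact: annulus_pointP.
move=> Ec e e0; have e20 : 0 < e / 2 by rewrite divr_gt0.
have [_ [z zr <-] ze] := inf_adherent e20 hE.
have [p [q [_ pq]]] := annulus_point_surj r0 zr.
pose S := \sum_(j < n) `|a j| * (j%:R * 2 ^+ j).
have S0 : 0 <= S by apply: sumr_ge0 => j _; rewrite !mulr_ge0 ?exprn_ge0.
pose dd := e / 2 / (3 * (S + 1)).
have S1 : 0 < S + 1 by rewrite ltr_wpDl.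
have d0 : 0 < dd by rewrite divr_gt0// mulr_gt0.
have near x : exists y : rat, `|ratr y - x| <= dd.
  have : x < x + dd by rewrite ltrDl.
  move=> /rat_in_itvoo[y]; rewrite in_itv/= => /andP[y1 y2]; exists y.
  by rewrite ger0_norm ?subr_ge0 ?(ltW y1)// lerBlDl ltW.
have [p' hp] := near p; have [q' hq] := near q.
exists p', q'.
have b2 u v : cmod (annulus_point r u v) <= 2.
  rewrite cmod_annulus_point//; have /andP[c1 c2] := clamp1_itv u.
  by move: r0 r1 c1 c2; nra.
have b12 : (1 : R) <= 2 by rewrite ler1n.
apply: le_lt_trans (kac_lip a n b12 (b2 p q) (b2 _ _)) _.
have h := cmod_annulus_point_sub p q (ratr p') (ratr q') r01.
rewrite -pq -/S.
have h2 : S * cmod (annulus_point r (ratr p') (ratr q') - annulus_point r p q) <= e / 2.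
  apply: (@le_trans _ _ ((S + 1) * (3 * dd))).
    by apply: ler_pM => //; [exact: cmod_ge0|lra|lra].
  by rewrite /dd le_eqVlt; apply/orP; left; apply/eqP; field; rewrite gt_eqF.
move: (cmod (kac_poly a n z)) ze Ec h2 => u ze Ec h2; lra.
Qed.

End MinModulus.

Section Measurability.
Context d (T : measurableType d) (R : realType).
Variable X : nat -> T -> R.
Hypothesis mX : forall j, measurable_fun setT (X j).
Local Open Scope complex_scope.

Lemma kac_parts (a : nat -> R) n (z : R[i]) : kac_poly a n z =
  (\sum_(j < n) complex.Re (z ^+ j) * a j) +i* (\sum_(j < n) complex.Im (z ^+ j) * a j).
Proof.
rewrite /kac_poly; elim/big_ind3 : _ => //= [? ? ? ? ? ? -> -> //|j _].
case: (z ^+ j) => u v /=.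
by apply/eqP; rewrite eq_complex/= !mul0r subr0 addr0 !(mulrC (a j)) !eqxx.
Qed.

Lemma measurable_min_modulus n (r c : R) : 0 < r <= 1 ->
  measurable [set w | min_modulus (fun k => X k w) n r <= c].
Proof.
move=> r01.
rewrite (_ : [set w | _] = \bigcap_(k : nat) \bigcup_(p : rat) \bigcup_(q : rat)
   [set w | cmod (kac_poly (fun j => X j w) n (annulus_point r (ratr p) (ratr q))) < c + k.+1%:R^-1]).
  apply: bigcapT_measurable => k; apply: bigcupT_measurable_rat => p.
  apply: bigcupT_measurable_rat => q.
  set z := annulus_point _ _ _.
  pose F w := (\sum_(j < n) complex.Re (z ^+ j) * X j w) ^+ 2 +
             (\sum_(j < n) complex.Im (z ^+ j) * X j w) ^+ 2.
  have mF : measurable_fun setT (Num.sqrt \o F).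
    apply: measurableT_comp.
      by apply: continuous_measurable_fun; exact: sqrt_continuous.
    apply: measurable_funD; apply: measurable_funX.
      by apply: measurable_sum => j; exact: measurable_funM.
    by apply: measurable_sum => j; exact: measurable_funM.
  rewrite (_ : [set w | _] = (Num.sqrt \o F) @^-1` `]-oo, c + k.+1%:R^-1[%classic).
    by rewrite -[X in measurable X]setTI; apply: mF.
  by apply/seteqP; split => w /=; rewrite in_itv/= kac_parts.
apply/seteqP; split => w /=.
  move=> /(min_modulus_leP _ _ _ r01) H k _.
  have [|p [q pq]] := H k.+1%:R^-1; first by rewrite invr_gt0 ltr0n.
  by exists p => //; exists q.
move=> H; apply/(min_modulus_leP _ _ _ r01) => e e0.
pose k := Num.truncn e^-1.
have ke : k.+1%:R^-1 <= e.
  rewrite invf_ple ?posrE ?ltr0n//.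
  have /andP[_ h] : k%:R <= e^-1 < k.+1%:R by apply: truncn_itv; rewrite invr_ge0 ltW.
  exact: ltW.
have [p _ [q _ /= pq]] := H k I.
by exists p, q; apply: lt_le_trans pq _; rewrite lerD2l.
Qed.

End Measurability.

(** * Union bound over a net of angles *)

Section Net.
Context {R : realType}.
Local Open Scope complex_scope.

(** Two nets, starting at the real points 1 and -1 and each used up to pi / 2, so that small [k]
    always means closeness to the real axis. *)
Definition net_angle (h : R) (m : bool) (k : nat) : R := if m then pi - k%:R * h else k%:R * h.

Lemma net_angle_diff h m k l : `|net_angle h m k - net_angle h m l| = `|h * k%:R - h * l%:R|.
Proof.
rewrite /net_angle; case: m; last by rewrite !(mulrC h).
by rewrite -normrN; congr (`|_|); ring.
Qed.

Variables (a : nat -> R) (n N : nat) (h D Q : R).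
Hypotheses (h_gt0 : 0 < h) (NE : 2 / h < N%:R).
Hypothesis aQ : \sum_(j < n) `|a j| <= Q.
Hypothesis aD : forall m k, (k < N)%N ->
  cmod (kac_poly (fun j => j%:R * a j) n (cis (net_angle h m k))) <= D.

Lemma kac_cis_step (x : R) (w : R[i]) (k : R) : cmod (w - 1) <= k -> n%:R * k <= 1 ->
  cmod (kac_poly (fun j => j%:R * a j) n (cis x)) <= D ->
  cmod (kac_poly a n (cis x * w) - kac_poly a n (cis x)) <=
  k * D + 4 * n%:R ^+ 2 * k ^+ 2 * Q.
Proof.
move=> wk nk xD; have k0 : 0 <= k by exact: le_trans (cmod_ge0 _) wk.
apply: le_trans (kac_taylor a (cmod_cis x) wk nk) _.
by apply: lerD; apply: ler_wpM2l => //; rewrite !mulr_ge0 ?sqr_ge0 ?ler0n.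
Qed.

Lemma net_point (r c : R) : 0 < r <= 1 -> 0 < c -> n%:R * (r + h) <= 1 ->
  min_modulus a n r <= c -> exists m k, [/\ (k < N)%N, k%:R * h <= pi / 2 &
   cmod (kac_poly a n (cis (net_angle h m k))) <=
     2 * c + ((r + h) * D + 4 * n%:R ^+ 2 * (r + h) ^+ 2 * Q)].
Proof.
move=> r01 c0 nr mc; have /andP[r0 r1] := r01.
have r01' : 0 <= r <= 1 by rewrite ltW.
(* A near-minimiser is enough: since [c] is positive, some value is below [2 * c]. *)
have [p [q [/andP[q0 qpi] qc]]] : exists p q, 0 <= q <= pi /\
    cmod (kac_poly a n (annulus_point r p q)) < 2 * c.
  move: mc; rewrite /min_modulus; set E := [set _ | _ in _] => mc.
  have hE : has_inf E.
    split; last by exists 0 => _ [z _ <-]; exact: cmod_ge0.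
    exists (cmod (kac_poly a n (annulus_point r 0 0))).
    by exists (annulus_point r 0 0) => //; exact: annulus_pointP.
  have [_ [z zr <-] ze] := inf_adherent c0 hE.
  have [p [q [q01 pq]]] := annulus_point_surj r0 zr.
  by exists p, q; split => //; rewrite -pq; move: ze mc; lra.
pose m := pi / 2 < q.
pose s := if m then pi - q else q.
have s0 : 0 <= s by rewrite /s; case: ifP => _ //; rewrite subr_ge0.
have s2 : s <= pi / 2 by rewrite /s /m; case: ltP => hq //; lra.
have sh0 : 0 <= s / h by rewrite divr_ge0// ltW.
have /andP[k1 k2] := truncn_itv sh0; set k := Num.truncn (s / h) in k1 k2.
have kh : k%:R * h <= s by rewrite -ler_pdivlMr.
have ks : s - k%:R * h <= h.
  have : s <= k.+1%:R * h by rewrite -ler_pdivrMr// ltW.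
  by rewrite -natr1 mulrDl mul1r; lra.
have kN : (k < N)%N.
  rewrite -(ltr_nat R); apply: le_lt_trans k1 (le_lt_trans _ NE).
  rewrite ler_pM2r ?invr_gt0//; apply: le_trans s2 _; have := @pihalf_lt2 R; lra.
exists m, k; split => //; first exact: le_trans kh s2.
have qa : `|q - net_angle h m k| <= h.
  rewrite /net_angle; move: kh ks; rewrite /s; case: (m) => kh ks; rewrite ler_norml;
    by apply/andP; split; move: h_gt0; lra.
set x := net_angle h m k in qa *.
pose w := (1 + r * clamp1 p)%:C * cis (q - x).
have zw : annulus_point r p q = cis x * w.
  rewrite /w /annulus_point mulrCA -cisD; congr (_ * cis _); ring.
have wk : cmod (w - 1) <= r + h.
  have -> : w - 1 = (r * clamp1 p)%:C * cis (q - x) + (cis (q - x) - 1).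
    by rewrite /w (rmorphD (real_complex R))/= rmorph1; ring.
  apply: le_trans (cmodD _ _) _; rewrite cmodM cmod_cis mulr1 cmod_real.
  apply: lerD; last by apply: le_trans (cmod_cis_sub1 _) qa.
  by rewrite normrM (gtr0_norm r0) ler_piMr ?(ltW r0)// ler_norml clamp1_itv.
have st := kac_cis_step wk nr (aD m kN).
rewrite zw in qc.
have -> : kac_poly a n (cis x) = kac_poly a n (cis x * w) -
   (kac_poly a n (cis x * w) - kac_poly a n (cis x)) by rewrite subKr.
apply: le_trans (cmodB _ _) _; apply: lerD => //; exact: ltW.
Qed.

(** Moving along the net transfers smallness to a distant net point at a linear cost; close to the
    real axis this permits a much coarser net. *)
Lemma net_chain m k l : n%:R * h <= 1 -> (l + k < N)%N ->
  cmod (kac_poly a n (cis (net_angle h m l))) <=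
  cmod (kac_poly a n (cis (net_angle h m (l + k)))) +
   k%:R * (h * D + 4 * n%:R ^+ 2 * h ^+ 2 * Q).
Proof.
move=> nh; elim: k => [|k IH] lkN; first by rewrite addn0 mul0r addr0.
have lkN' : (l + k < N)%N by apply: leq_ltn_trans lkN; rewrite leq_add2l.
apply: le_trans (IH lkN') _; set g := h * D + _.
have -> : k.+1%:R * g = g + k%:R * g by rewrite -natr1; ring.
rewrite addnS [leRHS]addrA lerD2r.
set x := net_angle h m (l + k).
pose w := cis (net_angle h m (l + k).+1 - x).
have zw : cis (net_angle h m (l + k).+1) = cis x * w.
  by rewrite /w -cisD; congr cis; ring.
have wk : cmod (w - 1) <= h.
  apply: le_trans (cmod_cis_sub1 _) _.
  rewrite net_angle_diff -natr1 -mulrBr addrC addKr mulr1 gtr0_norm//.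
have st := kac_cis_step wk nh (aD m lkN').
rewrite zw.
have -> : kac_poly a n (cis x) = kac_poly a n (cis x * w) -
   (kac_poly a n (cis x * w) - kac_poly a n (cis x)) by rewrite subKr.
by apply: le_trans (cmodB _ _) _; rewrite lerD2l.
Qed.

End Net.

Section UnionBound.
Context d (T : measurableType d) (R : realType) (P : probability T R).

Definition pr (A : set T) : R := fine (P A).

Lemma intg_indic (A : set T) : measurable A -> intg P (\1_A : T -> R).
Proof.
move=> mA; apply: (@intg_bounded _ _ _ _ _ 1); first exact: measurable_indic.
by move=> w; rewrite indicE ger0_norm ?ler0n// -[leRHS]/(1%:R) ler_nat leq_b1.
Qed.

Lemma pr_le_sum (I : finType) (Q : pred I) (F : I -> set T) (A : set T) :
  measurable A -> (forall i, measurable (F i)) ->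
  (forall w, A w -> exists2 i, Q i & F i w) -> pr A <= \sum_(i | Q i) pr (F i).
Proof.
move=> mA mF AF.
have -> : \sum_(i | Q i) pr (F i) = mean P (fun w => \sum_i (Q i)%:R * \1_(F i) w).
  rewrite mean_sum => [|i]; last by apply: intgZ; exact: intg_indic.
  rewrite big_mkcond; apply: eq_bigr => i _; rewrite meanZ ?mean_indic//; last exact: intg_indic.
  by case: (Q i); rewrite ?mul1r ?mul0r.
rewrite /pr -mean_indic//; apply: mean_le; first exact: intg_indic.
  by apply: intg_sum => i; apply: intgZ; exact: intg_indic.
move=> w; rewrite indicE.
have s0 : 0 <= \sum_i (Q i)%:R * (\1_(F i) w : R).
  by apply: sumr_ge0 => i _; rewrite mulr_ge0 ?ler0n.
have [|_] := boolP (w \in A); last by [].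
rewrite inE => /AF[i Qi Fi]; rewrite (bigD1 i)//= Qi indicE mem_set// mul1r lerDl.
by apply: sumr_ge0 => j _; rewrite mulr_ge0 ?ler0n.
Qed.

Lemma pr_le_add (A B C : set T) : measurable A -> measurable B -> measurable C ->
  (forall w, A w -> B w \/ C w) -> pr A <= pr B + pr C.
Proof.
move=> mA mB mC AB.
pose F (b : bool) := if b then B else C.
have mF b : measurable (F b) by case: b.
have := @pr_le_sum bool xpredT F A mA mF; rewrite big_bool/=; apply.
by move=> w /AB[?|?]; [exists true|exists false].
Qed.

Variable X : nat -> T -> R.
Hypothesis mX : forall j, measurable_fun setT (X j).

(** Signed real or imaginary part of z G'(z) at z = e^(i x): four one-sided deviations control its
    modulus. *)
Definition dev_coef (s co : bool) (x : R) (j : nat) : R :=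
  (if s then 1 else -1) * (j%:R * (if co then cos (j%:R * x) else sin (j%:R * x))).

(** The bound on the sum of |X_j| is what the truncated Chernoff bound needs; its failure is a
    single event, handled by Markov's inequality. *)
Definition dev_event (n : nat) (Q D : R) (b : nat -> R) : set T :=
  [set w | \sum_(j < n) `|X j w| <= Q /\ D <= \sum_(j < n) b j * X j w].

Definition dyadic_range (h : R) (i k : nat) : bool :=
  (((2 : R) ^+ i)^-1 <= k%:R * h) && (k%:R * h <= 2 / 2 ^+ i).

Lemma measurable_dev_event n Q D b : measurable (dev_event n Q D b).
Proof.
rewrite (_ : dev_event n Q D b = [set w | \sum_(j < n) `|X j w| <= Q] `&`
  [set w | D <= \sum_(j < n) b j * X j w])//.
apply: measurableI; first exact: measurable_set_le (measurable_sum_abs mX n).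
exact: measurable_set_ge (measurable_lin mX b n).
Qed.

Lemma measurable_small_value n th eps : measurable (small_value X n th eps).
Proof.
have mabs (b : nat -> R) : measurable [set w | `|\sum_(j < n) b j * X j w| <= eps].
  apply: (@measurable_set_le _ _ _ (fun w => `|\sum_(j < n) b j * X j w|)).
  by apply: measurableT_comp => //; exact: (measurable_lin mX b n).
by apply: measurableI; [exact: (mabs (fun j => cos (j%:R * th)))|
  exact: (mabs (fun j => sin (j%:R * th)))].
Qed.

Lemma large_derivative_dev n (x D : R) w : (forall s co, ~ (dev_event n
    (\sum_(j < n) `|X j w|) (D / 2) (dev_coef s co x)) w) ->
  cmod (kac_poly (fun j => j%:R * X j w) n (cis x)) <= D.
Proof.
move=> H; rewrite kac_cis.
have part co : `|\sum_(j < n) (if co then cos (j%:R * x) else sin (j%:R * x)) *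
    (j%:R * X j w)| <= D / 2.
  have E s : \sum_(j < n) dev_coef s co x j * X j w = (if s then 1 else -1) *
     \sum_(j < n) (if co then cos (j%:R * x) else sin (j%:R * x)) * (j%:R * X j w).
    by rewrite mulr_sumr; apply: eq_bigr => j _; rewrite /dev_coef; ring.
  have lt s : (if s then 1 else -1) *
     \sum_(j < n) (if co then cos (j%:R * x) else sin (j%:R * x)) * (j%:R * X j w) < D / 2.
    by rewrite ltNge; apply/negP => h; apply: (H s co); split => //=; rewrite E.
  have := lt true; have := lt false; rewrite mul1r mulN1r => l1 l2.
  by rewrite ler_norml; apply/andP; split; lra.
apply: le_trans (cmod_ge_parts _ _) _.
have := part true; have := part false => /=; lra.
Qed.

Variables (n N I b k0 k1 : nat) (h r c D Q eps0 epsm eps1 : R).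
Hypotheses (h_gt0 : 0 < h) (NE : 2 / h < N%:R) (r01 : 0 < r <= 1) (c_gt0 : 0 < c).
Hypotheses (nr : n%:R * (r + h) <= 1) (D_ge0 : 0 <= D) (b_gt0 : (0 < b)%N).
Hypothesis eps1E : 2 * c + ((r + h) * D + 4 * n%:R ^+ 2 * (r + h) ^+ 2 * Q) <= eps1.
Hypothesis eps0E : eps1 + k0%:R * (h * D + 4 * n%:R ^+ 2 * h ^+ 2 * Q) <= eps0.
Hypothesis epsmE : eps1 + b%:R * (h * D + 4 * n%:R ^+ 2 * h ^+ 2 * Q) <= epsm.
Hypothesis cover : forall k, (k < N)%N -> k%:R * h <= pi / 2 ->
  [\/ (k <= k0)%N, (k0 < k <= k1)%N | exists2 i, (i < I)%N & dyadic_range h i k].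

(** Three zones: angles up to index [k0] are moved to the real point at tolerance [eps0], those up
    to [k1] to multiples of [b] at tolerance [epsm], and the others, sorted by dyadic size, keep the
    full net at tolerance [eps1]. *)
Lemma min_event_bound :
  pr [set w | min_modulus (fun k => X k w) n r <= c] <=
  pr [set w | Q < \sum_(j < n) `|X j w|] +
  \sum_(v : (bool * 'I_N) * (bool * bool))
     pr (dev_event n Q (D / 2) (dev_coef v.2.1 v.2.2 (net_angle h v.1.1 v.1.2))) +
  \sum_(m : bool) (pr (small_value X n (net_angle h m 0) eps0) +
    \sum_(l : 'I_N | (k0 < l * b + b)%N && (l * b <= k1)%N)
      pr (small_value X n (net_angle h m (l * b)%N) epsm) +
    \sum_(i < I) \sum_(k : 'I_N | dyadic_range h i k)
      pr (small_value X n (net_angle h m k) eps1)).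
Proof.
set A := [set w | _].
have mA : measurable A by exact: measurable_min_modulus.
set B := [set w | Q < _].
have mB : measurable B.
  rewrite (_ : B = ~` [set w | \sum_(j < n) `|X j w| <= Q]).
    by apply: measurableC; exact: measurable_set_le (measurable_sum_abs mX n).
  by apply/seteqP; split => w /=; rewrite /B/= ltNge => /negP.
pose F (v : (bool * 'I_N) * (bool * bool)) :=
  dev_event n Q (D / 2) (dev_coef v.2.1 v.2.2 (net_angle h v.1.1 v.1.2)).
have mF v : measurable (F v) by exact: measurable_dev_event.
pose C := \bigcup_(v in [set: (bool * 'I_N) * (bool * bool)]) F v.
have mC : measurable C by apply: fin_bigcup_measurable.
pose G := A `\` (B `|` C).
have mG : measurable G by apply: measurableD => //; exact: measurableU.
have mBC : measurable (B `|` C) by exact: measurableU.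
apply: (@le_trans _ _ (pr (B `|` C) + pr G)).
  apply: pr_le_add => // w Aw; have [BCw|BCw] := pselect ((B `|` C) w); first by left.
  by right; split.
apply: lerD.
  apply: le_trans (pr_le_add mBC mB mC (fun w => id)) _; rewrite lerD2l.
  by apply: pr_le_sum => // w [v _ Fv]; exists v.
have Gw w : G w -> \sum_(j < n) `|X j w| <= Q /\ (forall m k, (k < N)%N ->
    cmod (kac_poly (fun j => j%:R * X j w) n (cis (net_angle h m k))) <= D).
  move=> [_ BC]; have wQ : \sum_(j < n) `|X j w| <= Q.
    by rewrite leNgt; apply/negP => h1; apply: BC; left.
  split => // m k kN; apply: large_derivative_dev => s co [_ h2].
  by apply: BC; right; exists ((m, Ordinal kN), (s, co)).
have nh : n%:R * h <= 1.
  apply: le_trans nr; rewrite ler_wpM2l ?ler0n// lerDr.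
  by have /andP[/ltW] := r01.
pose Z m := small_value X n (net_angle h m 0) eps0.
pose mid (l : 'I_N) := (k0 < l * b + b)%N && (l * b <= k1)%N.
pose Md m := \bigcup_(l in [set` mid]) small_value X n (net_angle h m (l * b)%N) epsm.
pose Mk m (i : 'I_I) := \bigcup_(k in [set` (fun k : 'I_N => dyadic_range h i k)])
  small_value X n (net_angle h m k) eps1.
pose Mn m := \bigcup_(i in [set: 'I_I]) Mk m i.
have mZ m : measurable (Z m) by exact: measurable_small_value.
have mMd m : measurable (Md m).
  by apply: fin_bigcup_measurable => // l _; exact: measurable_small_value.
have mMk m i : measurable (Mk m i).
  by apply: fin_bigcup_measurable => // l _; exact: measurable_small_value.
have mMn m : measurable (Mn m) by apply: fin_bigcup_measurable.
have mZM m : measurable (Z m `|` Md m) by exact: measurableU.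
apply: (@le_trans _ _ (\sum_m pr (Z m `|` Md m `|` Mn m))); last first.
  apply: ler_sum => m _.
  apply: le_trans (pr_le_add (measurableU _ _ (mZM m) (mMn m)) (mZM m) (mMn m) (fun w => id)) _.
  apply: lerD.
    apply: le_trans (pr_le_add (mZM m) (mZ m) (mMd m) (fun w => id)) _; rewrite lerD2l.
    apply: pr_le_sum => //; first by move=> l; exact: measurable_small_value.
  apply: le_trans (@pr_le_sum _ xpredT (Mk m) _ (mMn m) (mMk m) _) _.
    by move=> w [i _ wi]; exists i.
  apply: ler_sum => i _.
  apply: pr_le_sum => //; first by move=> l; exact: measurable_small_value.
apply: pr_le_sum => // [m|w Gw0]; first by apply: measurableU.
have [wQ wD] := Gw _ Gw0; have Q0 : 0 <= Q by apply: le_trans wQ; apply: sumr_ge0.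
have [Aw _] := Gw0.
have [m [k [kN kpi kc]]] := net_point h_gt0 NE wQ wD r01 c_gt0 nr Aw.
have {}kc := le_trans kc eps1E.
pose g0 := h * D + 4 * n%:R ^+ 2 * h ^+ 2 * Q.
have e0E : eps1 + k0%:R * g0 <= eps0 by [].
have emE : eps1 + b%:R * g0 <= epsm by [].
have g00 : 0 <= g0.
  by rewrite addr_ge0 ?mulr_ge0 ?sqr_ge0 ?ler0n// ltW.
have sv th eps : cmod (kac_poly (fun j => X j w) n (cis th)) <= eps ->
    small_value X n th eps w.
  move=> he; have e0 := le_trans (cmod_ge0 _) he.
  by move: he; rewrite kac_cis => /(cmod_le_parts e0).
exists m => //.
have [kk0|/andP[k0k kk1]|[i iI ki]] := cover kN kpi.
- left; left; apply: sv.
  have := @net_chain _ _ _ _ _ _ _ h_gt0 wQ wD m k 0 nh; rewrite add0n => /(_ kN) hk.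
  apply: le_trans hk _; apply: le_trans e0E; apply: lerD => //.
  by rewrite ler_wpM2r// ler_nat.
- left; right.
  (* Rounding [k] down to a multiple of [b] may cross [k0], whence the condition [k0 < l * b + b]
     rather than [k0 < l * b]. *)
  have lk : (k %/ b * b <= k)%N by exact: leq_divM.
  have lN : (k %/ b < N)%N by apply: leq_ltn_trans kN; exact: leq_div.
  exists (Ordinal lN) => /=.
    apply/andP; split => /=; last exact: leq_trans lk kk1.
    apply: leq_trans k0k _.
    by rewrite {1}(divn_eq k b) leq_add2l ltnW// ltn_pmod.
  apply: sv.
  have := @net_chain _ _ _ _ _ _ _ h_gt0 wQ wD m (k %% b)%N (k %/ b * b)%N nh.
  rewrite -divn_eq => /(_ kN) hk.
  apply: le_trans hk _; apply: le_trans emE; apply: lerD => //.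
  by rewrite ler_wpM2r// ler_nat ltnW// ltn_pmod.
- right; exists (Ordinal iI) => //; exists (Ordinal kN) => //=.
  exact: sv.
Qed.

End UnionBound.

(** * Estimates in powers of n *)

(* From here on y = n^(1/80), Lh = (log n)^(1/2) and LG = (log n)^gamma; for large n
   every constant and both logarithmic factors are at most y. The net has spacing
   h = (y^160 Lh LG)^-1, and q = (y^40 LG)^-1 is the order of the small values. *)
Section Scales.
Variable R : realType.
Implicit Types y t A h Lh LG W q : R.

Lemma ler_powr y i j : 1 <= y -> (i <= j)%N -> y ^+ i <= y ^+ j.
Proof. by move=> y1 ij; exact: ler_weXn2l. Qed.

Lemma truncn_half (x : R) : 2 <= x -> x / 2 <= (Num.truncn x)%:R <= x.
Proof.
move=> x2; have x0 : 0 <= x by lra.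
have /andP[l u] := truncn_itv x0; rewrite l andbT.
by move: u; rewrite -natr1; lra.
Qed.

Lemma annulus_scale_le1 y t h : 1 <= y -> 0 <= h -> h * y ^+ 160 <= 1 -> 1 <= t -> t + 1 <= y ->
  y ^+ 80 * (t * h + h) <= 1.
Proof.
move=> y1 h0 hy t1 ty.
have -> : y ^+ 80 * (t * h + h) = (t + 1) * (h * y ^+ 80) by ring.
apply: le_trans hy; have -> : h * y ^+ 160 = y ^+ 80 * (h * y ^+ 80) by ring.
have y0 := le_trans ler01 y1.
apply: ler_wpM2r; first by apply: mulr_ge0 => //; exact: exprn_ge0.
by apply: le_trans ty _; rewrite -[leLHS]expr1 ler_powr.
Qed.

(** The second-order Taylor term has a spare factor h y^152 <= y^(-8), which absorbs the constant;
    y^112 is the bound for the sum of |X_j|. *)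
Lemma quadratic_term_le y h Lh q (u : R) : 1 <= y -> 0 <= h -> h * y ^+ 160 <= 1 -> 1 <= Lh ->
  q = h * y ^+ 120 * Lh -> 4 * u ^+ 2 <= y ->
  4 * (y ^+ 80) ^+ 2 * (u * h) ^+ 2 * y ^+ 112 <= q.
Proof.
move=> y1 h0 hy L1 -> uy.
have -> : 4 * (y ^+ 80) ^+ 2 * (u * h) ^+ 2 * y ^+ 112 =
  h * y ^+ 120 * ((4 * u ^+ 2) * (h * y ^+ 152)) by ring.
have y0 : 0 <= y by lra.
rewrite ler_wpM2l ?mulr_ge0 ?exprn_ge0//; apply: le_trans L1; apply: le_trans hy.
apply: (@le_trans _ _ (y * (h * y ^+ 152))).
  by rewrite ler_wpM2r ?mulr_ge0 ?exprn_ge0.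
rewrite mulrCA -exprS ler_wpM2l// ler_powr//.
Qed.

Lemma eps1_bound y t A h Lh q : 1 <= y -> 0 <= h -> h * y ^+ 160 <= 1 -> 1 <= Lh ->
  q = h * y ^+ 120 * Lh -> 4 * (t + 1) ^+ 2 <= y ->
  2 * (t * q) + ((t * h + h) * (2 * A * y ^+ 120 * Lh) +
    4 * (y ^+ 80) ^+ 2 * (t * h + h) ^+ 2 * y ^+ 112) <= (2 * t + 2 * A * (t + 1) + 1) * q.
Proof.
move=> y1 h0 hy L1 qE ty.
have -> : (t * h + h) * (2 * A * y ^+ 120 * Lh) = 2 * A * (t + 1) * q by rewrite qE; ring.
have -> : t * h + h = (t + 1) * h by ring.
have := quadratic_term_le y1 h0 hy L1 qE ty; lra.
Qed.

Lemma step_bound y A h Lh q : 4 <= y -> 0 <= h -> h * y ^+ 160 <= 1 -> 1 <= Lh ->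
  q = h * y ^+ 120 * Lh ->
  h * (2 * A * y ^+ 120 * Lh) + 4 * (y ^+ 80) ^+ 2 * h ^+ 2 * y ^+ 112 <= (2 * A + 1) * q.
Proof.
move=> y1 h0 hy L1 qE.
have -> : h * (2 * A * y ^+ 120 * Lh) = 2 * A * q by rewrite qE; ring.
have := @quadratic_term_le y h Lh q 1 _ h0 hy L1 qE _; rewrite mul1r expr1n => /(_ _ _).
by move=> H; have := H ltac:(lra) ltac:(lra); lra.
Qed.

End Scales.

(** * Exceptional events and the zones near the real axis *)

Section Regions.
Context d (T : measurableType d) (R : realType) (P : probability T R).
Variable X : nat -> T -> R.
Hypothesis mX : forall j, measurable_fun setT (X j).
Hypothesis indX : forall (n : nat) (B : nat -> set R), (forall i, measurable (B i)) ->
  mean P (fun w => \prod_(j < n) \1_(B j) (X j w)) =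
  \prod_(j < n) mean P (fun w => \1_(B j) (X j w)).

(** Chernoff with s = Lh / y^120 and coefficients at most n: the exponent is - (v + 4) Lh^2 + v
    Lh^2. When Lh^2 = log n this is a probability n^(-4), small enough for a net of about n^2
    points. *)
Lemma dev_event_pr (v s1 y Lh Q x : R) (n : nat) (s co : bool) :
  (forall j s, `|s| <= s1 -> intg P (fun w => expR (s * X j w))) ->
  (forall j s, `|s| <= s1 -> mean P (fun w => expR (s * X j w)) <= expR (v * s ^+ 2)) ->
  0 <= v -> 0 < y -> 0 < Lh -> n%:R = y ^+ 80 -> Lh / y ^+ 40 <= s1 ->
  pr P (dev_event X n Q (2 * (v + 4) * y ^+ 120 * Lh / 2) (dev_coef s co x)) <=
    expR (- (4 * Lh ^+ 2)).
Proof.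
move=> iexp sg v0 y0 L0 nE ys.
(* Cut off at [n] because [chernoff_truncated] asks for a bound on all coefficients. *)
pose b j := if (j < n)%N then dev_coef s co x j else 0.
have bB j : `|b j| <= n%:R.
  rewrite /b; case: ifP => [jn|_]; last by rewrite normr0 ler0n.
  rewrite /dev_coef normrM (_ : `|if s then 1 else -1| = 1); last first.
    by case: (s); rewrite ?normrN normr1.
  rewrite mul1r normrM ger0_norm ?ler0n//.
  apply: (@le_trans _ _ (j%:R * 1)); last by rewrite mulr1 ler_nat ltnW.
  by rewrite ler_wpM2l ?ler0n//; case: (co); rewrite ler_norml ?cos_geN1 ?cos_le1 ?sin_geN1 ?sin_le1.
have k0 : 0 < y ^+ 40 by rewrite exprn_gt0.
have y80 : y ^+ 80 = (y ^+ 40) ^+ 2 by rewrite -exprM.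
have y120 : y ^+ 120 = (y ^+ 40) ^+ 3 by rewrite -exprM.
have := @chernoff_truncated _ _ _ _ _ mX indX _ _ iexp sg v0 n b n%:R (Lh / y ^+ 120)
  ((v + 4) * y ^+ 120 * Lh) Q bB.
rewrite divr_gt0 ?exprn_gt0// => /(_ isT).
have -> : Lh / y ^+ 120 * n%:R = Lh / y ^+ 40.
  by rewrite nE y80 y120; field; rewrite lt0r_neq0.
move=> /(_ ys).
have -> : - (Lh / y ^+ 120 * ((v + 4) * y ^+ 120 * Lh)) + n%:R * (v * (Lh / y ^+ 40) ^+ 2) =
    - (4 * Lh ^+ 2).
  by rewrite nE y80 y120; field; rewrite lt0r_neq0.
apply: le_trans; rewrite le_eqVlt; apply/orP; left; apply/eqP; congr (fine (P _)).
apply/seteqP; split => w /=; rewrite /dev_event/=;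
  have -> : \sum_(j < n) b j * X j w = \sum_(j < n) dev_coef s co x j * X j w;
  do ?[by apply: eq_bigr => j _; rewrite /b ltn_ord];
  (have -> : 2 * (v + 4) * y ^+ 120 * Lh / 2 = (v + 4) * y ^+ 120 * Lh by field); by [].
Qed.

Variable ps : R -> R.
Hypothesis psE : forall j x, psi P (X j) x = ps x.
Variables (c c0 : R).
Hypothesis ps_quad : forall x, `|x| <= c0 -> c * x ^+ 2 <= ps x.
Hypotheses (c_gt0 : 0 < c) (c0_gt0 : 0 < c0).

Lemma real_point_pr (y h : R) (n : nat) (m : bool) : 100 <= y -> n%:R = y ^+ 80 ->
  1 <= c0 * y -> 2 + 4 / c <= y ->
  pr P (small_value X n (net_angle h m 0) (y ^+ 34)) <= y^-1.
Proof.
move=> y100 nE c0y cy; move: c_gt0 c0_gt0 => c0' c00.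
have y0 : 0 < y by lra.
have y1 : 1 <= y by lra.
have yk k : 0 < y ^+ k by rewrite exprn_gt0.
have y2 : 100 * 100 <= y ^+ 2 by rewrite expr2; apply: ler_pM; lra.
have y6 : 32 * y ^+ 2 <= y ^+ 6.
  have -> : y ^+ 6 = y ^+ 2 * y ^+ 2 * y ^+ 2 by ring.
  rewrite ler_wpM2r ?(ltW (yk 2%N))//.
  by rewrite -[leLHS]mulr1; apply: ler_pM => //; lra.
have /andP[Kl Ku] := @truncn_half R (y ^+ 6 / 4) ltac:(lra).
set K := Num.truncn _ in Kl Ku.
have K0 : 0 < K%:R :> R by have := yk 6%N; lra.
have n0 : (0 < n)%N by rewrite -(ltr0n R) nE.
have := @small_ball_1d _ _ _ _ _ mX indX _ psE n (net_angle h m 0) (y ^+ 40)^-1 (y ^+ 34) c c0 K.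
rewrite -(ltr0n R) => /(_ K0 n0); rewrite invr_gt0 yk => /(_ isT).
have y40 : y ^+ 40 = y ^+ 6 * y ^+ 34 by ring.
have -> : (y ^+ 40)^-1 * K%:R * y ^+ 34 = K%:R / y ^+ 6.
  by rewrite y40; field; rewrite !lt0r_neq0.
rewrite ler_pdivrMr// (_ : 4^-1 * y ^+ 6 = y ^+ 6 / 4); last by rewrite mulrC.
move=> /(_ Ku); rewrite mulrC ler_pdivrMr//.
have Kc : K%:R <= c0 * y ^+ 40.
  apply: le_trans Ku _; rewrite y40.
  have -> : c0 * (y ^+ 6 * y ^+ 34) = y ^+ 6 * (c0 * y * y ^+ 33) by ring.
  apply: (@le_trans _ _ (y ^+ 6 * 1)); first by have := yk 6%N; lra.
  by rewrite ler_wpM2l ?(ltW (yk 6%N))// mulr_ege1//; exact: exprn_ege1.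
move=> /(_ Kc c0') H.
have {}H := H _ ps_quad; apply: le_trans (H _) _.
  move=> j; rewrite /net_angle mul0r subr0; case: m {H} => /=; last by rewrite mulr0 cos0 expr1n.
  elim: j => [|j IH]; first by rewrite mul0r cos0 expr1n.
  by rewrite -natr1 mulrDl mul1r cosDpi sqrrN.
have -> : c * n%:R * (y ^+ 40)^-1 ^+ 2 / 2 = c / 2.
  have y80 : y ^+ 80 = (y ^+ 40) ^+ 2 by rewrite -exprM.
  by rewrite nE y80; field; rewrite lt0r_neq0.
have -> : 2 + 2 / (c / 2) = 2 + 4 / c by field; rewrite lt0r_neq0.
apply: (@le_trans _ _ (4 / K%:R * y)).
  by rewrite ler_wpM2l// divr_ge0// ltW.
rewrite -(div1r y) ler_pdivlMr// (_ : 4 / K%:R * y * y = 4 * y ^+ 2 / K%:R); last by ring.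
rewrite ler_pdivrMr// mul1r; lra.
Qed.

End Regions.

Lemma card_ord_le (R : realType) (N : nat) (A : pred 'I_N) (u : R) : 0 <= u ->
  (forall l : 'I_N, A l -> l%:R <= u) -> #|A|%:R <= u + 1.
Proof.
move=> u0 Au; set M := Num.truncn u.
have AM (l : 'I_N) : l \in A -> (l < M.+1)%N.
  by move=> /Au lu; rewrite ltnS truncn_ge_nat.
have inj : {in A &, injective (fun l : 'I_N => inord l : 'I_M.+1)}.
  move=> k l kA lA /(congr1 val) /=; rewrite !inordK ?AM// => kl; exact: val_inj.
apply: (@le_trans _ _ M.+1%:R); last by rewrite -natr1 lerD2r; have /andP[] := truncn_itv u0.
rewrite ler_nat -(card_in_imset inj) -[leqRHS]card_ord; exact: max_card.
Qed.

Lemma sum_le_card (R : realType) (I : finType) (A : pred I) (F : I -> R) (u : R) :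
  (forall i, A i -> F i <= u) -> \sum_(i | A i) F i <= #|A|%:R * u.
Proof.
move=> Fu; apply: le_trans (ler_sum _ (fun i => @Fu i)) _.
by rewrite sumr_const mulr_natl.
Qed.

Lemma sin_mirror (R : realType) (h : R) (m : bool) (k e : nat) :
  `|sin (e%:R * net_angle h m k)| = `|sin (e%:R * (k%:R * h))|.
Proof.
case: m => //=; rewrite mulrBr sinB.
have sp j : sin (j%:R * pi) = 0 :> R.
  elim: j => [|j IH]; first by rewrite mul0r sin0.
  by rewrite -natr1 mulrDl mul1r sinDpi IH oppr0.
have cp : `|cos (e%:R * pi : R)| = 1.
  apply/eqP; rewrite -(@eqrXn2 _ 2)// real_normK ?num_real// expr1n.
  have := cos2Dsin2 (e%:R * pi : R); rewrite sp expr0n addr0 => ->//.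
by rewrite sp mul0r sub0r normrN normrM cp mul1r.
Qed.

(** If n tau <= 4 take e = n / 2, the largest allowed shift; otherwise take e just above 1 / tau, so
    that e tau lies in [1, 2]. *)
Lemma resolving_shift (R : realType) (n : nat) (tau tau0 : R) : (4 <= n)%N ->
  0 < tau0 -> tau0 <= tau -> tau <= 1 -> n%:R * tau0 <= 8 ->
  exists2 e, (2 * e <= n)%N & n%:R * tau0 / 24 <= `|sin (e%:R * tau)|.
Proof.
move=> n4 t0 tt t1 nt.
have n4R : 4 <= n%:R :> R by rewrite -[4]/(4%:R) ler_nat.
have step e : n%:R * tau0 / 8 <= e%:R * tau -> e%:R * tau <= 2 ->
    n%:R * tau0 / 24 <= `|sin (e%:R * tau)|.
  move=> l u; have l0 : 0 <= e%:R * tau by rewrite mulr_ge0//; lra.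
  have /sin_ge_third h3 : 0 <= e%:R * tau <= 2 by rewrite l0.
  by have := ler_norm (sin (e%:R * tau)); lra.
have [tn|tn] := leP (n%:R * tau) 4.
  exists (n %/ 2)%N; first by rewrite mulnC leq_divM.
  have e1 : (n %/ 2)%:R * 2 <= n%:R :> R by rewrite -natrM ler_nat leq_divM.
  have e2 : n%:R <= (n %/ 2)%:R * 2 + 1 :> R.
    by rewrite -natrM natr1 ler_nat; lia.
  have q4 : n%:R / 8 <= (n %/ 2)%:R :> R by lra.
  have e1t : (n %/ 2)%:R * 2 * tau <= n%:R * tau by rewrite ler_wpM2r//; lra.
  apply: step; last by move: e1t tn; rewrite mulrAC; lra.
  by rewrite mulrAC; apply: ler_pM => //; rewrite ?(ltW t0)//; lra.
have t0' : 0 < tau by lra.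
have it : 0 <= tau^-1 by rewrite invr_ge0 ltW.
have /andP[l u] := truncn_itv it; set q := Num.truncn _ in l u.
have tn4 : tau^-1 * 4 < n%:R by rewrite ltr_pdivrMl// mulrC.
exists q.+1; first by rewrite -(ler_nat R) natrM -natr1; lra.
apply: step.
  apply: (@le_trans _ _ 1); first by lra.
  by rewrite -ler_pdivrMr// div1r ltW.
have : q%:R * tau <= 1 by rewrite -ler_pdivlMr// div1r.
by rewrite -natr1 mulrDl mul1r; lra.
Qed.

Lemma two_sqr_le (R : realType) (a b : R) : 0 <= a -> a <= b / 2 -> 2 * a ^+ 2 <= b ^+ 2.
Proof.
move=> a0 ab; have : a ^+ 2 <= (b / 2) ^+ 2 by rewrite lerXn2r// ?nnegrE; lra.
by have := sqr_ge0 b; lra.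
Qed.

Lemma mid_weight_bound (R : realType) (y K : R) : 2 <= y -> 0 < K -> y ^+ 23 / 4 / 2 <= K ->
  4 / K ^+ 2 * (2 + 2 * y) ^+ 2 <= 100 * 100 / (2 * y ^+ 44).
Proof.
move=> y2 K0 Kl; have y0 : 0 < y by lra.
apply: (@le_trans _ _ (4 / K ^+ 2 * (3 * y) ^+ 2)).
  rewrite ler_wpM2l ?divr_ge0 ?sqr_ge0//.
  by rewrite lerXn2r// ?nnegrE; lra.
rewrite ler_pdivlMr ?mulr_gt0 ?exprn_gt0//.
have -> : 4 / K ^+ 2 * (3 * y) ^+ 2 * (2 * y ^+ 44) = 72 * (y ^+ 23) ^+ 2 / K ^+ 2 by ring.
rewrite ler_pdivrMr ?exprn_gt0//.
have := exprn_gt0 23 y0; move: (y ^+ 23) Kl => Y Kl Y0.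
have : (Y / 4 / 2) ^+ 2 <= K ^+ 2 by rewrite lerXn2r// ?nnegrE; lra.
have := sqr_ge0 Y; move: (K ^+ 2) => k; lra.
Qed.

Section MidRegion.
Context d (T : measurableType d) (R : realType) (P : probability T R).
Variable X : nat -> T -> R.
Hypothesis mX : forall j, measurable_fun setT (X j).
Hypothesis indX : forall (n : nat) (B : nat -> set R), (forall i, measurable (B i)) ->
  mean P (fun w => \prod_(j < n) \1_(B j) (X j w)) =
  \prod_(j < n) mean P (fun w => \1_(B j) (X j w)).
Variable ps : R -> R.
Hypothesis psE : forall j x, psi P (X j) x = ps x.
Variables (c c0 : R).
Hypothesis ps_quad : forall x, `|x| <= c0 -> c * x ^+ 2 <= ps x.
Hypotheses (c_gt0 : 0 < c) (c0_gt0 : 0 < c0).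

Lemma mid_point_pr (y tau th : R) (n : nat) : 100 * 100 <= y -> n%:R = y ^+ 80 ->
  1 <= c0 * y -> 100 * 100 * 100 <= c * y -> (y ^+ 88)^-1 / 2 <= tau -> tau <= 1 ->
  (forall e, `|sin (e%:R * th)| = `|sin (e%:R * tau)|) ->
  pr P (small_value X n th (y ^+ 9)) <= 100 * 100 / (2 * y ^+ 44).
Proof.
move=> y100 nE c0y cy taul tau1 sE; move: c_gt0 c0_gt0 => c0' c00.
have y1 : 1 <= y by lra.
have y2 : 2 <= y by lra.
have y0 : 0 < y by lra.
have cy48 : 48 * 48 * 16 <= c * y by lra.
have yk k : 0 < y ^+ k by rewrite exprn_gt0.
have y23 : 100 * 100 <= y ^+ 23.
  by rewrite exprS -[leLHS]mulr1; apply: ler_pM => //; exact: exprn_ege1.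
have /andP[Kl Ku] := @truncn_half R (y ^+ 23 / 4) ltac:(lra).
set K := Num.truncn _ in Kl Ku.
have K0 : 0 < K%:R :> R by lra.
have y80 : y ^+ 80 = y ^+ 8 * y ^+ 72 by ring.
have y88 : y ^+ 88 = y ^+ 8 * (y ^+ 8 * y ^+ 72) by ring.
have n4 : (4 <= n)%N.
  rewrite -(ler_nat R) nE y80; have : 1 <= y ^+ 72 by exact: exprn_ege1.
  have : 1 <= y ^+ 7 by exact: exprn_ege1.
  rewrite exprS => p q; apply: (@le_trans _ _ (4 * 1 * 1)); first lra.
  by apply: ler_pM => //; rewrite ?mulr_ge0//; apply: ler_pM => //; lra.
have t00 : 0 < (y ^+ 88)^-1 / 2 by rewrite divr_gt0 ?invr_gt0.
have nt : n%:R * ((y ^+ 88)^-1 / 2) = (y ^+ 8)^-1 / 2.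
  by rewrite nE y80 y88; field; rewrite !lt0r_neq0.
have y8 : (y ^+ 8)^-1 <= 1 by rewrite invf_le1//; exact: exprn_ege1.
have [e en sl] := @resolving_shift R n tau _ n4 t00 taul tau1 ltac:(rewrite nt; lra).
rewrite nt -sE in sl.
have yi := invr_gt0 (y ^+ 8); rewrite yk in yi.
have s2 : (y ^+ 16)^-1 / (48 * 48) <= sin (e%:R * th) ^+ 2.
  rewrite -[leRHS]real_normK ?num_real//.
  have -> : (y ^+ 16)^-1 / (48 * 48) = ((y ^+ 8)^-1 / 2 / 24) ^+ 2.
    have -> : y ^+ 16 = y ^+ 8 * y ^+ 8 by ring.
    by field; rewrite lt0r_neq0.
  by rewrite lerXn2r// ?nnegrE; lra.
(* With n = y^80 and a squared sine of order y^(-16), this makes n dl^2 sin^2 of constant order.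
   Then [K], about y^23 / 4, saturates dl K y^9 <= 1/4 and keeps the whole grid in the disc of
   radius [c0]. *)
pose dl := (y ^+ 32)^-1.
have dl0 : 0 < dl by rewrite invr_gt0.
have dK : dl * K%:R <= y^-1 / 2.
  apply: (@le_trans _ _ (dl * (y ^+ 23 / 4))); first by rewrite ler_wpM2l// ltW.
  have -> : dl * (y ^+ 23 / 4) = y^-1 / 4 * (y ^+ 8)^-1.
    rewrite /dl; have -> : y ^+ 32 = y * y ^+ 8 * y ^+ 23 by ring.
    by field; rewrite !lt0r_neq0.
  have yi0 : 0 <= y^-1 by rewrite invr_ge0 ltW.
  apply: (@le_trans _ _ (y^-1 / 4 * 1)); first by rewrite ler_wpM2l// divr_ge0.
  by rewrite mulr1 ler_wpM2l// lef_pV2 ?posrE// ler_nat.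
have dKe : dl * K%:R * y ^+ 9 <= 4^-1.
  apply: (@le_trans _ _ (dl * (y ^+ 23 / 4) * y ^+ 9)).
    by rewrite ler_wpM2r ?(ltW (yk _))// ler_wpM2l// ltW.
  have -> : dl * (y ^+ 23 / 4) * y ^+ 9 = 4^-1; last by [].
  rewrite /dl; have -> : y ^+ 32 = y ^+ 9 * y ^+ 23 by ring.
  by field; rewrite !lt0r_neq0.
have dKc : 2 * (dl * K%:R) ^+ 2 <= c0 ^+ 2.
  have c0i : y^-1 <= c0 by rewrite -(div1r y) ler_pdivrMr.
  have q0 : 0 <= dl * K%:R by rewrite mulr_ge0// ltW.
  by apply: (two_sqr_le q0); apply: le_trans dK _; rewrite ler_wpM2r// invr_ge0.
have K0n : (0 < K)%N by rewrite -(ltr0n R).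
apply: le_trans (@small_ball_2d _ _ _ _ _ mX indX _ psE n th dl _ K K0n (ltW dl0) dKe) _.
have yi0 : 0 < y^-1 by rewrite invr_gt0.
have al : y^-1 <= c * n%:R * dl ^+ 2 * sin (e%:R * th) ^+ 2 / 16.
  apply: (@le_trans _ _ (c * n%:R * dl ^+ 2 * ((y ^+ 16)^-1 / (48 * 48)) / 16)).
    have -> : c * n%:R * dl ^+ 2 * ((y ^+ 16)^-1 / (48 * 48)) / 16 = c / (48 * 48 * 16).
      rewrite nE /dl; have -> : y ^+ 80 = y ^+ 32 ^+ 2 * y ^+ 16 by ring.
      by field; rewrite !lt0r_neq0.
    by rewrite -(div1r y) ler_pdivrMr// mulrAC ler_pdivlMr// mul1r.
  by rewrite ler_wpM2r// ler_wpM2l// mulr_ge0 ?sqr_ge0 ?mulr_ge0 ?ler0n// ltW.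
have gs := low_freq_sum ps_quad c0' c00 en dKc yi0 al.
apply: le_trans (ler_wpM2l _ gs) _.
  by rewrite divr_ge0// sqr_ge0.
rewrite invrK.
exact: mid_weight_bound.
Qed.

(** The coarse net has at most about y^88 W / y^48, hence O(y^42), points, and each has probability
    O(y^(-44)). *)
Lemma mid_region (y W h : R) (n N : nat) (m : bool) : 100 * 100 * 100 <= y -> n%:R = y ^+ 80 ->
  1 <= c0 * y -> 100 * 100 * 100 <= c * y -> 1 <= W -> W <= y ^+ 2 -> h * (y ^+ 160 * W) = 1 ->
  \sum_(l < N | (Num.truncn (y ^+ 72 * W) < l * Num.truncn (y ^+ 48) + Num.truncn (y ^+ 48))%N &&
      (l * Num.truncn (y ^+ 48) <= Num.truncn (y ^+ 88 * W))%N)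
    pr P (small_value X n (net_angle h m (l * Num.truncn (y ^+ 48))%N) (y ^+ 9)) <= y^-1.
Proof.
move=> y3 nE c0y cy W1 Wy hW.
have y100 : 100 * 100 <= y by lra.
have y1 : 1 <= y by lra.
have y0 : 0 < y by lra.
have yk k : 0 < y ^+ k by rewrite exprn_gt0.
have h0 : 0 < h.
  by rewrite -(@pmulr_lgt0 _ (y ^+ 160 * W)) ?hW// mulr_gt0//; lra.
have y48 : 2 <= y ^+ 48.
  by rewrite exprS -[leLHS]mulr1; apply: ler_pM => //; [lra|exact: exprn_ege1].
have /andP[bl bu] := truncn_half y48; set b := Num.truncn (y ^+ 48) in bl bu *.
have b0 : 0 < b%:R :> R by lra.
have W0 : 0 < W by lra.
have /andP[_ k0u] := @truncn_itv R (y ^+ 72 * W) (mulr_ge0 (ltW (yk _)) (ltW W0)).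
have /andP[k1u _] := @truncn_itv R (y ^+ 88 * W) (mulr_ge0 (ltW (yk _)) (ltW W0)).
set k0 := Num.truncn (y ^+ 72 * W) in k0u *; set k1 := Num.truncn (y ^+ 88 * W) in k1u *.
have lk1 (l : 'I_N) : (l * b <= k1)%N -> l%:R * b%:R <= y ^+ 88 * W.
  by move=> lk; apply: le_trans k1u; rewrite -natrM ler_nat.
apply: le_trans (sum_le_card (u := 100 * 100 / (2 * y ^+ 44)) _) _.
  move=> l /andP[k0l /lk1 lk].
  have lk0 : y ^+ 72 * W <= l%:R * b%:R + b%:R.
    by apply: le_trans (ltW k0u) _; rewrite -natrM -natrD ler_nat.
  apply: (@mid_point_pr y ((l * b)%:R * h)) => //; rewrite ?natrM; last by move=> e; rewrite sin_mirror natrM.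
    have E : (y ^+ 88)^-1 / 2 = y ^+ 72 * W / 2 * h.
      have -> : h = (y ^+ 72 * y ^+ 88 * W)^-1.
        have -> : y ^+ 72 * y ^+ 88 = y ^+ 160 by rewrite -exprD.
        apply: (@mulIf _ (y ^+ 160 * W)); last by rewrite hW mulVf// lt0r_neq0// mulr_gt0.
        by rewrite lt0r_neq0// mulr_gt0.
      by field; rewrite !lt0r_neq0.
    rewrite E ler_wpM2r ?(ltW h0)//.
    have : 2 * y ^+ 48 <= y ^+ 72 * W.
      apply: (@le_trans _ _ (y ^+ 72)); last by rewrite ler_peMr// ltW.
      rewrite (_ : y ^+ 72 = y ^+ 24 * y ^+ 48); last by rewrite -exprD.
      rewrite ler_wpM2r ?(ltW (yk _))// exprS -[leLHS]mulr1; apply: ler_pM => //; [lra|].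
      exact: exprn_ege1.
    by lra.
  apply: (@le_trans _ _ (y ^+ 88 * W * h)); first by rewrite ler_wpM2r// ltW.
  rewrite -hW mulrC ler_wpM2l ?(ltW h0)// ler_wpM2r ?(ltW W0)// ler_powr//.
have cnt (l : 'I_N) : (k0 < l * b + b)%N && (l * b <= k1)%N -> l%:R <= 2 * y ^+ 42.
  move=> /andP[_ /lk1 lk].
  rewrite -(ler_pM2r b0); apply: le_trans lk _.
  apply: (@le_trans _ _ (2 * y ^+ 42 * (y ^+ 48 / 2))); last first.
    by rewrite ler_wpM2l// mulr_ge0// ltW.
  have -> : 2 * y ^+ 42 * (y ^+ 48 / 2) = y ^+ 88 * y ^+ 2.
    by rewrite -exprD (_ : (88 + 2 = 42 + 48)%N)// exprD; field.
  by rewrite ler_wpM2l// ltW.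
have u0 : 0 <= 2 * y ^+ 42 by rewrite mulr_ge0// ltW.
have := card_ord_le u0 cnt; set A := #|_| => cA.
have y42 : 1 <= y ^+ 42 by exact: exprn_ege1.
have k44 : 0 <= 100 * 100 / (2 * y ^+ 44) by rewrite divr_ge0// mulr_ge0// ltW.
apply: (@le_trans _ _ (3 * y ^+ 42 * (100 * 100 / (2 * y ^+ 44)))).
  by rewrite ler_wpM2r//; lra.
have -> : 3 * y ^+ 42 * (100 * 100 / (2 * y ^+ 44)) = 3 * 100 * 100 / 2 / y / y.
  have -> : y ^+ 44 = y ^+ 42 * y * y by ring.
  by field; rewrite !lt0r_neq0.
by rewrite -[leRHS]div1r ler_wpM2r ?invr_ge0 ?(ltW y0)// ler_pdivrMr//; lra.
Qed.

End MidRegion.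

(** * Size of the bad set and choice of parameters *)

Lemma bad_cells_bound (R : realType) (y c0 k Q S : R) : 100 * 100 <= y ->
  0 <= k -> k <= y -> 0 <= Q -> Q <= 2 * y ^+ 41 -> 0 <= S -> S <= y ^+ 44 ->
  0 <= c0^-1 -> c0^-1 <= y -> 0 <= k * S + 10 * k * Q + S / c0 + 1 <= y ^+ 46.
Proof.
move=> y3 k0 ky Q0 Qy S0 Sy c00 cy.
have f1 : k * S <= y * y ^+ 44 by exact: ler_pM.
have f2 : k * Q <= y * (2 * y ^+ 41) by exact: ler_pM.
have f3 : S / c0 <= y ^+ 44 * y by exact: ler_pM.
have p1 := mulr_ge0 k0 S0; have p2 := mulr_ge0 k0 Q0; have p3 := mulr_ge0 S0 c00.
move: f1 f2 f3 p1 p2 p3; rewrite -(mulrA 10).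
move: (k * S) (k * Q) (S / c0) => a b e.
have -> : y * y ^+ 44 = y ^+ 42 * y ^+ 3 by rewrite -exprS -exprD.
have -> : y ^+ 44 * y = y ^+ 42 * y ^+ 3 by rewrite -exprSr -exprD.
have -> : y * (2 * y ^+ 41) = 2 * y ^+ 42 by rewrite mulrCA -exprS.
have -> : y ^+ 46 = y ^+ 42 * y ^+ 3 * y by rewrite -exprD -exprSr.
have : 1 <= y ^+ 42 by apply: exprn_ege1; lra.
have : 1 <= y ^+ 3 by apply: exprn_ege1; lra.
move: (y ^+ 42) (y ^+ 3) => u z z1 u1 f1 f2 f3 p1 p2 p3.
have uz : u <= u * z by rewrite ler_peMr//; lra.
have : u * z * (100 * 100) <= u * z * y by rewrite ler_wpM2l// mulr_ge0//; lra.
by move: (u * z * y) => w ?; apply/andP; split; lra.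
Qed.

Lemma add_one_le_cube (R : realType) (y : R) : 100 * 100 <= y -> y ^+ 2 + 1 <= y ^+ 3.
Proof.
move=> y3; rewrite [y ^+ 3]exprS; have : 1 <= y ^+ 2 by apply: exprn_ege1; lra.
move=> y1; apply: (@le_trans _ _ (2 * y ^+ 2)); first by move: y1; lra.
by rewrite ler_wpM2r ?sqr_ge0//; lra.
Qed.

Lemma scaled_ratio_bound (R : realType) (y k q : R) : 100 * 100 <= y ->
  0 <= k -> k <= y / 2 -> 0 <= q -> q <= 2 * y -> 0 <= k * q + 1 <= y ^+ 3.
Proof.
move=> y3 k0 ky q0 qy; have := mulr_ge0 k0 q0.
have : k * q <= y / 2 * (2 * y) by exact: ler_pM.
have -> : y / 2 * (2 * y) = y ^+ 2 by field.
have := add_one_le_cube y3; move: (y ^+ 3) (y ^+ 2) (k * q) => a b e ? ? ?.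
by apply/andP; split; lra.
Qed.

Lemma bad_factors_bound (R : realType) (y p q u tr f1 f2 f3 f4 : R) :
  2 <= y -> 0 <= tr <= p -> 0 <= f1 <= q -> 0 <= f2 <= u -> 0 <= f3 <= u -> 0 <= f4 <= u ->
  2 * (tr * (tr * (f1 * (f2 * f3) * f4 ^+ 2))) <= y * (p * (p * (q * (u * u) * u ^+ 2))).
Proof.
move=> y2 /andP[tr0 trp] /andP[f10 f1q] /andP[f20 f2u] /andP[f30 f3u] /andP[f40 f4u].
have f23 : f2 * f3 <= u * u by exact: ler_pM.
have f230 := mulr_ge0 f20 f30.
have f44 : f4 ^+ 2 <= u ^+ 2 by rewrite lerXn2r// nnegrE// (le_trans f40).
have f123 : f1 * (f2 * f3) <= q * (u * u) by exact: ler_pM.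
have f1230 := mulr_ge0 f10 f230.
have A := ler_pM f1230 (sqr_ge0 f4) f123 f44.
have A0 := mulr_ge0 f1230 (sqr_ge0 f4).
have B := ler_pM tr0 A0 trp A.
have B0 := mulr_ge0 tr0 A0.
have D := ler_pM tr0 B0 trp B.
by apply: ler_pM => //; exact: mulr_ge0.
Qed.

(** 143 = 1 + 42 + 42 + 46 + 6 + 6: the factor 2, the two cell counts, the first factor of
    [cell_bound], the two gap ratios, and the square counting vectors. Its distance to 160 makes bad
    pairs negligible. *)
Lemma bad_bound_le (R : realType) (y W h c0 C1 : R) (K e d2 d3 : nat) :
  100 * 100 * 100 <= y -> 0 < c0 -> 0 <= C1 -> 100 * 100 * 100 <= c0 * y ->
  100 * 100 * 100 * C1 <= y -> 100 * 100 * 100 * C1 <= c0 * y ->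
  1 <= W -> W <= y ^+ 2 -> h * (y ^+ 160 * W) = 1 -> K%:R <= y ^+ 81 ->
  y ^+ 80 / 8 <= d3%:R * e%:R -> 0 < d2%:R :> R -> d2%:R <= y ^+ 40 ->
  d3%:R <= 2 * d2%:R * y ^+ 40 ->
  bad_bound c0 C1 K h (y ^+ 40)^-1 (y ^+ 39)^-1 e d2 d3 <= y ^+ 143.
Proof.
move=> y3 c00 C10 yc yC yC0 W1 Wy hW Ky de d20 d2u d3u.
have y1 : 1 <= y by lra.
have y0 : 0 < y by lra.
have yk k : 0 < y ^+ k by rewrite exprn_gt0.
have y1k k : 1 <= y ^+ k by exact: exprn_ege1.
have W0 : 0 < W by lra.
have h0 : 0 < h by rewrite -(@pmulr_lgt0 _ (y ^+ 160 * W)) ?hW// mulr_gt0.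
have Cy8 : 100 * 70 * C1 <= 1 * (y / 8) by lra.
have y8 : 0 <= y / 8 by lra.
have y100 : 100 * 100 <= y by lra.
have ci : c0^-1 <= y / (100 * 100 * 100).
  by rewrite -(div1r c0) ler_pdivrMr// mulrAC ler_pdivlMr// mul1r [leRHS]mulrC.
have ci0 : 0 < c0^-1 by rewrite invr_gt0.
have Ci : C1 / c0 <= y / (100 * 100 * 100).
  by rewrite ler_pdivrMr// mulrAC ler_pdivlMr// mulrC [leRHS]mulrC.
have Ci0 : 0 <= C1 / c0 by apply: divr_ge0 => //; exact: ltW.
rewrite /bad_bound; set Qp := 2 * (y ^+ 40)^-1 * K%:R.
have Qp0 : 0 <= Qp by rewrite !mulr_ge0 ?invr_ge0// ltW.
have Qpu : Qp <= 2 * y ^+ 41.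
  apply: (@le_trans _ _ (2 * (y ^+ 40)^-1 * y ^+ 81)).
    by rewrite ler_wpM2l// mulr_ge0 ?invr_ge0// ltW.
  have -> : y ^+ 81 = y ^+ 40 * y ^+ 41 by rewrite -exprD.
  by rewrite -mulrA mulKf// lt0r_neq0.
set tr := (Num.truncn (2 * Qp / c0)).+1%:R : R.
have tr1 : tr <= y ^+ 42.
  have a0 : 0 <= 2 * Qp / c0 by apply: divr_ge0; [exact: mulr_ge0|exact: ltW].
  have /andP[tl _] := truncn_itv a0.
  rewrite /tr -natr1; apply: (@le_trans _ _ (4 * y ^+ 41 * (y / (100 * 100 * 100)) + 1)).
    rewrite lerD2r; apply: le_trans tl _; apply: ler_pM.
    - by apply: mulr_ge0.
    - exact: ltW.
    - by apply: (@le_trans _ _ (2 * (2 * y ^+ 41))); [rewrite ler_wpM2l|rewrite mulrA -natrM].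
    - exact: ci.
  have -> : 4 * y ^+ 41 * (y / (100 * 100 * 100)) = 4 / (100 * 100 * 100) * y ^+ 42.
    by rewrite [y ^+ 42]exprSr; ring.
  have : y <= y ^+ 42 by rewrite -[leLHS]expr1 ler_powr.
  lra.
have tr0 : 0 <= tr by rewrite /tr ler0n.
rewrite /cell_bound; set b := C1 * (y ^+ 39)^-1.
have b0 : 0 <= b by rewrite mulr_ge0 ?invr_ge0// ltW.
have y40 : y ^+ 40 = y ^+ 39 * y by rewrite exprSr.
have e0 : 0 < d3%:R * e%:R :> R by apply: lt_le_trans de; rewrite divr_gt0.
have S1 : 100 * 70 * b / (d3%:R * (e%:R * h)) <= y ^+ 44.
  rewrite mulrA ler_pdivrMr ?(mulr_gt0 e0 h0)//.
  apply: (@le_trans _ _ (y ^+ 44 * (y ^+ 80 / 8 * h))); last first.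
    by rewrite ler_wpM2l ?(ltW (yk _))// ler_wpM2r// ltW.
  rewrite /b mulrA ler_pdivrMr//.
  have -> : y ^+ 44 * (y ^+ 80 / 8 * h) * y ^+ 39 = h * (y ^+ 160 * y ^+ 2) * (y / 8).
    have -> : y ^+ 160 = y ^+ 44 * y ^+ 80 * y ^+ 36 by rewrite -!exprD.
    have -> : y ^+ 39 = y ^+ 36 * y ^+ 2 * y by rewrite -exprD -exprSr.
    ring.
  have hy : 1 <= h * (y ^+ 160 * y ^+ 2).
    by rewrite -hW ler_wpM2l ?(ltW h0)// ler_wpM2l ?(ltW (yk _)).
  by apply: (le_trans Cy8); rewrite ler_wpM2r.
have S10 : 0 <= 100 * 70 * b / (d3%:R * (e%:R * h)).
  apply: divr_ge0; first by rewrite mulr_ge0.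
  by apply: ltW; rewrite mulrA; exact: mulr_gt0.
move: S1 S10; set S := 100 * 70 * b / _ => S1 S10.
have kk : 50 * 1 * (100 * 70) / c0 <= y by move: y1 ci; clear; lra.
have kk0 : 0 <= 50 * 1 * (100 * 70) / c0 by apply: mulr_ge0 => //; exact: ltW.
have F1 := @bad_cells_bound R y c0 _ Qp S y100 kk0 kk Qp0 Qpu S10 S1 (ltW ci0)
  ltac:(move: y1 ci; clear; lra).
have F2 : 0 <= 100 * 70 * 50 * b * d2%:R / (100 * 70 * c0) + 1 <= y ^+ 3.
  have -> : 100 * 70 * 50 * b * d2%:R / (100 * 70 * c0) = 50 * (C1 / c0) * (d2%:R / y ^+ 39).
    by rewrite /b; field; rewrite !lt0r_neq0.
  apply: scaled_ratio_bound.
  - by move: y3; clear; lra.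
  - exact: mulr_ge0.
  - by move: Ci y1; clear; lra.
  - by apply: divr_ge0; exact: ltW.
  - rewrite ler_pdivrMr//; apply: le_trans d2u _.
    rewrite y40 (mulrC _ y) -[leRHS]mulrA ler_peMl ?ler1n//.
    by apply: mulr_ge0; exact: ltW.
have F3 : 0 <= 100 * 70 * 50 * b * d3%:R / (d2%:R * c0) + 1 <= y ^+ 3.
  have -> : 100 * 70 * 50 * b * d3%:R / (d2%:R * c0) =
     100 * 70 * 50 * (C1 / c0) * (d3%:R / d2%:R / y ^+ 39).
    by rewrite /b; field; rewrite !lt0r_neq0.
  apply: scaled_ratio_bound.
  - by move: y3; clear; lra.
  - exact: mulr_ge0.
  - by move: Ci y1; clear; lra.
  - by apply: divr_ge0; [apply: divr_ge0 => //; exact: ltW|exact: ltW].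
  - rewrite ler_pdivrMr// ler_pdivrMr//; apply: le_trans d3u _.
    by rewrite y40 le_eqVlt; apply/orP; left; apply/eqP; ring.
have F4 : 0 <= 7 * b / (y ^+ 40)^-1 + 1 <= y ^+ 3.
  have -> : 7 * b / (y ^+ 40)^-1 = 7 * C1 * y.
    by rewrite invrK /b y40; field; rewrite lt0r_neq0.
  apply: scaled_ratio_bound.
  - by move: y3; clear; lra.
  - exact: mulr_ge0.
  - by move: yC y1; clear; lra.
  - exact: ltW.
  - by move: y1; clear; lra.
have trr : 0 <= tr <= y ^+ 42 by rewrite tr0.
have y2' : 2 <= y by move: y3; clear; lra.
apply: le_trans (bad_factors_bound y2' trr F1 F2 F3 F4) _.
by rewrite le_eqVlt; apply/orP; left; apply/eqP; rewrite -exprM -!exprD -exprS.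
Qed.

Lemma leq_half_mul4 (n : nat) : (4 <= n)%N -> (n <= n %/ 2 * 4)%N.
Proof. lia. Qed.

(** d3 = n / (4 e) is the longest offset that leaves half of the indices to shifts, up to a
    constant, and d2 is its square root, which balances the two gap ratios. *)
Lemma scale_parameters (R : realType) (y : R) (n e : nat) : 100 * 100 * 100 <= y ->
  n%:R = y ^+ 80 -> (0 < e)%N -> e%:R <= 2 * y ^+ 72 ->
  exists d2 d3, [/\ (100 * 70 <= d2)%N, (d2 <= d3)%N, ((d3 + 1) * e + n %/ 2 <= n)%N &
    [/\ y ^+ 80 / 8 <= d3%:R * e%:R, d2%:R <= y ^+ 40 & d3%:R <= 2 * d2%:R * y ^+ 40]].
Proof.
move=> y3 nE e0 eu.
have y1 : 1 <= y by lra.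
have eR : 0 < e%:R :> R by rewrite ltr0n.
have m0 : 0 <= 100 * 100 * 100 :> R by rewrite !mulr_ge0.
have y8 : 100 * 100 * 100 * 16 <= y ^+ 8.
  have : 100 * 100 * 100 * (100 * 100 * 100) <= y * y by apply: ler_pM => //; exact: m0.
  have : y ^+ 2 <= y ^+ 8 by exact: ler_powr.
  by rewrite expr2; lra.
have y72 : 1 <= y ^+ 72 by exact: exprn_ege1.
have n8 : e%:R * 4 <= n%:R / 4 :> R.
  rewrite nE (_ : y ^+ 80 = y ^+ 8 * y ^+ 72); last by rewrite -exprD.
  have : 100 * y ^+ 72 <= y ^+ 8 * y ^+ 72.
    by rewrite ler_wpM2r//; move: y8 y72; lra.
  by move: eu; move: (y ^+ 8 * y ^+ 72) (y ^+ 72) => a b; lra.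
pose d3 := (n %/ (4 * e))%N.
have d3l : (d3 * (4 * e) <= n)%N by exact: leq_divM.
have d3u : (n < d3.+1 * (4 * e))%N by rewrite -ltn_divLR// muln_gt0.
have d3e : y ^+ 80 / 8 <= d3%:R * e%:R.
  have : n%:R <= (d3%:R + 1) * (4 * e%:R) :> R by rewrite natr1 -!natrM ler_nat ltnW.
  by rewrite -nE; move: n8 eR; lra.
have d38 : y ^+ 8 / 16 <= d3%:R.
  rewrite -(ler_pM2r eR); apply: le_trans d3e.
  rewrite (_ : y ^+ 80 = y ^+ 8 * y ^+ 72) -?exprD//.
  have y80 : 0 <= y ^+ 8 / 16 by lra.
  apply: le_trans (ler_wpM2l y80 eu) _.
  by rewrite [y ^+ (_ + _)]exprD le_eqVlt; apply/orP; left; apply/eqP; field.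
have d30 : 0 <= d3%:R :> R by exact: ler0n.
have sqE : Num.sqrt d3%:R * Num.sqrt d3%:R = d3%:R :> R by rewrite -expr2 sqr_sqrtr.
pose q := Num.sqrt (d3%:R : R).
have q0 : 0 <= q by exact: sqrtr_ge0.
have q4 : y ^+ 4 / 4 <= q.
  have -> : y ^+ 4 / 4 = Num.sqrt ((y ^+ 4 / 4) ^+ 2).
    by rewrite sqrtr_sqr ger0_norm// divr_ge0// exprn_ge0//; lra.
  rewrite ler_wsqrtr//; apply: le_trans d38.
  by rewrite (_ : y ^+ 8 = y ^+ 4 ^+ 2) -?exprM// le_eqVlt; apply/orP; left; apply/eqP; field.
have y4 : y <= y ^+ 4 by rewrite -[leLHS]expr1 ler_powr.
have /andP[ql qu] := @truncn_half R q ltac:(move: q4 y4 y3; clear; lra).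
set d2 := Num.truncn q in ql qu.
have q40 : q <= y ^+ 40.
  have -> : y ^+ 40 = Num.sqrt ((y ^+ 40) ^+ 2).
    by rewrite sqrtr_sqr ger0_norm// exprn_ge0//; lra.
  rewrite ler_wsqrtr// -exprM -nE ler_nat; apply: leq_trans d3l.
  by rewrite leq_pmulr// muln_gt0.
exists d2, d3; split.
- by rewrite -(ler_nat R) natrM; move: ql q4 y4 y3; clear; lra.
- rewrite -(ler_nat R); apply: le_trans qu _; rewrite -sqE ler_peMl//.
  by move: q4 y4 y3; clear; rewrite -/q; lra.
- have en : (16 * e <= n)%N.
    by rewrite -(ler_nat R) natrM; move: n8; clear; lra.
  by move: d3l en; rewrite /d3; move: (n %/ (4 * e))%N => z; clear; lia.
- split => //; first exact: le_trans q40.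
  rewrite -sqE -/q; apply: ler_pM => //.
  by move: ql; clear; lra.
Qed.

(** Since 4 / K^2 <= 256 ct^2 / (u LG^2) and J <= 3 p u Lh LG, the Gaussian part gives 768 ct^2 A p
    Lh / LG; the exponential and the bad parts are each at most y^(-3). *)
Lemma scale_assembly (R : realType) (y K J A ct Lh LG p u : R) :
  100 * 100 * 100 <= y -> 1 <= ct -> 256 * ct ^+ 2 <= y -> 1 <= LG -> 1 <= Lh ->
  Lh * LG <= y ^+ 2 -> 0 < p <= 1 -> u = y ^+ 160 -> 0 <= A ->
  0 < K -> y ^+ 80 * LG / (4 * ct) / 2 <= K -> 0 <= J -> J <= 3 * (p * (u * (Lh * LG))) ->
  4 / K ^+ 2 * (J * (A + 4 * K ^+ 2 * (y ^+ 320)^-1) + y ^+ 143) <=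
  768 * ct ^+ 2 * A * (Lh / LG) * p + (y ^+ 2)^-1.
Proof.
move=> yb ct1 cty LG1 Lh1 LL /andP[p0 p1] uE A0 K0 Kl J0 Ju.
have y1 : 1 <= y by lra.
have y0 : 0 < y by lra.
have yk k : 0 < y ^+ k by rewrite exprn_gt0.
have u0 : 0 < u by rewrite uE.
have LG0 : 0 < LG by lra.
have ct0 : 0 < ct by lra.
have x0 : 0 < y ^+ 80 * LG / (4 * ct) / 2.
  by rewrite !divr_gt0 ?mulr_gt0.
have g0 : 0 < 4 / K ^+ 2 by rewrite divr_gt0// exprn_gt0.
have gu : 4 / K ^+ 2 <= 256 * ct ^+ 2 / (u * LG ^+ 2).
  apply: (@le_trans _ _ (4 / (y ^+ 80 * LG / (4 * ct) / 2) ^+ 2)).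
    rewrite ler_wpM2l// lef_pV2 ?posrE ?exprn_gt0// lerXn2r// nnegrE; exact: ltW.
  rewrite uE (_ : y ^+ 160 = y ^+ 80 ^+ 2); last by rewrite -exprM.
  by rewrite le_eqVlt; apply/orP; left; apply/eqP; field; rewrite !lt0r_neq0.
have -> : 4 / K ^+ 2 * (J * (A + 4 * K ^+ 2 * (y ^+ 320)^-1) + y ^+ 143) =
   4 / K ^+ 2 * (J * A) + 16 * J / u ^+ 2 + 4 / K ^+ 2 * y ^+ 143.
  rewrite (_ : y ^+ 320 = u ^+ 2); last by rewrite uE -exprM.
  by field; rewrite !lt0r_neq0.
have m1 : 4 / K ^+ 2 * (J * A) <= 768 * ct ^+ 2 * A * (Lh / LG) * p.
  apply: (@le_trans _ _ (256 * ct ^+ 2 / (u * LG ^+ 2) * (3 * (p * (u * (Lh * LG))) * A))).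
    apply: ler_pM => //; [exact: ltW|exact: mulr_ge0|exact: ler_wpM2r].
  by rewrite le_eqVlt; apply/orP; left; apply/eqP; field; rewrite !lt0r_neq0.
have y3 : 2 * (y ^+ 3)^-1 <= (y ^+ 2)^-1.
  rewrite -[leRHS]mul1r ler_pdivlMr// mulrAC ler_pdivrMr// mul1r [y ^+ 3]exprS.
  by rewrite ler_wpM2r ?(ltW (yk _))//; lra.
have yy k l : (l <= k)%N -> y ^+ l / y ^+ k = (y ^+ (k - l))^-1.
  by move=> lk; rewrite -{1}(subnK lk) exprD invfM mulrCA mulfV ?mulr1// lt0r_neq0.
have yinv k l : (l <= k)%N -> (y ^+ k)^-1 <= (y ^+ l)^-1.
  by move=> lk; rewrite lef_pV2 ?posrE// ler_powr.
have m2 : 16 * J / u ^+ 2 <= (y ^+ 3)^-1.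
  have Ju2 : J <= 3 * (u * y ^+ 2).
    apply: le_trans Ju _; rewrite ler_wpM2l//.
    apply: (@le_trans _ _ (1 * (u * (Lh * LG)))).
      apply: ler_wpM2r p1; apply: mulr_ge0; first exact: ltW.
      by apply: mulr_ge0; [exact: le_trans Lh1|exact: ltW].
    by rewrite mul1r ler_wpM2l ?(ltW u0).
  apply: (@le_trans _ _ (16 * (3 * (u * y ^+ 2)) / u ^+ 2)).
    by rewrite ler_wpM2r ?invr_ge0 ?sqr_ge0// ler_wpM2l.
  have -> : 16 * (3 * (u * y ^+ 2)) / u ^+ 2 = 48 * (y ^+ 2 / y ^+ 160).
    by rewrite -uE; field; rewrite lt0r_neq0.
  rewrite yy// (_ : y ^+ (160 - 2) = y ^+ 3 * y ^+ 155); last by rewrite -exprD.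
  rewrite invfM mulrCA -[leRHS]mulr1 ler_wpM2l ?invr_ge0 ?(ltW (yk _))//.
  rewrite ler_pdivrMr// mul1r; apply: (@le_trans _ _ y); first by lra.
  by rewrite -[leLHS]expr1 ler_powr.
have m3 : 4 / K ^+ 2 * y ^+ 143 <= (y ^+ 3)^-1.
  apply: (@le_trans _ _ (y / u * y ^+ 143)).
    rewrite ler_wpM2r ?(ltW (yk _))//; apply: le_trans gu _.
    apply: ler_pM; [by apply: mulr_ge0; [exact: ler0n|exact: sqr_ge0]| |exact: cty|].
      by rewrite invr_ge0; apply: mulr_ge0; [exact: ltW|exact: sqr_ge0].
    rewrite lef_pV2 ?posrE ?mulr_gt0 ?exprn_gt0// ler_peMr ?(ltW u0)//.
    exact: exprn_ege1.
  rewrite mulrAC -exprS uE yy//; exact: yinv.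
lra.
Qed.

(** * One dyadic range of angles *)

Section ScaleRegion.
Context d (T : measurableType d) (R : realType) (P : probability T R).
Variable X : nat -> T -> R.
Hypothesis mX : forall j, measurable_fun setT (X j).
Hypothesis indX : forall (n : nat) (B : nat -> set R), (forall i, measurable (B i)) ->
  mean P (fun w => \prod_(j < n) \1_(B j) (X j w)) =
  \prod_(j < n) mean P (fun w => \1_(B j) (X j w)).
Variable ps : R -> R.
Hypothesis psE : forall j x, psi P (X j) x = ps x.
Variables (c c0 C1 : R).
Hypothesis ps_ge0 : forall x, 0 <= ps x.
Hypothesis ps_quad : forall x, `|x| <= c0 -> c * x ^+ 2 <= ps x.
Hypothesis ps_cluster : forall eta x y, 0 <= eta -> ps x <= eta ^+ 2 ->
  ps y <= eta ^+ 2 -> `|x - y| <= c0 -> `|x - y| <= C1 * eta.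
Hypotheses (c_gt0 : 0 < c) (c0_gt0 : 0 < c0) (C1_ge0 : 0 <= C1).
Variables (y Lh LG h ct : R) (n N : nat).
Hypotheses (y_big : 100 * 100 * 100 <= y) (nE : n%:R = y ^+ 80).
Hypotheses (yc0 : 100 * 100 * 100 <= c0 * y) (yC1 : 100 * 100 * 100 * C1 <= y).
Hypothesis yC0 : 100 * 100 * 100 * C1 <= c0 * y.
Hypotheses (Lh1 : 1 <= Lh) (Lhy : Lh ^+ 2 <= y) (LG1 : 1 <= LG) (LGy : LG <= y).
Hypothesis hE : h * (y ^+ 160 * (Lh * LG)) = 1.
Hypotheses (ct1 : 1 <= ct) (cty : 256 * ct ^+ 2 <= y).
Hypothesis expE : expR (- (4 * Lh ^+ 2)) = (y ^+ 320)^-1.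

(** The shift e = 2^i puts e theta in [1, 2]. With dl = y^(-40) one has n dl^2 = 1, hence a = c /
    144 and 2 / a = 288 / c; the threshold lam = 8 Lh^2 makes long vectors weigh at most y^(-320),
    and eta = y^(-39) is just large enough for the averaging. *)
Lemma scale_grid_sum (i K : nat) (m : bool) : 2 ^+ i <= 2 * y ^+ 72 -> K%:R <= y ^+ 81 ->
  \sum_(k < N | dyadic_range h i k) \sum_(w : 'I_(2 * K) * 'I_(2 * K))
      grid_weight ps n (net_angle h m k) (y ^+ 40)^-1 w <=
  (#|[set k : 'I_N | dyadic_range h i k]%SET|)%:R * ((2 + 288 / c) ^+ 2 + 4 * K%:R ^+ 2 * (y ^+ 320)^-1) + y ^+ 143.
Proof.
move=> iy Ky; move: c_gt0 c0_gt0 C1_ge0 y_big => c' c0' C1' yb.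
have y1 : 1 <= y by move: yb; lra.
have y0 : 0 < y by move: y1; lra.
have yk k : 0 < y ^+ k by rewrite exprn_gt0.
have i0 : (0 < 2 ^ i)%N by rewrite expn_gt0.
have iR : (2 ^ i)%:R = 2 ^+ i :> R by rewrite natrX.
have [d2 [d3 [d2l d23 d3n [d3e d2u d3u]]]] : exists d2 d3, _ :=
  scale_parameters yb nE i0 (eq_ind_r (fun z => z <= _) iy iR).
have W1 : 1 <= Lh * LG by exact: mulr_ege1.
have Wy : Lh * LG <= y ^+ 2.
  apply: ler_pM => //; try by move: Lh1 LG1; lra.
  by apply: le_trans Lhy; rewrite expr2 ler_peMr//; move: Lh1; lra.
have h0 : 0 < h.
  by rewrite -(@pmulr_lgt0 _ (y ^+ 160 * (Lh * LG))) ?hE// mulr_gt0//; move: W1; lra.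
set J := [set k : 'I_N | dyadic_range h i k]%SET.
rewrite (eq_bigl (mem J)); last by move=> k; rewrite !inE.
have i2 : 0 < 2 ^+ i :> R by rewrite exprn_gt0.
have Jlu (k : 'I_N) : k \in J -> 1 <= 2 ^+ i * (k%:R * h) <= 2.
  rewrite inE => /andP[l u]; apply/andP; split.
    by rewrite -[leLHS](mulfV (lt0r_neq0 i2)) ler_pM2l.
  by rewrite mulrC -ler_pdivlMr.
have d20 : (0 < d2)%N by apply: leq_trans d2l.
have n4 : 4 <= n%:R :> R.
  rewrite nE exprS; have : 1 <= y ^+ 79 by exact: exprn_ege1.
  by move=> y79; apply: (@le_trans _ _ (4 * 1)); [lra|apply: ler_pM => //; move: yb; lra].
have n4n : (4 <= n)%N by rewrite -(ler_nat R).
have n2 : (0 < n %/ 2)%N by rewrite divn_gt0// (leq_trans _ n4n).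
have d31 : (1 <= d3)%N by rewrite (leq_trans d20).
apply: le_trans (@main_freq_sum R ps c c0 C1 ps_ge0 ps_cluster ps_quad c' c0' n N K (n %/ 2)
  (fun k => net_angle h m k) h (y ^+ 40)^-1 (y ^+ 39)^-1 (8 * Lh ^+ 2) (2 ^ i) d2 d3 J _ _ _ _ _ _ _
  _ _ n2 d2l d23 d3n _ C1' _ (c / 144) _ _) _ => //.
- by move=> k l; exact: net_angle_diff.
- move=> k /Jlu /andP[l u]; rewrite sin_mirror iR.
  have /sin_ge_third s3 : 0 <= 2 ^+ i * (k%:R * h) <= 2 by rewrite u andbT; move: l; lra.
  by have := ler_norm (sin (2 ^+ i * (k%:R * h))); move: s3 l; lra.
- move=> k l /Jlu /andP[kl ku] /Jlu /andP[ll lu].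
  rewrite iR -(ger0_norm (ltW i2)) -normrM ler_norml.
  rewrite mulrBr !(mulrC h); move: kl ku ll lu.
  by move: (_ * _) (_ * _) => a b *; apply/andP; split; lra.
- by rewrite invr_gt0.
- by rewrite invr_gt0.
- by rewrite mulr_ge0 ?sqr_ge0.
- apply: leq_trans d3n; apply: leq_trans (leq_addr _ _).
  by rewrite leq_mul2r; apply/orP; right; rewrite addn1 ltnS.
- rewrite ler_pdivrMr//.
  have : c0 * y <= c0 * y ^+ 39.
    by rewrite ler_wpM2l ?(ltW c0')// -[leLHS]expr1 ler_powr.
  by rewrite mulrAC; move: yC0 C1' (mulr_gt0 c0' y0); lra.
- have n24 : n%:R / 4 <= (n %/ 2)%:R :> R.
    by rewrite ler_pdivrMr// -natrM ler_nat; exact: leq_half_mul4.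
  apply: (@le_trans _ _ ((y ^+ 39)^-1 ^+ 2 * (n%:R / 4))); last by rewrite ler_wpM2l// sqr_ge0.
  have -> : (y ^+ 39)^-1 ^+ 2 * (n%:R / 4) = y * y / 4.
    rewrite nE (_ : y ^+ 80 = y ^+ 39 * y ^+ 39 * y * y); last by rewrite -exprD -!exprSr.
    by field; rewrite lt0r_neq0.
  have : 100 * 100 * y <= y * y by rewrite ler_wpM2r ?(ltW y0)//; move: yb; lra.
  by move: Lhy; lra.
- by rewrite divr_gt0.
- rewrite nE (_ : y ^+ 80 = y ^+ 40 ^+ 2); last by rewrite -exprM.
  by rewrite le_eqVlt; apply/orP; left; apply/eqP; field; rewrite lt0r_neq0.
apply: lerD.
  rewrite (_ : - (8 * Lh ^+ 2) / 2 = - (4 * Lh ^+ 2)); last by field.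
  rewrite expE (_ : 2 / (c / 144) = 288 / c)//; last by field; rewrite lt0r_neq0.
apply: (bad_bound_le yb c0' C1' yc0 yC1 yC0 W1 Wy hE Ky) => //.
by rewrite ltr0n.
Qed.



Lemma scale_region (i : nat) (m : bool) : 2 ^+ i <= 2 * y ^+ 72 ->
  \sum_(k < N | dyadic_range h i k)
    pr P (small_value X n (net_angle h m k) (ct * (y ^+ 40 * LG)^-1)) <=
  768 * ct ^+ 2 * (2 + 288 / c) ^+ 2 * (Lh / LG) * (2 ^+ i)^-1 + (y ^+ 2)^-1.
Proof.
move=> iy; move: c_gt0 c0_gt0 C1_ge0 y_big => c' c0' C1' yb.
have y1 : 1 <= y by lra.
have y0 : 0 < y by lra.
have yk k : 0 < y ^+ k by rewrite exprn_gt0.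
have y1k k : 1 <= y ^+ k by exact: exprn_ege1.
have LG0 : 0 < LG by move: LG1; lra.
have ct0 : 0 < ct by move: ct1; lra.
have i0 : 0 < 2 ^+ i :> R by rewrite exprn_gt0.
have ctyy : 256 * ct <= y.
  have ct2 : ct <= ct ^+ 2 by rewrite expr2 ler_peMr// ltW.
  by move: cty; lra.
pose x := y ^+ 80 * LG / (4 * ct).
have x2 : 2 <= x.
  rewrite /x ler_pdivlMr ?mulr_gt0//; apply: (@le_trans _ _ (y * 1)); first by lra.
  apply: ler_pM => //; [exact: ltW|by rewrite -[leLHS]expr1 ler_powr].
have /andP[Kl Ku] := truncn_half x2; set K := Num.truncn x in Kl Ku.
have K0 : 0 < K%:R :> R by lra.
have K0n : (0 < K)%N by rewrite -(ltr0n R).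
have xy : x <= y ^+ 81.
  rewrite ler_pdivrMr ?mulr_gt0// [y ^+ 81]exprSr -[leRHS]mulrA ler_wpM2l ?(ltW (yk _))//.
  apply: le_trans LGy _; rewrite ler_peMr ?(ltW y0)//; move: ct1; lra.
have dK : (y ^+ 40)^-1 * K%:R * (ct * (y ^+ 40 * LG)^-1) <= 4^-1.
  have -> : 4^-1 = (y ^+ 40)^-1 * x * (ct * (y ^+ 40 * LG)^-1).
    rewrite /x (_ : y ^+ 80 = y ^+ 40 ^+ 2); last by rewrite -exprM.
    by field; rewrite !lt0r_neq0.
  have q0 : 0 < ct * (y ^+ 40 * LG)^-1 by rewrite mulr_gt0// invr_gt0 mulr_gt0.
  by rewrite (ler_pM2r q0) ler_pM2l// invr_gt0.
apply: (@le_trans _ _ (\sum_(k < N | dyadic_range h i k) 4 / K%:R ^+ 2 *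
    \sum_(w : 'I_(2 * K) * 'I_(2 * K)) grid_weight ps n (net_angle h m k) (y ^+ 40)^-1 w)).
  apply: ler_sum => k _; apply: (@small_ball_2d _ _ _ _ _ mX indX _ psE) => //.
  by rewrite invr_ge0 ltW.
rewrite -mulr_sumr.
have Ky : K%:R <= y ^+ 81 by exact: le_trans xy.
apply: le_trans (ler_wpM2l _ (scale_grid_sum m iy Ky)) _.
  by rewrite divr_ge0 ?sqr_ge0.
have W1 : 1 <= Lh * LG by exact: mulr_ege1.
have Wy : Lh * LG <= y ^+ 2.
  rewrite expr2; apply: ler_pM => //; try by move: Lh1 LG1; lra.
  by apply: le_trans Lhy; rewrite expr2 ler_peMr//; move: Lh1; lra.
have p01 : 0 < ((2 : R) ^+ i)^-1 <= 1.
  apply/andP; split; first by rewrite invr_gt0.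
  by rewrite invf_le1//; apply: exprn_ege1; lra.
set pp := ((2 : R) ^+ i)^-1 in p01 *.
have [p0 _] := andP p01.
have h0 : 0 < h.
  by rewrite -(@pmulr_lgt0 _ (y ^+ 160 * (Lh * LG))) ?hE// mulr_gt0//; move: W1; lra.
apply: (scale_assembly yb ct1 cty LG1 Lh1 Wy p01 erefl (sqr_ge0 _) _ Kl) => //.
have u0 : 0 <= 2 * (pp * (y ^+ 160 * (Lh * LG))).
  apply: mulr_ge0; first exact: ler0n.
  apply: mulr_ge0; first exact: ltW.
  by apply: mulr_ge0; [exact: ltW|exact: le_trans W1].
have cJ := @card_ord_le R N (mem [set k : 'I_N | dyadic_range h i k]%SET) _ u0 _.
apply: le_trans (cJ _) _.
  move=> k /=; rewrite inE => /andP[_ ku].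
  rewrite -(ler_pM2r h0); apply: le_trans ku _.
  have -> : 2 * (pp * (y ^+ 160 * (Lh * LG))) * h = 2 * pp * (h * (y ^+ 160 * (Lh * LG))) by ring.
  by rewrite hE mulr1.
rewrite (_ : 3 * _ = 2 * (pp * (y ^+ 160 * (Lh * LG))) + pp * (y ^+ 160 * (Lh * LG))); last by ring.
rewrite lerD2l -[leLHS](mulVf (lt0r_neq0 i0)) ler_wpM2l ?(ltW p0)//.
apply: le_trans iy _; apply: (@le_trans _ _ (y ^+ 160 * 1)); last by rewrite ler_wpM2l ?(ltW (yk _)).
rewrite mulr1 (_ : y ^+ 160 = y ^+ 88 * y ^+ 72); last by rewrite -exprD.
rewrite ler_wpM2r ?(ltW (yk _))//; apply: (@le_trans _ _ y); first by lra.
by rewrite -[leLHS]expr1 ler_powr.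
Qed.

End ScaleRegion.

Lemma dyadic_top (R : realType) (x : R) : 1 <= x -> exists I, x <= 2 ^+ I <= 2 * x.
Proof.
move=> x1.
have ex : exists I, x <= 2 ^+ I.
  exists (Num.truncn x).+1; have /andP[_ u] := truncn_itv (le_trans ler01 x1).
  by apply: le_trans (ltW u) _; rewrite -natrX ler_nat ltnW// ltn_expl.
case: (ex_minnP ex) => I xI Imin; exists I; rewrite xI /=.
case: I xI Imin => [|I] xI Imin; first by rewrite expr0; move: x1; lra.
rewrite exprS ler_pM2l//; rewrite leNgt; apply/negP => /ltW xl.
by have := Imin _ xl; rewrite ltnn.
Qed.

Lemma dyadic_range_cover (R : realType) (h : R) (I k : nat) :
  (2 ^+ I)^-1 <= k%:R * h -> k%:R * h <= 2 ->
  exists2 i, (i < I.+1)%N & dyadic_range h i k.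
Proof.
move=> kl ku.
have ex : exists i, (2 ^+ i)^-1 <= k%:R * h by exists I.
case: (ex_minnP ex) => i il imin; exists i; first by rewrite ltnS; exact: imin.
rewrite /dyadic_range il /=; case: i il imin => [|i] il imin; first by rewrite expr0 divr1.
rewrite exprS invfM mulrA divff// mul1r leNgt; apply/negP => /ltW xl.
by have := imin _ xl; rewrite ltnn.
Qed.

Lemma sum_half_pow (R : realType) (I : nat) : \sum_(i < I) ((2 : R) ^+ i)^-1 <= 2.
Proof.
suff : \sum_(i < I) ((2 : R) ^+ i)^-1 <= 2 - 2 * (2 ^+ I)^-1.
  have : 0 <= ((2 : R) ^+ I)^-1 by rewrite invr_ge0 exprn_ge0.
  by lra.
elim: I => [|I IH]; first by rewrite big_ord0 expr0 invr1; lra.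
rewrite big_ord_recr /= exprS invfM; move: IH.
by move: (\sum_(_ < _) _) ((2 ^+ I)^-1) => a b; lra.
Qed.

(** 2 >= exp (1/2), so there are O(log n) dyadic ranges. Only the error terms are multiplied by this
    number; the main terms carry 2^(-i) and sum as a geometric series. *)
Lemma dyadic_count (R : realType) (I : nat) (u : R) : 2 ^+ I <= expR u -> I%:R <= 2 * u.
Proof.
move=> Iu; have half : expR (2^-1) <= 2 :> R.
  have := @expR_ge1Dx R (- 2^-1); rewrite expRN.
  have e0 := @expR_gt0 R 2^-1 => H.
  by rewrite -[leLHS]invrK -[leRHS]invrK lef_pV2 ?posrE ?invr_gt0//; lra.
have : expR (I%:R * 2^-1) <= expR u.
  apply: le_trans Iu; rewrite mulrC expRM_natr lerXn2r// nnegrE//; exact: expR_ge0.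
by rewrite ler_expR; lra.
Qed.

Lemma count_exp_bound (R : realType) (y N : R) : 24 <= y -> N <= 3 * y ^+ 162 ->
  2 * N * (2 * 2) * (y ^+ 320)^-1 <= y^-1.
Proof.
move=> y24 N3; have y0 : 0 < y by lra.
have y1 : 1 <= y by lra.
have yk k : 0 < y ^+ k by rewrite exprn_gt0.
have -> : y ^+ 320 = y ^+ 162 * (y * y ^+ 157) by rewrite -exprS -exprD.
have y157 : y <= y ^+ 157 by rewrite -[leLHS]expr1 ler_powr.
move: (yk 162%N) (yk 157%N) N3 y157; move: (y ^+ 162) (y ^+ 157) => a b a0 b0 N3 yb.
rewrite -[leRHS]div1r ler_pdivlMr// (_ : 2 * N * (2 * 2) * _ * y = 8 * N / (a * b)).
  by rewrite ler_pdivrMr ?mulr_gt0// mul1r; apply: (@le_trans _ _ (a * 24)); [lra|rewrite ler_pM2l//; lra].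
by field; rewrite !lt0r_neq0.
Qed.

Lemma add_le_of_parts (R : realType) (a b u w : R) : a <= u / 256 -> b <= w / 256 ->
  u <= w -> 0 <= w -> a + b <= w.
Proof. lra. Qed.

Lemma net_size_bound (R : realType) (h u : R) (N : nat) : N%:R <= 2 / h -> h^-1 <= u ->
  1 <= u -> N%:R + 1 <= 3 * u.
Proof. lra. Qed.

Lemma scale_count_bound (R : realType) (y L : R) (I : nat) : 1 <= y -> L <= y ->
  I%:R <= 2 * (4 * L) -> I.+1%:R <= 9 * y.
Proof. rewrite -natr1; lra. Qed.

(** The 24 is 2 + 2 (2 + 9): two global events, and for each half of the arc the real point, the
    coarse net and the dyadic errors. *)
Lemma total_bound (R : realType) (u z a : R) : z <= u ->
  z + z + (z + z + (a * 2 + 9 * z) + (z + z + (a * 2 + 9 * z))) <= a * 4 + 24 * u.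
Proof. lra. Qed.

(** * Sum over all zones *)

Section Assembly.
Context d (T : measurableType d) (R : realType) (P : probability T R).
Variable X : nat -> T -> R.
Hypothesis mX : forall j, measurable_fun setT (X j).
Hypothesis indX : forall (n : nat) (B : nat -> set R), (forall i, measurable (B i)) ->
  mean P (fun w => \prod_(j < n) \1_(B j) (X j w)) =
  \prod_(j < n) mean P (fun w => \1_(B j) (X j w)).
Variable ps : R -> R.
Hypothesis psE : forall j x, psi P (X j) x = ps x.
Variables (c c0 C1 v s1 m1 : R).
Hypothesis ps_ge0 : forall x, 0 <= ps x.
Hypothesis ps_quad : forall x, `|x| <= c0 -> c * x ^+ 2 <= ps x.
Hypothesis ps_cluster : forall eta x y, 0 <= eta -> ps x <= eta ^+ 2 ->
  ps y <= eta ^+ 2 -> `|x - y| <= c0 -> `|x - y| <= C1 * eta.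
Hypotheses (c_gt0 : 0 < c) (c0_gt0 : 0 < c0) (C1_ge0 : 0 <= C1).
Hypothesis iexp : forall j s, `|s| <= s1 -> intg P (fun w => expR (s * X j w)).
Hypothesis subgauss : forall j s, `|s| <= s1 ->
  mean P (fun w => expR (s * X j w)) <= expR (v * s ^+ 2).
Hypothesis v_ge0 : 0 <= v.
Hypothesis iX : forall j, intg P (fun w => `|X j w|).
Hypothesis mXabs : forall j, mean P (fun w => `|X j w|) <= m1.

Variables (y Lh LG t : R) (n : nat).
Let ct : R := 2 * t + 2 * (v + 4) * (t + 1) + 1.
Hypotheses (y_big : 100 * 100 * 100 <= y) (nE : n%:R = y ^+ 80).
Hypotheses (yc0 : 100 * 100 * 100 <= c0 * y) (yC1 : 100 * 100 * 100 * C1 <= y).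
Hypothesis yC0 : 100 * 100 * 100 * C1 <= c0 * y.
Hypotheses (yc : 100 * 100 * 100 <= c * y) (yc4 : 2 + 4 / c <= y).
Hypotheses (Lh1 : 1 <= Lh) (Lhy : Lh ^+ 2 <= y) (LG1 : 1 <= LG) (LGy : LG <= y).
Hypotheses (t1 : 1 <= t) (cty : 256 * ct ^+ 2 <= y) (m1y : m1 <= y) (s1y : 1 <= s1 * y).
Hypothesis expE : expR (- (4 * Lh ^+ 2)) = (y ^+ 320)^-1.

Let h := (y ^+ 160 * (Lh * LG))^-1.
Let q := (y ^+ 40 * LG)^-1.

(** 3072 = 768 * 2 * 2, for the geometric series over dyadic ranges and the two halves of the arc.
    All other terms are O(1/y), and 1/y <= Lh / LG. *)
Lemma min_modulus_pr : pr P [set w | min_modulus (fun k => X k w) n (t * h) <= t * q] <=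
  (3072 * ct ^+ 2 * (2 + 288 / c) ^+ 2 + 24) * (Lh / LG).
Proof.
move: c_gt0 c0_gt0 C1_ge0 y_big => c' c0' C1' yb.
have y1 : 1 <= y by lra.
have y0 : 0 < y by lra.
have yk k : 0 < y ^+ k by rewrite exprn_gt0.
have y1k k : 1 <= y ^+ k by exact: exprn_ege1.
have LG0 : 0 < LG by move: LG1; lra.
have Lh0 : 0 < Lh by move: Lh1; lra.
have ctE : ct = 2 * (v * t) + 2 * v + 10 * t + 9 by rewrite /ct; ring.
have vt0 : 0 <= v * t by rewrite mulr_ge0// (le_trans ler01).
have [ct1 ctA ctt] : [/\ 1 <= ct, 2 * (v + 4) + 1 <= ct & t + 1 <= ct].
  by rewrite ctE; move: v_ge0 t1 vt0; move: (v * t) => vt *; split; lra.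
have ct0 : 0 < ct by lra.
have ctyy : 256 * ct <= y.
  have ct2 : ct <= ct ^+ 2 by rewrite expr2 ler_peMr// ltW.
  by move: cty; lra.
have ty4 : 4 * (t + 1) ^+ 2 <= y.
  have : (t + 1) ^+ 2 <= ct ^+ 2 by rewrite lerXn2r// nnegrE; move: t1; lra.
  by have := sqr_ge0 ct; move: cty; lra.
have t0 : 0 < t by move: t1; lra.
have A0 : 0 <= v + 4 by move: v_ge0; lra.
have ctd : ct <= y / 256 by lra.
have t1y : t + 1 <= y by lra.
have ty : t <= y by lra.
have y4 : 4 <= y by lra.
have y2 : 2 <= y by lra.
have y24 : 24 <= y by lra.
have y100 : 100 <= y by lra.
have c0y : 1 <= c0 * y by move: yc0; lra.
have [I /andP[Il Iu]] := dyadic_top (y1k 72%N).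
pose b := Num.truncn (y ^+ 48).
have y48 : 2 <= y ^+ 48 by apply: (le_trans y2); rewrite -[leLHS]expr1 ler_powr.
have /andP[b2 bl] := truncn_half y48; rewrite -/b in bl b2.
have Lhy1 : Lh <= y.
  by apply: le_trans Lhy; rewrite expr2 ler_peMr// ltW.
have W1 : 1 <= Lh * LG by exact: mulr_ege1.
have Wy : Lh * LG <= y ^+ 2 by rewrite expr2; apply: ler_pM; [exact: ltW|exact: ltW| |].
have W0 : 0 < Lh * LG by exact: mulr_gt0.
have h0 : 0 < h by rewrite invr_gt0 mulr_gt0.
have hE : h * (y ^+ 160 * (Lh * LG)) = 1 by rewrite mulVf// lt0r_neq0// mulr_gt0.
have hy : h * y ^+ 160 <= 1.
  by rewrite -hE ler_wpM2l ?(ltW h0)// ler_peMr// ltW.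
have qE : q = h * y ^+ 120 * Lh.
  rewrite /q /h (_ : y ^+ 160 = y ^+ 40 * y ^+ 120); last by rewrite -exprD.
  by field; rewrite !lt0r_neq0.
have q0 : 0 < q by rewrite invr_gt0 mulr_gt0.
have qy : q <= (y ^+ 40)^-1.
  rewrite /q invfM; apply: ler_piMr; last by rewrite (invf_le1 LG0).
  by rewrite invr_ge0; exact: ltW.
pose N := (Num.truncn (2 / h)).+1.
have h20 : 0 <= 2 / h by rewrite divr_ge0// ltW.
have /andP[Nl Nu] := truncn_itv h20.
(* In angle, [k0] and [k1] correspond to y^(-88) = n^(-11/10) and y^(-72) = n^(-9/10), the ends of
   the zone covered by the coarse net of step [b]. *)
pose k0 := Num.truncn (y ^+ 72 * (Lh * LG)).
pose k1 := Num.truncn (y ^+ 88 * (Lh * LG)).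
have /andP[k0u _] := truncn_itv (ltW (mulr_gt0 (yk 72%N) W0)); rewrite -/k0 in k0u.
have g0 := @step_bound R y (v + 4) h Lh q y4 (ltW h0) hy Lh1 qE.
have gct : h * (2 * (v + 4) * y ^+ 120 * Lh) + 4 * (y ^+ 80) ^+ 2 * h ^+ 2 * y ^+ 112 <= ct * q.
  by apply: le_trans g0 _; rewrite ler_wpM2r// ltW.
have g00 : 0 <= h * (2 * (v + 4) * y ^+ 120 * Lh) + 4 * (y ^+ 80) ^+ 2 * h ^+ 2 * y ^+ 112.
  apply: addr_ge0.
    apply: mulr_ge0; first exact: ltW.
    apply: mulr_ge0; last exact: ltW.
    by apply: mulr_ge0; [apply: mulr_ge0 => //; exact: ler0n|exact: ltW].
  apply: mulr_ge0; last exact: ltW.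
  by apply: mulr_ge0; [apply: mulr_ge0|exact: sqr_ge0]; [exact: ler0n|exact: sqr_ge0].
have q1 : q <= 1 by apply: le_trans qy _; rewrite invf_le1.
have := @min_event_bound _ _ _ P X mX n N I.+1 b k0 k1 h (t * h) (t * q)
  (2 * (v + 4) * y ^+ 120 * Lh) (y ^+ 112) (y ^+ 34) (y ^+ 9) (ct * q) h0 Nu.
rewrite !nE; move=> H; apply: le_trans (H _ _ _ _ _ _ _ _ _) _ => {H}.
- rewrite mulr_gt0//=; apply: le_trans hy; rewrite mulrC ler_wpM2l ?(ltW h0)//.
  by apply: le_trans ty _; rewrite -[leLHS]expr1 ler_powr.
- by rewrite mulr_gt0.
- exact: (annulus_scale_le1 y1 (ltW h0) hy t1 t1y).
- apply: mulr_ge0; last exact: ltW.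
  by apply: mulr_ge0; [apply: mulr_ge0 => //; exact: ler0n|exact: ltW].
- by rewrite -(ltr0n R); apply: lt_le_trans b2; rewrite divr_gt0.
- exact: (@eps1_bound R y t (v + 4) h Lh q y1 (ltW h0) hy Lh1 qE ty4).
- apply: (@le_trans _ _ (ct + y ^+ 72 * (Lh * LG) * (ct * q))).
    apply: lerD; first by rewrite ler_piMr ?(ltW ct0).
    by apply: ler_pM => //; exact: le_trans gct.
  have -> : y ^+ 72 * (Lh * LG) * (ct * q) = ct * Lh * y ^+ 32.
    rewrite /q (_ : y ^+ 72 = y ^+ 40 * y ^+ 32); last by rewrite -exprD.
    by field; rewrite !lt0r_neq0.
  have : ct * Lh * y ^+ 32 <= y / 256 * y * y ^+ 32.
    apply: ler_wpM2r; first exact: ltW.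
    by apply: ler_pM; [exact: ltW|exact: ltW|exact: ctd|].
  rewrite (_ : y / 256 * y * y ^+ 32 = y ^+ 34 / 256); last by rewrite 2!exprS; ring.
  move=> b34; apply: (add_le_of_parts ctd b34) => //; last exact: ltW.
  by rewrite -[leLHS]expr1 ler_powr.
- apply: (@le_trans _ _ (ct + y ^+ 48 * (ct * q))).
    apply: lerD; first by rewrite ler_piMr ?(ltW ct0).
    by apply: ler_pM => //; exact: le_trans gct.
  have : y ^+ 48 * (ct * q) <= y ^+ 48 * (y / 256 * (y ^+ 40)^-1).
    apply: ler_wpM2l; first exact: ltW.
    by apply: ler_pM; [exact: ltW|exact: ltW|exact: ctd|].
  rewrite (_ : y ^+ 48 * (y / 256 * (y ^+ 40)^-1) = y ^+ 9 / 256); last first.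
    rewrite (_ : y ^+ 48 = y ^+ 40 * y ^+ 8); last by rewrite -exprD.
    by rewrite [y ^+ 9]exprS; field; rewrite lt0r_neq0.
  move=> b9; apply: (add_le_of_parts ctd b9) => //; last exact: ltW.
  by rewrite -[leLHS]expr1 ler_powr.
- move=> k kN kpi.
  have [kk0|k0k] := leqP k k0; first by constructor 1.
  have [kk1|k1k] := leqP k k1; first by constructor 2; apply/andP.
  constructor 3; apply: (@dyadic_range_cover R h I k); last first.
    apply: le_trans kpi _; exact: ltW (andP (pihalf_02 R)).2.
  apply: (@le_trans _ _ ((y ^+ 72)^-1)); first by rewrite lef_pV2 ?posrE ?exprn_gt0.
  have k1R : y ^+ 88 * (Lh * LG) <= k%:R.
    have /andP[_ u] := truncn_itv (ltW (mulr_gt0 (yk 88%N) W0)).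
    by apply: le_trans (ltW u) _; rewrite ler_nat.
  apply: le_trans (ler_wpM2r (ltW h0) k1R).
  rewrite -[leLHS]mulr1 -hE (_ : y ^+ 160 = y ^+ 72 * y ^+ 88); last by rewrite -exprD.
  by rewrite le_eqVlt; apply/orP; left; apply/eqP; field; rewrite lt0r_neq0.
have q31 : y^-1 <= Lh / LG.
  rewrite -[leLHS]mul1r; apply: ler_pM => //; first by rewrite invr_ge0 ltW.
  by rewrite lef_pV2 ?posrE.
have T1 : pr P [set w | y ^+ 112 < \sum_(j < n) `|X j w|] <= y^-1.
  apply: le_trans (@markov_sum_abs _ _ _ P X mX n m1 _ (yk 112%N) iX mXabs) _.
  rewrite nE ler_pdivrMr// (_ : y ^+ 112 = y ^+ 80 * y * y ^+ 31); last by rewrite -exprSr -exprD.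
  rewrite (_ : y^-1 * (y ^+ 80 * y * y ^+ 31) = y ^+ 80 * y ^+ 31); last by field; rewrite lt0r_neq0.
  rewrite ler_wpM2l ?(ltW (yk _))//; apply: le_trans m1y _.
  by rewrite -[leLHS]expr1 ler_powr.
have T2 : \sum_(z : (bool * 'I_N) * (bool * bool)) pr P (dev_event X n (y ^+ 112)
    (2 * (v + 4) * y ^+ 120 * Lh / 2) (dev_coef z.2.1 z.2.2 (net_angle h z.1.1 z.1.2))) <= y^-1.
  have Ls1 : Lh / y ^+ 40 <= s1.
    rewrite ler_pdivrMr//; apply: le_trans Lhy1 _.
    rewrite exprS mulrA; apply: (@le_trans _ _ (1 * y ^+ 39)).
      by rewrite mul1r -[leLHS]expr1 ler_powr.
    by rewrite ler_wpM2r ?(ltW (yk _)).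
  apply: le_trans (sum_le_card (u := (y ^+ 320)^-1) _) _.
    move=> z _; rewrite -expE.
    exact: (@dev_event_pr _ _ _ P X mX indX v s1 y Lh _ _ n _ _ iexp subgauss v_ge0 y0 Lh0 nE Ls1).
  rewrite !card_prod !card_bool card_ord !natrM.
  have N3 : N%:R <= 3 * y ^+ 162.
    rewrite /N -natr1; have hi : h^-1 <= y ^+ 162.
      rewrite /h invrK (_ : y ^+ 162 = y ^+ 160 * y ^+ 2); last by rewrite -exprD.
      by rewrite ler_wpM2l ?(ltW (yk _)).
    exact: net_size_bound Nl hi (y1k _).
  exact: count_exp_bound.
have T3 (m : bool) : pr P (small_value X n (net_angle h m 0) (y ^+ 34)) <= y^-1.
  exact: (@real_point_pr _ _ _ P X mX indX ps psE c c0 ps_quad c' c0' y h n m y100 nE c0y yc4).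
have T4 (m : bool) : \sum_(l < N | (k0 < l * b + b)%N && (l * b <= k1)%N)
    pr P (small_value X n (net_angle h m (l * b)) (y ^+ 9)) <= y^-1.
  exact: (@mid_region _ _ _ P X mX indX ps psE c c0 ps_quad c' c0' y _ h n N m yb nE c0y yc W1 Wy hE).
pose CC := 768 * ct ^+ 2 * (2 + 288 / c) ^+ 2 * (Lh / LG).
have CC0 : 0 <= CC.
  apply: mulr_ge0; last by apply: divr_ge0; exact: ltW.
  apply: mulr_ge0; last exact: sqr_ge0.
  by apply: mulr_ge0; [exact: ler0n|exact: sqr_ge0].
have T5 (m : bool) : \sum_(i < I.+1) \sum_(k < N | dyadic_range h i k)
    pr P (small_value X n (net_angle h m k) (ct * q)) <= CC * 2 + 9 * y^-1.
  apply: (@le_trans _ _ (\sum_(i < I.+1) (CC * (2 ^+ i)^-1 + (y ^+ 2)^-1))).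
    apply: ler_sum => i _; apply: (@scale_region _ _ _ P X mX indX ps psE c c0 C1 ps_ge0 ps_quad ps_cluster c' c0' C1' y Lh LG
      h ct n N yb nE yc0 yC1 yC0 Lh1 Lhy LG1 LGy hE ct1 cty expE i m).
    apply: le_trans Iu; apply: ler_weXn2l; first by rewrite ler1n.
    by rewrite -ltnS.
  rewrite big_split /= -mulr_sumr; apply: lerD.
    by rewrite ler_wpM2l ?sum_half_pow.
  rewrite sumr_const card_ord -[leLHS]mulr_natl.
  have IL : I%:R <= 2 * (4 * Lh ^+ 2).
    apply: dyadic_count; apply: le_trans Iu _.
    rewrite -[expR _]invrK -expRN expE invrK.
    rewrite (_ : y ^+ 320 = y ^+ 248 * y ^+ 72); last by rewrite -exprD.
    rewrite ler_wpM2r ?(ltW (yk _))//; apply: (le_trans y2).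
    by rewrite -[leLHS]expr1 ler_powr.
  have I9 := scale_count_bound y1 Lhy IL.
  rewrite expr2 invfM mulrA ler_wpM2r ?invr_ge0 ?(ltW y0)//.
  by rewrite ler_pdivrMr.
apply: (@le_trans _ _ (y^-1 + y^-1 + \sum_(m : bool) (y^-1 + y^-1 + (CC * 2 + 9 * y^-1)))).
  by apply: lerD; [exact: lerD|apply: ler_sum => m _; apply: lerD => //; exact: lerD].
rewrite big_bool /= (_ : (_ + 24) * _ = CC * 4 + 24 * (Lh / LG)); last by rewrite /CC; ring.
exact: total_bound.
Qed.

End Assembly.

(** * Transfer of laws and the limit *)

Section Transfer.
Context d0 (T0 : measurableType d0) d (T : measurableType d) (R : realType).
Variables (P0 : probability T0 R) (P : probability T R).
Variables (xi : {RV P0 >-> R}) (X : {RV P >-> R}).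
Hypothesis eqX : equal_in_distribution P P0 X xi.

Lemma ge0_integral_transfer (f : R -> \bar R) : measurable_fun setT f ->
  (forall x, 0 <= f x)%E -> (\int[P]_w f (X w) = \int[P0]_w f (xi w))%E.
Proof.
move=> mf f0; rewrite -(ge0_integral_distribution X mf f0) -(ge0_integral_distribution xi mf f0).
by apply: eq_measure_integral => A mA _; exact: eqX.
Qed.

Lemma integral_transfer (f : R -> \bar R) : measurable_fun setT f ->
  (\int[P]_w f (X w) = \int[P0]_w f (xi w))%E.
Proof.
move=> mf.
have pos := ge0_integral_transfer (measurable_funepos mf) (fun x => funepos_ge0 f x).
have neg := ge0_integral_transfer (measurable_funeneg mf) (fun x => funeneg_ge0 f x).
rewrite [LHS]integralE [RHS]integralE; congr (_ - _)%E.
  apply: etrans (etrans pos _); apply: eq_integral => w _; by rewrite !funeposE.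
by apply: etrans (etrans neg _); apply: eq_integral => w _; rewrite !funenegE.
Qed.

Lemma mean_transfer (f : R -> R) : measurable_fun setT f ->
  mean P (fun w => f (X w)) = mean P0 (fun w => f (xi w)).
Proof.
move=> mf; rewrite /mean /Rintegral; congr fine.
by apply: (integral_transfer (f := EFin \o f)); apply/measurable_EFinP.
Qed.

Lemma intg_transfer (f : R -> R) : measurable_fun setT f ->
  intg P0 (fun w => f (xi w)) -> intg P (fun w => f (X w)).
Proof.
move=> mf /integrableP[_ i0]; apply/integrableP; split.
  by apply/measurable_EFinP; exact: measurableT_comp.
apply: le_lt_trans i0; rewrite le_eqVlt; apply/orP; left; apply/eqP.
apply: (@ge0_integral_transfer (fun x => `|(f x)%:E|%E)) => //.
by apply: measurableT_comp => //; apply/measurable_EFinP.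
Qed.

End Transfer.

Section Moments.
Context d (T : measurableType d) (R : realType) (P : probability T R) (xi : {RV P >-> R}).

Lemma mean_expectation (X : T -> R) : mean P X = fine 'E_P[X].
Proof. by rewrite unlock. Qed.

Lemma mean_sqr_variance : ('E_P[xi] = 0)%E -> mean P (fun w => xi w ^+ 2) = fine 'V_P[xi].
Proof.
move=> E0; rewrite mean_expectation /variance covariance.unlock E0 /=; congr (fine (expectation P _)).
by apply/funext => w /=; rewrite /GRing.mul /= subr0 expr2.
Qed.

Lemma mean_mgf s : mean P (fun w => expR (s * xi w)) = fine ('M_P xi s).
Proof.
rewrite mean_expectation /mmt_gen_fun; congr (fine (expectation P _)).
by apply/funext => w /=; rewrite /GRing.mulr_fun /= mulrC.
Qed.

Lemma intg_mgf s : ('M_P xi s < +oo)%E -> intg P (fun w => expR (s * xi w)).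
Proof.
rewrite /mmt_gen_fun unlock => Ms.
apply/integrableP; split.
  apply/measurable_EFinP; apply: measurableT_comp => //.
  by apply: measurable_funM => //.
apply: le_lt_trans Ms; rewrite le_eqVlt; apply/orP; left; apply/eqP.
apply: eq_integral => w _ /=.
by rewrite ger0_norm ?expR_ge0// /GRing.mulr_fun mulrC.
Qed.

End Moments.

Lemma indicator_mean_prod d (T : measurableType d) (R : realType) (P : probability T R)
    (xs : nat -> {RV P >-> R}) : mutually_independent P xs ->
  forall (n : nat) (B : nat -> set R), (forall i, measurable (B i)) ->
  mean P (fun w => \prod_(j < n) \1_(B j) (xs j w)) =
  \prod_(j < n) mean P (fun w => \1_(B j) (xs j w)).
Proof.
move=> ind n B mB.
have mpre j : measurable (xs j @^-1` B j).
  by rewrite -[_ @^-1` _]setTI; exact: measurable_funPT.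
have m1 j : mean P (fun w => \1_(B j) (xs j w)) = fine (P (xs j @^-1` B j)).
  by rewrite -mean_indic.
have := ind (iota 0 n) B (iota_uniq 0 n) mB => H.
transitivity (fine (P (\bigcap_(i in [set` iota 0 n]) (xs i @^-1` B i)))).
  rewrite -mean_indic; last by apply: bigcap_measurableType => k _; exact: mpre.
  congr mean; apply/funext => w; rewrite indicE.
  have [|] := boolP (w \in _).
    rewrite inE => hw; rewrite big1// => j _; rewrite indicE mem_set//.
    by apply: hw; rewrite /= mem_iota /= add0n.
  rewrite notin_setE => hw; apply/eqP/prodf_eq0.
  apply: contrapT => hn; apply: hw => i /=; rewrite mem_iota /= add0n => i_n.
  apply: contrapT => hi; apply: hn; exists (Ordinal i_n) => //=.
  by rewrite indicE memNset.
rewrite H -{1}(subn0 n) -/(index_iota 0 n) big_mkord.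
rewrite (eq_bigr (fun j : 'I_n => (mean P (fun w => \1_(B j) (xs j w)))%:E)); last first.
  by move=> j _; rewrite m1 fineK// fin_num_measure.
elim: n {H} => [|n IH]; first by rewrite !big_ord0.
by rewrite !big_ord_recr /= -IH fineM//; elim: n {IH} => [|n IH]; rewrite ?big_ord0// big_ord_recr /= fin_numM.
Qed.

Lemma powR_ge_eventually (R : realType) (B k : R) : 0 < k ->
  \forall n \near \oo, B <= (n%:R : R) `^ k.
Proof.
move=> k0; near=> n.
have nB : (1 + `|B|) `^ k^-1 <= n%:R by near: n; exact: nbhs_infty_ger.
have B0 : 0 <= 1 + `|B| by rewrite addr_ge0.
apply: (@le_trans _ _ (1 + `|B|)); first by have := ler_norm B; lra.
have -> : 1 + `|B| = ((1 + `|B|) `^ k^-1) `^ k.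
  by rewrite -powRrM mulVf ?lt0r_neq0// powRr1.
by apply: ge0_ler_powR => //; rewrite ?nnegrE ?powR_ge0 ?ler0n ?(ltW k0).
Unshelve. all: by end_near. Qed.

Lemma ln_powR_le_eventually (R : realType) (a k : R) : 0 < a -> 0 < k ->
  \forall n \near \oo, (ln n%:R) `^ a <= (n%:R : R) `^ k.
Proof.
(* Writing ln n as e^-1 ln (n^e), both factors are eventually at most n^e, so ln n <= n^(k / a). *)
move=> a0 k0; pose e := k / a / 2.
have e0 : 0 < e by rewrite !divr_gt0.
near=> n.
have n1 : 1 <= n%:R :> R by near: n; exact: nbhs_infty_ger.
have n0 : 0 < n%:R :> R by lra.
have ne : e^-1 <= (n%:R : R) `^ e by near: n; exact: powR_ge_eventually.
have L : ln n%:R <= (n%:R : R) `^ (k / a).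
  have -> : k / a = e + e by rewrite /e; field; rewrite lt0r_neq0.
  rewrite powRD; last by rewrite (lt0r_neq0 n0) implybT.
  have -> : ln (n%:R : R) = e^-1 * ln ((n%:R : R) `^ e).
    by rewrite ln_powR mulKf// lt0r_neq0.
  apply: ler_pM => //; first by rewrite invr_ge0 ltW.
    by rewrite ln_ge0// -[leLHS](powRr0 (n%:R : R)) ler_powR// ltW.
  by apply: ltW; apply: ln_sublinear; exact: powR_gt0.
have -> : (n%:R : R) `^ k = ((n%:R : R) `^ (k / a)) `^ a.
  by rewrite -powRrM divfK// lt0r_neq0.
by apply: ge0_ler_powR => //; rewrite ?nnegrE ?powR_ge0 ?ln_ge0 ?(ltW a0).
Unshelve. all: by end_near. Qed.

Lemma le_of_quadratic_bound (R : realType) (t v y : R) : 1 <= t -> 0 < v ->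
  256 * (2 * t + 2 * (v + 4) * (t + 1) + 1) ^+ 2 <= y -> t <= y.
Proof.
move=> t1 v0; have := mulr_ge0 (ltW v0) (le_trans ler01 t1).
have -> : 2 * t + 2 * (v + 4) * (t + 1) + 1 = 2 * (v * t) + 2 * v + 10 * t + 9 by ring.
move: (v * t) => vt vt0 cy; set a := _ + 9 in cy.
have ta : t <= a by rewrite /a; lra.
have : a * 1 <= a * a by rewrite ler_wpM2l//; move: ta t1; lra.
by rewrite -expr2; move: ta t1 cy; move: (a ^+ 2) => b; lra.
Qed.

Section Limit.
Context d0 (T0 : measurableType d0) d (T : measurableType d) (R : realType).
Variables (P0 : probability T0 R) (P : probability T R).
Variables (xi : {RV P0 >-> R}) (xs : nat -> {RV P >-> R}) (t gamma delta v : R).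
Hypotheses (t1 : 1 <= t) (gamma_half : 2^-1 < gamma) (delta0 : 0 < delta).
Hypothesis E0 : ('E_P0[xi] = 0)%E.
Hypothesis vE : mean P0 (fun w => xi w ^+ 2) = v.
Hypothesis v0 : 0 < v.
Hypothesis Mfin : forall s, `|s| <= delta -> ('M_P0 xi s < +oo)%E.
Hypothesis ind : mutually_independent P xs.
Hypothesis eqd : forall k, equal_in_distribution P P0 (xs k) xi.

Let iexp0 s : `|s| <= delta -> intg P0 (fun w => expR (s * xi w)).
Proof. by move=> /Mfin; exact: intg_mgf. Qed.

Let mxi : measurable_fun setT xi. Proof. exact: measurable_funPT. Qed.

Let mean0 : mean P0 xi = 0. Proof. by rewrite mean_expectation E0. Qed.

Lemma mgf_second_order : second_order_at0 (fun s => fine ('M_P0 xi s)) v.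
Proof.
have [C HC] := mgf_third_order mxi delta0 iexp0 mean0 vE.
exists C, (delta / 2); split; first by rewrite divr_gt0.
by move=> s sd; rewrite -mean_mgf; exact: HC.
Qed.

Lemma small_min_event_pr : \forall n \near \oo,
  (P (small_min_event (fun k => xs k : T -> R) t gamma n) <=
  ((3072 * (2 * t + 2 * (v + 4) * (t + 1) + 1) ^+ 2 * (2 + 288 / (v / 4)) ^+ 2 + 24) *
    (ln n%:R) `^ (- gamma + 2^-1))%:E)%E.
Proof.
have g0 : 0 < gamma by move: gamma_half; lra.
pose ps := psi P0 xi.
have mX j : measurable_fun setT (xs j : T -> R) by exact: measurable_funPT.
have psE j x : psi P (xs j) x = ps x.
  rewrite /psi /ecos /esin.
  rewrite (mean_transfer (f := fun z => cos (x * z)) (eqd j)).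
    rewrite (mean_transfer (f := fun z => sin (x * z)) (eqd j))//.
    exact: (@measurable_sinM _ R R id).
  exact: (@measurable_cosM _ R R id).
have [c0 c00 quad] := psi_quad_near0 mxi (intg_pow1 mxi delta0 iexp0)
  (intg_pow2 mxi delta0 iexp0) (intg_pow4 mxi delta0 iexp0) mean0 vE v0.
pose c := v / 4.
have c1 : 0 < c by rewrite divr_gt0.
pose C1 := 2 / Num.sqrt c.
have C10 : 0 <= C1 by rewrite divr_ge0// sqrtr_ge0.
have cluster := psi_cluster mxi c1 quad.
have [s1' s10 sub'] := second_order_subgauss v0 mgf_second_order.
pose s1 := Num.min s1' delta.
have s1p : 0 < s1 by rewrite lt_min s10.
have sub s : `|s| <= s1 -> mean P0 (fun w => expR (s * xi w)) <= expR (v * s ^+ 2).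
  by rewrite le_min => /andP[h _]; rewrite mean_mgf; exact: sub'.
have iex s : `|s| <= s1 -> intg P0 (fun w => expR (s * xi w)).
  by rewrite le_min => /andP[_]; exact: iexp0.
have mexp s : measurable_fun setT (fun z : R => expR (s * z)).
  by apply: measurableT_comp => //; exact: measurable_funM.
have mabs : measurable_fun setT (fun z : R => `|z|) by exact: measurableT_comp.
pose m1 := mean P0 (fun w => `|xi w|).
have ix0 := intg_norm mxi delta0 iexp0.
pose ct := 2 * t + 2 * (v + 4) * (t + 1) + 1.
(* Every quantity that depends on more than [t] and the variance ([c0], [C1] / [c0], [m1], [s1])
   enters only through this threshold for y = n^(1/80). *)
pose K := Num.max (Num.max (Num.max (100 * 100 * 100) (100 * 100 * 100 / c0))
    (Num.max (100 * 100 * 100 * C1) (100 * 100 * 100 * C1 / c0)))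
  (Num.max (Num.max (100 * 100 * 100 / c) (2 + 4 / c)) (Num.max (256 * ct ^+ 2) (Num.max m1 s1^-1))).
near=> n.
have Ky : K <= (n%:R : R) `^ 80^-1 by near: n; apply: powR_ge_eventually; rewrite invr_gt0.
have Ly1 : ln n%:R `^ 1 <= (n%:R : R) `^ 80^-1.
  by near: n; apply: ln_powR_le_eventually; rewrite ?invr_gt0.
have LGy : ln n%:R `^ gamma <= (n%:R : R) `^ 80^-1.
  by near: n; apply: ln_powR_le_eventually; rewrite ?invr_gt0.
have n3 : expR 1 <= n%:R :> R by near: n; exact: nbhs_infty_ger.
pose y := (n%:R : R) `^ 80^-1.
move: Ky; rewrite -/y !ge_max => /andP[/andP[/andP[y1 y2] /andP[y3 y4]] /andP[/andP[y5 y6] /and3P[y7 y8 y9]]].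
have L1 : 1 <= ln n%:R :> R.
  by rewrite -[leLHS](expRK 1) ler_ln ?posrE ?expR_gt0// (lt_le_trans (expR_gt0 1)).
have L0 := le_trans ler01 L1.
have Lpos := lt_le_trans ltr01 L1.
have Ly : ln n%:R <= y by rewrite -[leLHS]powRr1.
have n0 : (0 : R) <= n%:R by exact: ler0n.
have nE : n%:R = y ^+ 80.
  by rewrite -powR_mulrn ?powR_ge0// -powRrM mulVf// powRr1.
have ypos : 0 < y by apply: lt_le_trans y1; rewrite !mulr_gt0.
have npos : (0 : R) < n%:R by rewrite nE exprn_gt0.
pose Lh := (ln n%:R : R) `^ 2^-1.
pose LG := (ln n%:R : R) `^ gamma.
have Lh2 : Lh ^+ 2 = ln n%:R.
  by rewrite /Lh -powR_mulrn ?powR_ge0// -powRrM mulVf// powRr1.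
have Lh1 : 1 <= Lh by rewrite -[leLHS](powRr0 (ln n%:R : R)) ler_powR.
have LG1 : 1 <= LG by rewrite -[leLHS](powRr0 (ln n%:R : R)) ler_powR// ltW.
have expE : expR (- (4 * Lh ^+ 2)) = (y ^+ 320)^-1.
  rewrite Lh2 expRN mulrC expRM_natr lnK ?posrE// nE -exprM//.
have yc0 k : k / c0 <= y -> k <= c0 * y by rewrite ler_pdivrMr// mulrC.
have ev : small_min_event (fun k => xs k : T -> R) t gamma n =
    [set w | min_modulus (fun k => xs k w) n (t * (y ^+ 160 * (Lh * LG))^-1) <= t * (y ^+ 40 * LG)^-1].
  have rE : t * n%:R `^ (-2) * ln n%:R `^ (- 2^-1 - gamma) = t * (y ^+ 160 * (Lh * LG))^-1.
    rewrite -mulrA; congr (t * _); rewrite powRN powRB; last by rewrite (lt0r_neq0 Lpos) implybT.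
    rewrite powRN -/Lh -/LG powR_mulrn// nE -exprM.
    by rewrite !invfM.
  have qE : t * n%:R `^ (- 2^-1) * ln n%:R `^ (- gamma) = t * (y ^+ 40 * LG)^-1.
    rewrite -mulrA; congr (t * _); rewrite !powRN -/LG invfM; congr (_^-1 * _).
    rewrite -powR_mulrn ?powR_ge0// -powRrM; congr (_ `^ _).
    by rewrite -[80%N]/(2 * 40)%N natrM invfM divfK ?pnatr_eq0//.
  by rewrite /small_min_event rE qE.
have t0 : 0 < t := lt_le_trans ltr01 t1.
have h0 : 0 < y ^+ 160 * (Lh * LG).
  by apply: mulr_gt0; [exact: exprn_gt0|apply: mulr_gt0; exact: powR_gt0].
have r01 : 0 < t * (y ^+ 160 * (Lh * LG))^-1 <= 1.
  rewrite divr_gt0//= ler_pdivrMr// mul1r; apply: le_trans (le_of_quadratic_bound t1 v0 y7) _.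
  apply: (@le_trans _ _ (y ^+ 160 * 1)).
    by rewrite mulr1 -[leLHS]expr1 ler_powr//; apply: le_trans y1; rewrite !mulr_ege1// ler1n.
  by rewrite ler_wpM2l ?exprn_ge0 ?(ltW ypos)// mulr_ege1.
rewrite ev {ev} -[leLHS]fineK ?fin_num_measure//; last exact: measurable_min_modulus.
rewrite lee_fin -/(pr P _).
have := @min_modulus_pr _ _ _ P (fun j => xs j) mX (indicator_mean_prod ind) ps psE c c0 C1 v s1 m1
  (psi_ge0 P0 mxi) quad cluster c1 c00 C10
  (fun j s hs => intg_transfer (eqd j) (mexp s) (iex s hs)) _ (ltW v0)
  (fun j => intg_transfer (eqd j) mabs ix0) _ y Lh LG t n y1 nE (yc0 _ y2) y3 (yc0 _ y4) _ y6
  Lh1 _ LG1 LGy t1 y7 y8 _ expE.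
move=> H. apply: le_trans (H _ _ _ _ _) _ => {H}.
- by move=> j s hs; rewrite (mean_transfer (eqd j) (mexp s)); exact: sub.
- by move=> j; rewrite (mean_transfer (eqd j) mabs).
- by rewrite [leRHS]mulrC -ler_pdivrMr.
- by rewrite Lh2.
- by rewrite [leRHS]mulrC -ler_pdivrMr// div1r.
rewrite le_eqVlt; apply/orP; left; apply/eqP; congr (_ * _).
by rewrite addrC powRB//; rewrite (lt0r_neq0 Lpos) implybT.
Unshelve. all: by end_near. Qed.

End Limit.

Theorem theorem2p3 (R : realType) (t : R) (M : R -> \bar R) (ht : 1 <= t) :
  exists C : R,
  forall (d0 : measure_display) (T0 : measurableType d0)
    (P0 : probability T0 R) (xi : {RV P0 >-> R})
    (d : measure_display) (T : measurableType d)
    (P : probability T R) (xs : nat -> {RV P >-> R}) (gamma : R),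
  ('E_P0[xi] = 0)%E ->
  (0 < 'V_P0[xi] < +oo)%E ->
  (exists2 delta : R, 0 < delta &
     forall s : R, `|s| < delta -> ('M_P0 xi s < +oo)%E) ->
  (forall s : R, 'M_P0 xi s = M s) ->
  mutually_independent P xs ->
  (forall k : nat, equal_in_distribution P P0 (xs k) xi) ->
  2^-1 < gamma ->
  \forall n \near \oo,
    (P (small_min_event (fun k => xs k : T -> R) t gamma n)
       <= (C * (ln n%:R) `^ (- gamma + 2^-1))%:E)%E.
Proof.
have key d0 (T0 : measurableType d0) (P0 : probability T0 R) (xi : {RV P0 >-> R}) :
    ('E_P0[xi] = 0)%E -> (0 < 'V_P0[xi] < +oo)%E ->
    (exists2 delta : R, 0 < delta & forall s : R, `|s| < delta -> ('M_P0 xi s < +oo)%E) ->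
    (forall s : R, 'M_P0 xi s = M s) ->
    0 < fine 'V_P0[xi] /\ second_order_at0 (fun s => fine (M s)) (fine 'V_P0[xi]).
  move=> E0 V0 [delta d0' Md] ME; split; first exact: fine_gt0.
  have d2 : 0 < delta / 2 by rewrite divr_gt0.
  rewrite -(_ : (fun s => fine ('M_P0 xi s)) = (fun s => fine (M s))); last first.
    by apply/funext => s; rewrite ME.
  apply: (mgf_second_order d2 E0 (mean_sqr_variance E0)) => s sd; apply: Md.
  by apply: le_lt_trans sd _; lra.
(* The constant must be chosen from [M] alone: take the positive second-order coefficient of [M] at
   0 if there is one. Otherwise no admissible law has moment generating function [M], and 0 serves
   vacuously. *)
have [[v [v0 Hv]]|no] := pselect (exists v, 0 < v /\ second_order_at0 (fun s => fine (M s)) v); last first.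
  exists 0 => d0 T0 P0 xi d T P xs gamma E0 V0 Md ME; exfalso; apply: no.
  by exists (fine 'V_P0[xi]); exact: (key _ _ _ _ E0 V0 Md ME).
exists (3072 * (2 * t + 2 * (v + 4) * (t + 1) + 1) ^+ 2 * (2 + 288 / (v / 4)) ^+ 2 + 24).
move=> d0 T0 P0 xi d T P xs gamma E0 V0 Md ME ind eqd hg.
have [_ HV] := key _ _ _ _ E0 V0 Md ME.
have vE : fine 'V_P0[xi] = v.
  by apply/eqP; rewrite eq_le (second_order_unique HV Hv) (second_order_unique Hv HV).
have [delta d0' Mfin] := Md.
have d2 : 0 < delta / 2 by rewrite divr_gt0.
apply: (@small_min_event_pr _ T0 _ T R P0 P xi xs t gamma (delta / 2) v) => //.
  by rewrite mean_sqr_variance.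
by move=> s sd; apply: Mfin; apply: le_lt_trans sd _; lra.
Qed.
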